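(* Let $d\ge 1$ and let $a:\mathbb{Z}^d\to\mathbb{R}$ be the transition intensities of a continuous-time random walk on $\mathbb{Z}^d$ as described in the context, satisfying for some $\alpha\in(0,2)$ the asymptotic condition \[ a(z)\sim\frac{H\!\left(\frac{z}{|z|}\right)}{|z|^{d+\alpha}}\quad\text{as } |z|\to\infty, \] where $H$ is a continuous, positive, symmetric function on the unit sphere $\mathbb{S}^{d-1}=\{z\in\mathbb{R}^d: |z|=1\}$. Let $G_\lambda=G_\lambda(0,0)=\int_0^\infty e^{-\lambda t}p(t,0,0)\,dt$ and $G_0=G_0(0,0)$. Then, as $\lambda\downarrow 0$, the following asymptotic equalities hold: \begin{itemize} \item[(i)] $G_{\lambda}\sim\gamma_{d,\alpha}\lambda^{\frac{1-\alpha}{\alpha}}$ for $d=1$, $\alpha\in(1,2)$; \item[(ii)] $G_{\lambda}\sim -\gamma_{d,\alpha}\ln \lambda$ for $d=1$, $\alpha=1$; \item[(iii)] $G_{\lambda}-G_{0}\sim-\gamma_{d,\alpha}\lambda^{\frac{d-\alpha}{\alpha}}$ for $d=1$, $\alpha\in(\frac{1}{2},1)$, or $d=2$, $\alpha\in(1,2)$, or $d=3$, $\alpha\in(\frac{3}{2},2)$; \item[(iv)] $G_{\lambda}-G_{0}\sim\gamma_{d,\alpha}\lambda\ln\lambda$ for $d=1$, $\alpha=\frac{1}{2}$, or $d=2$, $\alpha=1$, or $d=3$, $\alpha=\frac{3}{2}$; \item[(v)] $G_{\lambda}-G_{0}\sim-\gamma_{d,\alpha}\lambda$ for $d=1$,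 $\alpha\in(0,\frac{1}{2})$, or $d=2$, $\alpha\in(0,1)$, or $d=3$, $\alpha\in(0,\frac{3}{2})$, or $d\ge4$, $\alpha\in(0,2)$, \end{itemize} where in each case $\gamma_{d,\alpha}$ is some positive constant (depending on $d$ and $\alpha$).
   Context: The random walk on $\mathbb{Z}^d$ is given by a matrix $A=(a(x,y))_{x,y\in\mathbb{Z}^d}$ of transition intensities with $a(x,y)\ge 0$ for $x\ne y$, $a(x,x)<0$, $a(x,y)=a(y,x)=a(0,y-x)=:a(y-x)$ (symmetric and space-homogeneous), $\sum_z a(z)=0$, and $A$ irreducible: every $z\in\mathbb{Z}^d$ can be written as $z=\sum_{i=1}^k z_i$ with $a(z_i)\ne0$ for all $i$. Here $|z|$ is the Euclidean norm. $p(t,x,y)$ denotes the transition probability of this continuous-time Markov random walk (from $x$ to $y$ in time $t$), and $G_\lambda(x,y)=\int_0^\infty e^{-\lambda t}p(t,x,y)\,dt$, $\lambda\ge0$, is its Green function (possibly $+\infty$ at $\lambda=0$). Under the hypotheses, $G_0=\infty$ in cases (i),(ii) and $G_0<\infty$ in cases (iii)–(v). For functions, $f\sim g$ means $f/g\to1$. *)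

(* Defs.v *)
From HB Require Import structures.
From mathcomp Require Import all_boot all_order all_algebra.
From mathcomp Require Import all_classical all_reals all_analysis.
Set Implicit Arguments. Unset Strict Implicit. Unset Printing Implicit Defensive.
Import Order.TTheory GRing.Theory Num.Theory.
Import numFieldNormedType.Exports.
Local Open Scope classical_set_scope.
Local Open Scope ring_scope.

Section RW.
Variables (R : realType) (d : nat).

Definition enorm (u : 'rV[R]_d) : R := Num.sqrt (\sum_(i < d) (u 0 i) ^+ 2).
Definition znorm (z : 'rV[int]_d) : R := Num.sqrt (\sum_(i < d) ((z 0 i)%:~R : R) ^+ 2).
Definition zdir (z : 'rV[int]_d) : 'rV[R]_d := \row_i (((z 0 i)%:~R : R) / znorm z).
Definition usphere : set 'rV[R]_d := [set u | enorm u = 1].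

Definition rw_intensity (a : 'rV[int]_d -> R) : Prop :=
  [/\ (forall z, z != 0 -> 0 <= a z),
      a 0 < 0,
      (forall z, a (- z) = a z),
      (\esum_(z in [set z : 'rV[int]_d | z != 0%R]) (a z)%:E)%E = (- a 0)%:E
    & (forall z, exists s : seq 'rV[int]_d,
          all (fun w => a w != 0) s /\ z = \sum_(w <- s) w)].

Definition jump_rate (a : 'rV[int]_d -> R) : R := - a 0.
Definition jump_kernel (a : 'rV[int]_d -> R) (z : 'rV[int]_d) : R :=
  if z == 0 then 0 else a z / jump_rate a.

Fixpoint convpow (P : 'rV[int]_d -> R) (n : nat) : 'rV[int]_d -> \bar R :=
  match n with
  | 0 => fun x => ((x == 0)%:R)%:E
  | n'.+1 => fun x => (\esum_(y in [set: 'rV[int]_d]) (convpow P n' y * (P (x - y)%R)%:E))%E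
  end.

(* p(t, 0, x) = (e^{tA})(0,x) written as the (uniformized) Poisson series
   sum_n e^{-qt} (qt)^n / n! P^{*n}(x) *)
Definition trans_prob (a : 'rV[int]_d -> R) (t : R) (x : 'rV[int]_d) : \bar R :=
  (\esum_(n in [set: nat])
     ((expR (- (jump_rate a * t)) * (jump_rate a * t) ^+ n / (n`!)%:R)%:E
        * convpow (jump_kernel a) n x))%E.

Definition green (a : 'rV[int]_d -> R) (lam : R) : \bar R :=
  (\int[lebesgue_measure]_(t in `[0%R, +oo[)
      ((expR (- (lam * t)))%:E * trans_prob a t 0))%E.

End RW.

Definition equiv0 (R : realType) (f g : R -> R) : Prop :=
  (fun x => f x / g x) @ 0%R^'+ --> (1 : R).

(* Main.v *)
(* The Fourier representation p(t,0,0) = mean of exp(-t phi) over the torus, with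
   phi(xi) = sum_z a(z) (1 - cos(z.xi)), reduces everything to the behaviour of phi
   near 0. Written as a Riemann sum of mesh s, s^(-alpha) phi(s xi) converges to
   the symbol Phi(xi) of a stable law, and phi(xi) >= c |xi|^alpha on the torus;
   dominated convergence then gives t^(d/alpha) p(t,0,0) -> C > 0. With
   beta = d/alpha, the five cases are Abelian theorems for the Laplace transform of
   a function equivalent to C t^(-beta), according to the position of beta with
   respect to 1 and 2: for beta < 2 with beta <> 1 rescale t by lambda and use dominated
   convergence, for beta = 1, 2 a logarithm comes from lambda < t lambda < 1, and for
   beta > 2 the first moment of p is finite. *)
Require Import Defs.
From HB Require Import structures.
From mathcomp Require Import all_boot all_order all_algebra.
From mathcomp Require Import all_classical all_reals all_analysis.
From mathcomp Require Import measurable_realfun.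
From mathcomp Require Import ring lra zify.
Import Order.TTheory GRing.Theory Num.Theory.
Import numFieldNormedType.Exports.
Local Open Scope classical_set_scope.
Local Open Scope ring_scope.
Set Implicit Arguments.
Unset Strict Implicit.
Unset Printing Implicit Defensive.

(** * Sums, power integrals and product measures *)

(** Every sum in the definitions is an [\esum], faithful only to nonnegative terms, whereas cosines
    and powers of a characteristic function change sign. In the Fourier part the constant 1 is
    therefore added to each signed quantity (1 + cos, 1 + c^n, 1 + h), Tonelli is applied to the
    nonnegative result, and the contribution of the constant is cancelled afterwards. Symmetry of
    the walk keeps everything real, so cosines replace complex exponentials. The torus is taken as
    the box of half-side pi / s with an arbitrary scale s > 0. The return probability does not
    depend on s, so choosing s = t^(-1/alpha) performs the rescaling of the local limit theorem
    without a change of variables in dimension d. Besides measurability and 0 < p <= 1, the Abelian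
    part retains two facts on the return probability p: the bound p(t) <= K t^(-beta) for all t > 0,
    which supplies the majorants, and the limit C of t^beta p(t). The kernel is e^(-u) for G_lam and
    1 - e^(-u) for G_0 - G_lam; the latter is of order u at 0, which moves the critical exponent
    from beta = 1 to beta = 2. *)

Section esum_countable.
Context (R : realType) (I : countType).
Local Open Scope ereal_scope.

(** Turns an unordered sum into a series over [nat], where monotone convergence is available;
    integers that code no element contribute the default 0. *)
Lemma esum_pickle (f : I -> \bar R) : (forall i, 0 <= f i) ->
  \esum_(i in [set: I]) f i = \sum_(n <oo) oapp f 0 (pickle_inv n).
Proof.
move=> f0; rewrite nneseries_esumT; last first.
  by move=> n; case: (pickle_inv n).
have pinj : injective (@pickle I) by exact: pcan_inj pickleK.
transitivity (\esum_(n in range (@pickle I)) oapp f 0 (pickle_inv n)).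
  rewrite esum_image; last by move=> x y _ _; exact: pinj.
  by apply: eq_esum => i _; rewrite pickleK_inv.
rewrite esum_mkcond; apply: eq_esum => n _.
case: ifPn => //; rewrite notin_setE => nP.
case E : (pickle_inv n) => [x|//]; exfalso; apply: nP; exists x => //.
by have := @pickle_invK I n; rewrite E.
Qed.

Context {d : measure_display} (T : measurableType d).

Lemma measurable_fun_esum (D : set T) (f : I -> T -> \bar R) :
  (forall i x, D x -> 0 <= f i x) -> (forall i, measurable_fun D (f i)) ->
  measurable_fun D (fun x => \esum_(i in [set: I]) f i x).
Proof.
move=> f0 mf.
have mf' n : measurable_fun D (fun x => oapp (f ^~ x) 0 (pickle_inv n)).
  by case: (pickle_inv n).
have f0' n x : D x -> 0 <= oapp (f ^~ x) 0 (pickle_inv n).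
  by move=> Dx; case: (pickle_inv n) => //= i; exact: f0.
apply: (eq_measurable_fun (fun x => \sum_(n <oo | n \in predT)
    oapp (f ^~ x) 0 (pickle_inv n))).
  move=> x; rewrite inE => Dx; by rewrite esum_pickle// => i; exact: f0.
by apply: ge0_emeasurable_sum => // n x Dx _; exact: f0'.
Qed.

Lemma ge0_integral_esum (mu : {measure set T -> \bar R}) (D : set T)
    (f : I -> T -> \bar R) : measurable D ->
  (forall i x, D x -> 0 <= f i x) -> (forall i, measurable_fun D (f i)) ->
  \int[mu]_(x in D) (\esum_(i in [set: I]) f i x) =
  \esum_(i in [set: I]) \int[mu]_(x in D) f i x.
Proof.
move=> mD f0 mf.
have f0' n x : D x -> 0 <= oapp (f ^~ x) 0 (pickle_inv n).
  by move=> Dx; case: (pickle_inv n) => //= i; exact: f0.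
transitivity (\int[mu]_(x in D)
    (\sum_(n <oo) oapp (f ^~ x) 0 (pickle_inv n))).
  apply: eq_integral => x /[!inE] Dx.
  by rewrite esum_pickle// => i; exact: f0.
rewrite integral_nneseries//; last by move=> n; case: (pickle_inv n).
rewrite esum_pickle; last by move=> i; apply: integral_ge0 => x; exact: f0.
apply: eq_eseriesr => n _; case: (pickle_inv n) => //=.
by rewrite integral0.
Qed.

Lemma esumZl (f : I -> \bar R) (c : R) : (0 <= c)%R -> (forall i, 0 <= f i) ->
  \esum_(i in [set: I]) (c%:E * f i) = c%:E * \esum_(i in [set: I]) f i.
Proof.
move=> c0 f0; rewrite !esum_pickle//; last first.
  by move=> i; rewrite mule_ge0.
rewrite -nneseriesZl//; last by move=> n _; case: (pickle_inv n).
by apply: eq_eseriesr => n _; case: (pickle_inv n) => //=; rewrite mule0.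
Qed.

(** Serves to bound the symbol from below by its terms over a cube of lattice points. *)
Lemma finite_le_esum (J : finType) (e : J -> I) (f : I -> \bar R) :
  injective e -> (forall i, 0 <= f i) ->
  \sum_(j : J) f (e j) <= \esum_(i in [set: I]) f i.
Proof.
move=> inje f0.
have -> : \sum_(j : J) f (e j) = \esum_(j in [set: J]) f (e j).
  rewrite esum_fset//; last exact: finite_finset.
  rewrite fsbig_finite/=; last exact: finite_finset.
  rewrite -big_enum/=; apply: perm_big.
  apply: uniq_perm; [exact: enum_uniq|exact: finmap.fset_uniq|].
  move=> j; rewrite mem_enum in_fset_set; last exact: finite_finset.
  by rewrite in_setT.
rewrite -(@esum_image _ _ _ _ e f); last by move=> x y _ _; exact: inje.
rewrite esum_mkcond; apply: le_esum => i _; case: ifP => //.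
Qed.

End esum_countable.

Section real_line.
Context {R : realType}.
Implicit Types (a b c s L x : R) (k : int).
Local Notation mu := (@lebesgue_measure R).

(** By uniqueness of Lebesgue measure: the left side is a measure that gives each interval its
    length. *)
Lemma lebesgue_measure_scale c (A : set R) : 0 < c -> measurable A ->
  (c%:E * pushforward mu (( *%R c) : measurableTypeR R -> measurableTypeR R) A
   = mu A)%E.
Proof.
move=> c0 mA.
have mc : measurable_fun [set: measurableTypeR R]
    (( *%R c) : measurableTypeR R -> measurableTypeR R).
  exact: (@measurable_funM _ _ R _ (cst c) id).
pose phi : {mfun (measurableTypeR R) >-> (measurableTypeR R)} :=
  HB.pack (( *%R c) : measurableTypeR R -> measurableTypeR R)
    (isMeasurableFun.Build _ _ _ _ _ mc).
have -> : (c%:E * pushforward mu (( *%R c) : measurableTypeR R -> measurableTypeR R) A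
   = mscale (NngNum (ltW c0)) (pushforward mu phi) A)%E by [].
apply/esym/lebesgue_measure_unique => //= _ [[p q]] _ <-.
rewrite /mscale /pushforward /=.
rewrite [X in (_ * lebesgue_measure X)%E](_ : _ = `](p / c), (q / c)]%classic);
    last first.
  apply/seteqP; split => x /=; rewrite !in_itv/= ltr_pdivrMr// ler_pdivlMr//;
    by rewrite mulrC.
rewrite !lebesgue_measure_itv/= !lte_fin ltr_pM2r ?invr_gt0//.
case: ifPn => _; last by rewrite mule0.
by rewrite -!EFinB -EFinM; congr EFin; field; rewrite gt_eqF.
Qed.

(** Stated for merely measurable integrands, because the return probability enters the Abelian part
    with no more regularity than that; hence the passage through pushforward measures. *)
Lemma ge0_integral_scale c (f : R -> \bar R) : 0 < c ->
  measurable_fun [set: R] f -> (forall x, 0 <= f x)%E ->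
  (\int[mu]_(x in `[0%R, +oo[) f (c * x)%R =
   c^-1%:E * \int[mu]_(x in `[0%R, +oo[) f x)%E.
Proof.
move=> c0 mf f0.
have mc : measurable_fun [set: measurableTypeR R]
    (( *%R c) : measurableTypeR R -> measurableTypeR R).
  exact: (@measurable_funM _ _ R _ (cst c) id).
pose phi : {mfun (measurableTypeR R) >-> (measurableTypeR R)} :=
  HB.pack (( *%R c) : measurableTypeR R -> measurableTypeR R)
    (isMeasurableFun.Build _ _ _ _ _ mc).
have -> : (\int[mu]_(x in `[0%R, +oo[) f x =
    c%:E * \int[pushforward mu phi]_(x in `[0%R, +oo[) f x)%E.
  rewrite -(ge0_integral_mscale _ _ (NngNum (ltW c0)))//=.
    apply: eq_measure_integral => A mA _.
    by apply/esym; exact: (lebesgue_measure_scale c0 mA).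
  exact: measurable_funTS.
rewrite muleA -EFinM mulVf ?gt_eqF// mul1e.
rewrite ge0_integral_pushforward//; last exact: measurable_funTS.
have -> : phi @^-1` `[0%R, +oo[%classic = `[0%R, +oo[%classic => //.
by apply/seteqP; split => x /=; rewrite !in_itv/= !andbT pmulr_rge0.
Qed.

Lemma floor_cellE s k : 0 < s ->
  [set x : R | Num.floor (x / s) = k] = `[(s * k%:~R), (s * (k + 1)%:~R)[%classic.
Proof.
move=> s0; apply/seteqP.
have E x : (Num.floor (x / s) == k) = (s * k%:~R <= x < s * (k + 1)%:~R).
  by rewrite floor_eq ler_pdivlMr// ltr_pdivrMr// ![_%:~R * s]mulrC.
by split => x /=; rewrite in_itv/= -E => /eqP.
Qed.

Lemma floor_cell_measure s k : 0 < s ->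
  mu [set x : R | Num.floor (x / s) = k] = s%:E.
Proof.
move=> s0; rewrite floor_cellE// lebesgue_measure_itv/= lte_fin ltr_pM2l//.
rewrite ltr_int ltzD1 lexx -EFinB -mulrBr -intrB addrAC subrr add0r mulr1.
by [].
Qed.

Lemma floor_cell_measurable s k : 0 < s ->
  measurable [set x : R | Num.floor (x / s) = k].
Proof. by move=> s0; rewrite floor_cellE. Qed.

Lemma sin_intpi k : sin (k%:~R * pi) = 0 :> R.
Proof.
suff h n : sin (n%:R * pi) = 0 :> R.
  case: k => n; first exact: h.
  by rewrite NegzE mulrNz mulNr sinN h oppr0.
elim: n => [|n ih]; first by rewrite mul0r sin0.
by rewrite -natr1 mulrDl mul1r sinDpi ih oppr0.
Qed.

(** The primitive contains sin (c + s k x), whose values at both ends cancel since s k L is an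
    integer multiple of pi. The added 1 keeps the integrand nonnegative for Tonelli. *)
Lemma integral_1pcos (c L s : R) k : 0 < s -> L = pi / s ->
  (\int[mu]_(x in `[(- L)%R, L]) (1 + cos (c + s * k%:~R * x))%:E =
   (2 * L * (1 + (k == 0)%:R * cos c))%:E)%E.
Proof.
move=> s0 LE; have L0 : 0 < L by rewrite LE divr_gt0// pi_gt0.
have LL : - L < L by rewrite (lt_trans _ L0)// oppr_lt0.
have [->|k0] := eqVneq k 0.
  rewrite (eq_integral (cst (1 + cos c)%:E)); last first.
    by move=> x _ /=; rewrite mulr0 mul0r addr0.
  rewrite integral_cst//= lebesgue_measure_itv/= lte_fin LL.
  by rewrite -EFinB -EFinM; congr EFin; ring.
have ks : s * k%:~R != 0 :> R by apply: mulf_neq0; [rewrite gt_eqF|rewrite intr_eq0].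
pose F x : R := x + sin (c + s * k%:~R * x) / (s * k%:~R).
have dF x : is_derive x (1 : R) F (1 + cos (c + s * k%:~R * x)).
  have d1 : is_derive x (1 : R) (fun x => c + s * k%:~R * x) (s * k%:~R).
    by apply: is_derive_eq; rewrite add0r mul1r /GRing.scale /= mulr1.
  have d2 := @is_derive1_comp _ sin (fun x => c + s * k%:~R * x) x _ _
    (is_derive_sin (c + s * k%:~R * x)) d1.
  apply: is_derive_eq; rewrite !scaler0 add0r; congr (1 + _).
  by rewrite /GRing.scale /= mulrC mulfK.
have cF x : {for x, continuous F}.
  by apply: differentiable_continuous; apply/derivable1_diffP; apply: ex_derive.
rewrite (@continuous_FTC2 _ (fun x => 1 + cos (c + s * k%:~R * x)) F)//.
- rewrite -EFinB; congr EFin; rewrite /F mul0r addr0 mulr1.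
  have -> : s * k%:~R * L = k%:~R * pi by rewrite LE; field; rewrite gt_eqF.
  have -> : s * k%:~R * - L = - (k%:~R * pi) by rewrite LE; field; rewrite gt_eqF.
  rewrite sinD sinB sin_intpi mulr0 addr0 subr0; ring.
- apply: continuous_subspaceT => x.
  apply: cvgD; first exact: cvg_cst.
  apply: (@continuous_comp _ _ _ (fun x => c + s * k%:~R * x) cos); last exact: continuous_cos.
  apply: cvgD; first exact: cvg_cst.
  exact: mulrl_continuous.
- split.
  + by move=> x _; apply: ex_derive.
  + by apply: cvg_at_right_filter; exact: cF.
  + by apply: cvg_at_left_filter; exact: cF.
- by move=> x _; rewrite derive1E; exact: derive_val.
Qed.

End real_line.

(** * Integrability of powers on the half-line *)

Section power_integrals.
Context {R : realType}.
Implicit Types (a b c x : R).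
Local Notation mu := (@lebesgue_measure R).

Lemma measurable_powRl b (D : set R) : measurable_fun D (fun x : R => x `^ b).
Proof. by apply: measurable_funTS; exact: measurable_powR. Qed.

Lemma derivable_powRdiv b x : b != 1 -> 0 < x ->
  is_derive x (1 : R) (fun x => x `^ (1 - b) / (1 - b)) (x `^ (- b)).
Proof.
move=> b1 x0.
have -> : (fun x : R => x `^ (1 - b) / (1 - b)) = (1 - b)^-1 \*: (fun x => x `^ (1 - b)).
  by apply/funext => y; rewrite mulrC.
have d := @is_derive1_powR _ (1 - b) _ x0.
apply: is_derive_eq; rewrite /GRing.scale/= mulrA mulVf ?subr_eq0 1?eq_sym// mul1r.
by congr (_ `^ _); ring.
Qed.

Lemma continuous_powRx b x : 0 < x -> {for x, continuous (fun x => x `^ b)}.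
Proof.
move=> x0; apply: differentiable_continuous; apply/derivable1_diffP.
exact/(@ex_derive _ _ _ _ _ _ _ (is_derive1_powR _ x0)).
Qed.

Lemma integral_powRN_01 b : b < 1 ->
  (\int[mu]_(x in `]0%R, 1%R]) (x `^ (- b))%:E < +oo)%E.
Proof.
move=> b1.
(* The primitive is singular at 0, so the interval is exhausted from the right; [n.+2] rather than
   [n.+1] keeps the left end strictly below 1. *)
pose F n : set R := `[n.+2%:R^-1, 1]%classic.
have -> : `]0%R, 1%R]%classic = \bigcup_n F n.
  apply/seteqP; split => x; rewrite /F /=.
    rewrite in_itv/= => /andP[x0 x1].
    have [n _ hn] : \forall n \near \oo, n.+2%:R^-1 <= x.
      exists (Num.truncn x^-1) => // n /= hn.
      rewrite invf_ple ?posrE//; apply: (le_trans (ltW (truncnS_gt _))).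
      by rewrite ler_nat ltnS; apply: leq_trans (hn : (_ <= n)%N) _.
    by exists n => //=; rewrite in_itv/= x1 andbT; apply: hn => /=.
  move=> [n _] /=; rewrite !in_itv/= => /andP[h ->]; rewrite andbT.
  by apply: lt_le_trans h; rewrite invr_gt0.
have h : (\int[mu]_(x in F i) (x `^ (- b))%:E @[i --> \oo] -->
    \int[mu]_(x in \bigcup_i F i) (x `^ (- b))%:E)%E.
  apply: ge0_nondecreasing_set_cvg_integral.
  - move=> n m nm; apply/subsetPset => x; rewrite /F/= !in_itv/= => /andP[h1 ->].
    rewrite andbT; apply: le_trans h1; rewrite lef_pV2 ?posrE// ler_nat; lia.
  - by move=> n; exact: measurable_itv.
  - by move=> n; apply/measurable_EFinP; exact: measurable_powRl.
  - by move=> n x _; rewrite lee_fin powR_ge0.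
apply: (@le_lt_trans _ _ (1 / (1 - b))%:E); last exact: ltry.
apply: (cvge_le _ h).
near=> n; rewrite /F.
have n0 : 0 < n.+2%:R^-1 :> R by rewrite invr_gt0.
have bn1 : b != 1 by rewrite lt_eqF.
have dF x : 0 < x -> {for x, continuous (fun x => x `^ (1 - b) / (1 - b))}.
  move=> x0; apply: differentiable_continuous; apply/derivable1_diffP.
  by apply: ex_derive; exact: derivable_powRdiv.
rewrite (@continuous_FTC2 _ _ (fun x => x `^ (1 - b) / (1 - b)))//.
- rewrite -EFinB lee_fin powR1 lerBlDr lerDl.
  by rewrite divr_ge0 ?powR_ge0// subr_ge0 ltW.
- by rewrite invf_lt1// ltr1n.
- apply: continuous_in_subspaceT => x; rewrite inE/= in_itv/= => /andP[x1 _].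
  by apply: continuous_powRx; exact: lt_le_trans x1.
- split.
  + move=> x; rewrite in_itv/= => /andP[x1 _].
    by apply: ex_derive; apply: derivable_powRdiv => //; exact: lt_trans x1.
  + by apply: cvg_at_right_filter; exact: dF.
  + by apply: cvg_at_left_filter; exact: dF.
- move=> x; rewrite in_itv/= => /andP[x1 _]; rewrite derive1E.
  have x0 : 0 < x by exact: lt_trans x1.
  by have h' := derivable_powRdiv bn1 x0; apply: derive_val.
Unshelve. all: by end_near. Qed.

Lemma cvgy_powRN p : 0 < p -> x `^ (- p) @[x --> +oo] --> (0 : R).
Proof.
move=> p0; apply/cvgrPdist_lt => e e0; near=> x.
have x0 : 0 < x by [].
rewrite sub0r normrN ger0_norm ?powR_ge0// powRN invf_plt ?posrE ?powR_gt0//.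
have -> : e^-1 = (e^-1 `^ p^-1) `^ p.
  by rewrite -powRrM mulVf ?gt_eqF// powRr1// invr_ge0 ltW.
by rewrite gt0_ltr_powR// nnegrE ?powR_ge0// ltW.
Unshelve. all: by end_near. Qed.

Lemma integral_powRN_1y b : 1 < b ->
  (\int[mu]_(x in `[1%R, +oo[) (x `^ (- b))%:E < +oo)%E.
Proof.
move=> b1; rewrite (@ge0_continuous_FTC2y _ _ (fun x => x `^ (1 - b) / (1 - b)) _ 0).
- by rewrite -EFinB ltry.
- by move=> x _; exact: powR_ge0.
- apply: continuous_in_subspaceT => x; rewrite inE/= in_itv/= andbT => x1.
  by apply: continuous_powRx; exact: lt_le_trans x1.
- rewrite -[X in _ --> X](mul0r (1 - b)^-1); apply: cvgMl.
  by rewrite -opprB; apply: cvgy_powRN; rewrite subr_gt0.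
- move=> x x1; have x0 : 0 < x by apply: lt_trans x1.
  by apply: ex_derive; apply: derivable_powRdiv => //; rewrite gt_eqF.
- apply: cvg_at_right_filter.
  have dF : {for 1, continuous (fun x : R => x `^ (1 - b) / (1 - b))}.
    apply: differentiable_continuous; apply/derivable1_diffP.
    by apply: ex_derive; apply: derivable_powRdiv => //; rewrite gt_eqF.
  exact: dF.
- move=> x; rewrite in_itv/= andbT => x1; have x0 : 0 < x by apply: lt_trans x1.
  rewrite derive1E; have h := @derivable_powRdiv b x _ x0.
  by apply: derive_val; apply: h; rewrite gt_eqF.
Qed.

(** For a < 1 < b this is integrable both at 0 and at infinity; it is the common majorant of the
    dominated convergence arguments on the half-line. *)
Definition pmin a b x : R := Num.min (x `^ (- a)) (x `^ (- b)).

Lemma pmin_ge0 a b x : 0 <= pmin a b x.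
Proof. by rewrite le_min !powR_ge0. Qed.

Lemma measurable_pmin a b (D : set R) : measurable_fun D (pmin a b).
Proof. by apply: measurable_minr; exact: measurable_powRl. Qed.

Lemma integral_pmin a b : a < 1 -> 1 < b ->
  (\int[mu]_(x in `[0%R, +oo[) (pmin a b x)%:E < +oo)%E.
Proof.
move=> a1 b1.
rewrite -integral_itv_obnd_cbnd; last first.
  by apply/measurable_EFinP; exact: measurable_pmin.
have -> : `]0%R, +oo[%classic = `]0%R, 1%R] `|` `]1%R, +oo[ :> set R.
  by rewrite -itv_bndbnd_setU// bnd_simp.
rewrite ge0_integral_setU//=; first 1 last.
- by apply/measurable_EFinP; exact: measurable_pmin.
- by move=> x _; rewrite lee_fin pmin_ge0.
- apply/disj_setPS => x /= []; rewrite !in_itv/= andbT => /andP[_ x1].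
  by rewrite ltNge x1.
rewrite lte_add_pinfty//.
  apply: le_lt_trans (integral_powRN_01 a1).
  apply: ge0_le_integral => //.
  - by move=> x _; rewrite lee_fin pmin_ge0.
  - by apply/measurable_EFinP; exact: measurable_pmin.
  - by apply/measurable_EFinP; exact: measurable_powRl.
  - by move=> x _; rewrite lee_fin ge_min lexx.
rewrite integral_itv_obnd_cbnd; last first.
  by apply/measurable_EFinP; exact: measurable_pmin.
apply: le_lt_trans (integral_powRN_1y b1).
apply: ge0_le_integral => //.
- by move=> x _; rewrite lee_fin pmin_ge0.
- by apply/measurable_EFinP; exact: measurable_pmin.
- by apply/measurable_EFinP; exact: measurable_powRl.
- by move=> x _; rewrite lee_fin ge_min lexx orbT.
Qed.

End power_integrals.

(** * Euclidean space as an iterated product *)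

Section product_sigma_finite.
Context d1 d2 (T1 : measurableType d1) (T2 : measurableType d2) (R : realType).
Variable m1 : {sigma_finite_measure set T1 -> \bar R}.
Variable m2 : {sigma_finite_measure set T2 -> \bar R}.

(** Tonelli in dimension d + 1 needs a sigma-finite measure on the d-dimensional factor, so the
    recursive construction has to carry this property along. *)
Lemma sigma_finite_product : sigma_finite [set: T1 * T2] (m1 \x m2)%E.
Proof.
have /sigma_finiteP[F [TF ndF Foo]] := sigma_finiteT m1.
have /sigma_finiteP[G [TG ndG Goo]] := sigma_finiteT m2.
exists (fun n => F n `*` G n).
  apply/seteqP; split => // -[x y] _.
  have [n _ Fx] : (\bigcup_n F n) x by rewrite -TF.
  have [m _ Gy] : (\bigcup_n G n) y by rewrite -TG.
  exists (maxn n m) => //; split => /=.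
    by have /subsetPset := ndF _ _ (leq_maxl n m); exact.
  by have /subsetPset := ndG _ _ (leq_maxr n m); exact.
move=> n; have [mF Fn] := Foo n; have [mG Gn] := Goo n.
split; first exact: measurableX.
by rewrite /= product_measure1E// lte_mul_pinfty// ge0_fin_numE.
Qed.

Definition sf_product : {sigma_finite_measure set (T1 * T2)%type -> \bar R} :=
  HB.pack (product_measure1 m1 m2)
    (Measure_isSigmaFinite.Build _ _ _ (product_measure1 m1 m2) sigma_finite_product).

End product_sigma_finite.

(* [euclid R d] is the d-fold product of the Lebesgue measure space of [R],
   realized by nested pairs so that Tonelli's theorem gives induction on d. *)
Record sfspace (R : realType) := SFSpace {
  sfdisp : measure_display;
  sftype : measurableType sfdisp;
  sfmeasure : {sigma_finite_measure set sftype -> \bar R} }.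

Fixpoint euclid (R : realType) (d : nat) : sfspace R :=
  if d is d'.+1 then SFSpace (sf_product (@lebesgue_measure R) (sfmeasure (euclid R d')))
  else SFSpace (@dirac _ unit tt R).

Section euclid.
Context {R : realType}.
Local Notation mu := (@lebesgue_measure R).
Local Notation E d := (sftype (euclid R d)).
Local Notation vol d := (sfmeasure (euclid R d)).

Fixpoint ecoord (d : nat) : E d -> 'I_d -> R :=
  match d with
  | 0 => fun _ _ => 0
  | d'.+1 => fun x i => oapp (ecoord x.2) x.1 (unlift ord0 i)
  end.

Lemma coord0 d (x : E d.+1) : ecoord x ord0 = x.1.
Proof. by rewrite /= unlift_none. Qed.

Lemma coord_lift d (x : E d.+1) (i : 'I_d) : ecoord x (lift ord0 i) = ecoord x.2 i.
Proof. by rewrite /= liftK. Qed.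

Lemma measurable_coord d (i : 'I_d) : measurable_fun [set: E d] (@ecoord d ^~ i).
Proof.
elim: d i => [[]//|d ih i] /=.
case: (unlift ord0 i) => [j|] /=; last exact: measurable_fst.
exact: (measurableT_comp (ih j) measurable_snd).
Qed.

Arguments ecoord : simpl never.

Lemma emeasurable_prod_ord dd (T : measurableType dd) n (g : 'I_n -> T -> \bar R) :
  (forall i, measurable_fun [set: T] (g i)) ->
  measurable_fun [set: T] (fun x => \prod_(i < n) g i x)%E.
Proof.
elim: n g => [|n ih] g mg.
  by under eq_fun do rewrite big_ord0; exact: measurable_cst.
by under eq_fun do rewrite big_ord_recl; apply: emeasurable_funM => //; exact: ih.
Qed.

Lemma measurable_prod_coord d (f : 'I_d -> R -> \bar R) :
  (forall i, measurable_fun [set: R] (f i)) ->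
  measurable_fun [set: E d] (fun x => \prod_(i < d) f i (ecoord x i))%E.
Proof.
move=> mf; apply: emeasurable_prod_ord => i.
exact: (measurableT_comp (mf i) (measurable_coord i)).
Qed.

Lemma integral_prod_coord d (f : 'I_d -> R -> \bar R) :
  (forall i, measurable_fun [set: R] (f i)) -> (forall i x, 0 <= f i x)%E ->
  (\int[vol d]_x \prod_(i < d) f i (ecoord x i) = \prod_(i < d) \int[mu]_x f i x)%E.
Proof.
elim: d f => [|d ih] f mf f0.
  rewrite big_ord0 (eq_integral (cst 1%E)); last by move=> x _; rewrite big_ord0.
  rewrite integral_cst//=. by rewrite diracT mule1.
have fp0 x : (0 <= \prod_(i < d) f (lift ord0 i) (ecoord x i))%E.
  by apply: prode_ge0.
rewrite big_ord_recl -ih//.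
rewrite [LHS]fubini_tonelli1/=; first last.
- by move=> x; apply: prode_ge0.
- exact: (measurable_prod_coord mf).
rewrite /fubini_F muleC -ge0_integralZl//; last exact: integral_ge0.
apply: eq_integral => x _.
rewrite muleC -ge0_integralZl//; last first.
  exact: (measurable_prod_coord (fun i => mf (lift ord0 i))).
apply: eq_integral => y _; rewrite big_ord_recl coord0.
by congr (_ * _)%E; apply: eq_bigr => i _; rewrite coord_lift.
exact: mf.
Qed.

Definition ebox d (L : R) : set (E d) := [set x | forall i, - L <= ecoord x i <= L].
Arguments ebox : clear implicits.

Lemma measurable_box d L : measurable (ebox d L).
Proof.
have -> : ebox d L = \bigcap_(i in [set: 'I_d]) ((@ecoord d ^~ i) @^-1` `[- L, L]%classic).
  apply/seteqP; split => x; first by move=> h i _ /=; rewrite in_itv/=; exact: h.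
  by move=> h i; have := h i I; rewrite /= in_itv/=.
apply: fin_bigcap_measurable => // i _.
by rewrite -[X in measurable X]setTI; apply: measurable_coord.
Qed.

Lemma box_consE d L (x : R) (y : E d) :
  ebox d.+1 L (x, y) <-> `[- L, L]%classic x /\ ebox d L y.
Proof.
split=> [h|[h1 h2] i].
  split; first by have := h ord0; rewrite coord0 /= in_itv.
  by move=> i; have := h (lift ord0 i); rewrite coord_lift.
have [j ->|->] := unliftP ord0 i; first by rewrite coord_lift; exact: h2.
by rewrite coord0; move: h1; rewrite /= in_itv.
Qed.

Lemma ge0_integral_box_cons d L (f : E d.+1 -> \bar R) :
  measurable_fun [set: E d.+1] f -> (forall x, 0 <= f x)%E ->
  (\int[vol d.+1]_(x in ebox d.+1 L) f x =
   \int[mu]_(x in `[(- L)%R, L]) \int[vol d]_(y in ebox d L) f (x, y))%E.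
Proof.
move=> mf f0; rewrite integral_mkcond [LHS]fubini_tonelli1; first last.
- by apply: erestrict_ge0 => // x.
- exact: (iffLR (@measurable_restrictT _ _ (E d.+1) _ _ f (@measurable_box d.+1 L)) (measurable_funTS mf)).
rewrite [RHS]integral_mkcond; apply: eq_integral => x _.
rewrite patchE /fubini_F; case: ifPn => xL.
  rewrite [RHS]integral_mkcond; apply: eq_integral => y _.
  rewrite !patchE; congr (if _ then _ else _).
  apply/idP/idP; rewrite !inE; first by move=> /box_consE[].
  by move=> h; apply/box_consE; split => //; move: xL; rewrite inE.
rewrite integral0_eq// => y _; rewrite patchE; case: ifPn => //.
by rewrite inE => /box_consE[xL' _]; move: xL; rewrite notin_setE.
Qed.

Lemma box_vol d L : 0 <= L -> vol d (ebox d L) = ((2 * L) ^+ d)%:E.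
Proof.
move=> L0; elim: d => [|d ih].
  by rewrite expr0 /= diracE mem_set// => -[].
rewrite -[LHS]mul1e -integral_cst; last exact: measurable_box.
rewrite ge0_integral_box_cons//.
rewrite (eq_integral (cst ((2 * L) ^+ d)%:E)); last first.
  by move=> x _; rewrite integral_cst ?mul1e//; exact: measurable_box.
rewrite integral_cst//= lebesgue_measure_itv/= lte_fin.
case: ifPn => [_|h]; first by rewrite -EFinB -EFinM; congr EFin; rewrite exprS; ring.
have -> : L = 0 by lra.
by rewrite mule0 mulr0 expr0n.
Qed.

Lemma measurable_sum_coord d (c : 'I_d -> R) :
  measurable_fun [set: E d] (fun x => \sum_(i < d) c i * ecoord x i).
Proof.
apply: measurable_sum => i; apply: measurable_funM => //.
exact: measurable_coord.
Qed.

(** Orthogonality of the characters of the torus, in nonnegative form. The free phase [c] is what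
    makes the induction on [d] go through: it absorbs the coordinate that is held fixed while the
    others are integrated. *)
Lemma integral_box_1pcos d (c L s : R) (k : 'I_d -> int) : 0 < s -> L = pi / s ->
  (\int[vol d]_(x in ebox d L) (1 + cos (c + \sum_(i < d) s * (k i)%:~R * ecoord x i))%:E =
   ((2 * L) ^+ d * (1 + [forall i, k i == 0]%:R * cos c))%:E)%E.
Proof.
move=> s0 LE; have L0 : 0 <= L by rewrite LE divr_ge0 ?pi_ge0// ltW.
have mcos n (c' : R) (k' : 'I_n -> int) : measurable_fun [set: E n]
    (fun x => (1 + cos (c' + \sum_(i < n) s * (k' i)%:~R * ecoord x i))%:E).
  apply/measurable_EFinP; apply: measurable_funD => //.
  apply: (measurableT_comp (continuous_measurable_fun (@continuous_cos R))).
  by apply: measurable_funD => //; exact: measurable_sum_coord.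
have cos0 (x : R) : 0 <= 1 + cos x by have := cos_geN1 x; lra.
elim: d c k => [|d ih] c k.
  rewrite expr0 mul1r (_ : [forall i, _]); last by apply/forallP => -[].
  rewrite (eq_integral (cst (1 + cos c)%:E)); last by move=> x _; rewrite big_ord0 addr0.
  rewrite integral_cst; last exact: measurable_box.
  by rewrite [X in (_ * X)%E](box_vol 0 L0) expr0 mule1 mul1r.
rewrite ge0_integral_box_cons//.
pose k' i := k (lift ord0 i).
transitivity (\int[mu]_(x in `[(- L)%R, L]) (((2 * L) ^+ d)%:E *
   (1 + [forall i, k' i == 0]%:R * cos (c + s * (k ord0)%:~R * x))%:E)%E)%E.
  apply: eq_integral => x _; rewrite -EFinM.
  rewrite -ih; apply: eq_integral => y _.
  rewrite big_ord_recl coord0 /= addrA; congr (_ + cos (_ + _))%:E.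
  by apply: eq_bigr => i _; rewrite coord_lift.
have -> : [forall i, k i == 0] = (k ord0 == 0) && [forall i, k' i == 0].
  apply/forallP/andP => [h|[h1 /forallP h2] i]; last first.
    by have [j ->|->//] := unliftP ord0 i; exact: h2.
  by split => //; apply/forallP => i; exact: h.
rewrite ge0_integralZl//; first last.
- by rewrite lee_fin exprn_ge0// mulr_ge0.
- move=> x _; rewrite lee_fin; case: ([forall _, _]); first by rewrite mul1r.
  by rewrite mul0r addr0.
- apply/measurable_EFinP; apply: measurable_funD => //; apply: measurable_funM => //.
  apply: (measurableT_comp (continuous_measurable_fun (@continuous_cos R))).
  by apply: measurable_funD => //; exact: measurable_funM.
case: ([forall _, _]).
  under eq_integral do rewrite mul1r.
  by rewrite integral_1pcos// -EFinM; congr EFin; rewrite andbT exprS; ring.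
under eq_integral do rewrite mul0r addr0.
rewrite integral_cst//= lebesgue_measure_itv/= lte_fin andbF exprS mul0r addr0.
case: ifPn => [_|h]; first by rewrite -EFinB mul1e -EFinM; congr EFin; ring.
have -> : L = 0 by lra.
by rewrite mulr0 mul0r mul0r mule0 mule0.
Qed.

(** * Lattice sums as integrals of step functions *)

Definition floorv d (s : R) (x : E d) : 'rV[int]_d :=
  \row_i Num.floor (ecoord x i / s).

Lemma measurable_floor_ind s k : 0 < s ->
  measurable_fun [set: R] (fun x : R => ((Num.floor (x / s) == k)%:R%:E : \bar R)).
Proof.
move=> s0; have -> : (fun x : R => ((Num.floor (x / s) == k)%:R%:E : \bar R)) =
    EFin \o \1_[set x : R | Num.floor (x / s) = k].
  apply/funext => x /=; rewrite indicE; congr ((nat_of_bool _)%:R%:E).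
  by apply/eqP/idP => [?|/set_mem//]; exact/mem_set.
by apply/measurable_EFinP; apply: measurable_indic; exact: floor_cell_measurable.
Qed.

Lemma floorv_indE d s (x : E d) (z : 'rV[int]_d) :
  ((floorv s x == z)%:R%:E = \prod_(i < d) (Num.floor (ecoord x i / s) == z 0 i)%:R%:E :> \bar R)%E.
Proof.
have [<-|] := eqVneq (floorv s x) z.
  by rewrite big1// => i _; rewrite mxE eqxx.
move=> xz; have [i xzi] : exists i, Num.floor (ecoord x i / s) != z 0 i.
  apply/existsP; rewrite -negb_forall; apply: contra xz => /forallP h.
  by apply/eqP/rowP => i; rewrite mxE; exact/eqP.
by rewrite (bigD1 i)//= (negPf xzi) mul0e.
Qed.

Lemma measurable_floorv_ind d s (z : 'rV[int]_d) : 0 < s ->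
  measurable_fun [set: E d] (fun x => ((floorv s x == z)%:R%:E : \bar R)).
Proof.
move=> s0; under eq_fun do rewrite floorv_indE.
apply: (@measurable_prod_coord d (fun i x => (Num.floor (x / s) == z 0 i)%:R%:E)) => i.
exact: measurable_floor_ind.
Qed.

Lemma floorv_cell_measure d s (z : 'rV[int]_d) : 0 < s ->
  (\int[vol d]_x (floorv s x == z)%:R%:E = (s ^+ d)%:E)%E.
Proof.
move=> s0; under eq_integral do rewrite floorv_indE.
rewrite (integral_prod_coord (f := fun i x => (Num.floor (x / s) == z 0 i)%:R%:E));
  last 2 first.
- by move=> i; exact: measurable_floor_ind.
- by move=> i x; rewrite lee_fin.
rewrite (eq_bigr (fun=> s%:E)); last first.
  move=> i _; rewrite -(floor_cell_measure (z 0 i) s0).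
  rewrite -[RHS]mul1e -(setIT [set x : R | _]) -integral_indic//; last exact: floor_cell_measurable.
  rewrite mul1e; apply: eq_integral => x _; rewrite indicE; congr ((nat_of_bool _)%:R%:E).
  by apply/eqP/idP => [?|/set_mem//]; exact/mem_set.
by rewrite prodEFin prodr_const card_ord.
Qed.

(** Decomposing the step function over the cells gives both its measurability and its integral from
    the same facts about one cell. *)
Lemma floorv_esumE d s (F : 'rV[int]_d -> \bar R) (x : E d) : (forall z, 0 <= F z)%E ->
  F (floorv s x) = (\esum_(z in [set: 'rV[int]_d]) (F z * (floorv s x == z)%:R%:E))%E.
Proof.
move=> F0; rewrite (esumID [set floorv s x]); last first.
  by move=> z _; apply: mule_ge0 => //; rewrite lee_fin.
rewrite setTI esum_set1; last by apply: mule_ge0 => //; rewrite lee_fin.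
rewrite eqxx mule1 esum1 ?adde0// => z [_ /= /eqP].
by rewrite eq_sym => /negPf ->; rewrite mule0.
Qed.

Lemma measurable_floorv d s (F : 'rV[int]_d -> \bar R) : 0 < s ->
  (forall z, 0 <= F z)%E -> measurable_fun [set: E d] (fun x => F (floorv s x)).
Proof.
move=> s0 F0; under eq_fun do rewrite floorv_esumE//.
apply: measurable_fun_esum => [z x _|z].
  by apply: mule_ge0 => //; rewrite lee_fin.
by apply: emeasurable_funM => //; exact: measurable_floorv_ind.
Qed.

(** Each lattice point owns a cell of volume s^d. Reading a lattice sum as an integral over a fixed
    space lets dominated convergence replace any Riemann sum estimate as the mesh goes to 0. *)
Lemma esum_integral_floorv d s (F : 'rV[int]_d -> \bar R) : 0 < s ->
  (forall z, 0 <= F z)%E ->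
  (\int[vol d]_x F (floorv s x) = (s ^+ d)%:E * \esum_(z in [set: 'rV[int]_d]) F z)%E.
Proof.
move=> s0 F0; under eq_integral do rewrite floorv_esumE//.
rewrite ge0_integral_esum//; last 2 first.
- by move=> z x _; apply: mule_ge0 => //; rewrite lee_fin.
- by move=> z; apply: emeasurable_funM => //; exact: measurable_floorv_ind.
rewrite -esumZl//; last by rewrite exprn_ge0// ltW.
apply: eq_esum => z _; rewrite ge0_integralZl//; last exact: measurable_floorv_ind.
by rewrite floorv_cell_measure// muleC.
Qed.

Lemma vol_setT_neq0 d : vol d [set: E d] != 0%E.
Proof.
have h : (vol d (ebox d 2^-1) <= vol d [set: E d])%E.
  by apply: le_measure; rewrite ?inE//; exact: measurable_box.
rewrite gt_eqF//; apply: lt_le_trans h.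
by rewrite box_vol// divff// expr1n lte01.
Qed.

End euclid.

(** * Fourier representation of the return probability *)

Section average.
Context dd (T : measurableType dd) (R : realType).
Variables (mu : {measure set T -> \bar R}) (D : set T) (V : R).
Hypotheses (mD : measurable D) (muD : mu D = V%:E) (V0 : 0 < V).

(** A class stable under sums and products whose members are all integrable on the set [D] of finite
    measure, so that linearity of the mean needs no further side conditions. *)
Definition bmeas (f : T -> R) :=
  measurable_fun [set: T] f /\ exists M, forall x, `|f x| <= M.

Lemma bmeas_cst c : bmeas (cst c).
Proof. by split => //; exists `|c|. Qed.

Lemma bmeasD f g : bmeas f -> bmeas g -> bmeas (fun x => f x + g x).
Proof.
move=> [mf [M fM]] [mg [N gN]]; split; first exact: measurable_funD.
by exists (M + N) => x; rewrite (le_trans (ler_normD _ _))// lerD.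
Qed.

Lemma bmeasM f g : bmeas f -> bmeas g -> bmeas (fun x => f x * g x).
Proof.
move=> [mf [M fM]] [mg [N gN]]; split; first exact: measurable_funM.
by exists (M * N) => x; rewrite normrM ler_pM.
Qed.

Lemma bmeasN f : bmeas f -> bmeas (fun x => - f x).
Proof.
move=> [mf [M fM]]; split; first exact: measurableT_comp.
by exists M => x; rewrite normrN.
Qed.

Lemma bmeasB f g : bmeas f -> bmeas g -> bmeas (fun x => f x - g x).
Proof. by move=> bf bg; apply: bmeasD => //; exact: bmeasN. Qed.

Lemma bmeasX f n : bmeas f -> bmeas (fun x => f x ^+ n).
Proof.
move=> bf; elim: n => [|n ih]; first exact: (bmeas_cst 1).
by under eq_fun do rewrite exprS; exact: bmeasM.
Qed.

Lemma bmeas_integrable f : bmeas f -> mu.-integrable D (EFin \o f).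
Proof.
move=> [mf [M fM]]; apply: measurable_bounded_integrable => //.
- by rewrite muD ltry.
- exact: measurable_funTS.
- exists M; split; first by rewrite num_real.
  by move=> N MN x _ /=; rewrite (le_trans (fM x))// ltW.
Qed.

Definition avg (f : T -> R) : R := V^-1 * \int[mu]_(x in D) f x.

Lemma eq_avg f g : (forall x, D x -> f x = g x) -> avg f = avg g.
Proof. by move=> fg; congr (_ * _); apply: eq_Rintegral => x /set_mem/fg. Qed.

Lemma avgD f g : bmeas f -> bmeas g -> avg (fun x => f x + g x) = avg f + avg g.
Proof. by move=> bf bg; rewrite /avg RintegralD ?mulrDr//; exact: bmeas_integrable. Qed.

Lemma avgB f g : bmeas f -> bmeas g -> avg (fun x => f x - g x) = avg f - avg g.
Proof. by move=> bf bg; rewrite /avg RintegralB ?mulrBr//; exact: bmeas_integrable. Qed.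

Lemma avgZ c f : bmeas f -> avg (fun x => c * f x) = c * avg f.
Proof.
by move=> bf; rewrite /avg RintegralZl//; [rewrite mulrCA|exact: bmeas_integrable].
Qed.

Lemma avg_cst c : avg (fun=> c) = c.
Proof. by rewrite /avg Rintegral_cst// muD/= mulrCA mulVf ?mulr1// gt_eqF. Qed.

Lemma le_avg f g : bmeas f -> bmeas g -> (forall x, D x -> f x <= g x) -> avg f <= avg g.
Proof.
move=> bf bg fg; rewrite ler_pM2l ?invr_gt0//.
by apply: le_Rintegral => //; exact: bmeas_integrable.
Qed.

Lemma avg_ge0 f : (forall x, D x -> 0 <= f x) -> 0 <= avg f.
Proof. by move=> f0; rewrite mulr_ge0 ?invr_ge0 ?(ltW V0)// Rintegral_ge0. Qed.

Lemma integral_avg f : bmeas f -> (\int[mu]_(x in D) (f x)%:E = (V * avg f)%:E)%E.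
Proof.
move=> bf; rewrite /avg mulrA divff ?mul1r ?gt_eqF// /Rintegral fineK//.
exact: (integrable_fin_num mD (bmeas_integrable bf)).
Qed.

Lemma avg_esum (I : countType) (f : I -> T -> R) (g : T -> R) :
  (forall i x, D x -> 0 <= f i x) -> (forall i, bmeas (f i)) -> bmeas g ->
  (forall x, D x -> (\esum_(i in [set: I]) (f i x)%:E) = (g x)%:E)%E ->
  ((\esum_(i in [set: I]) (avg (f i))%:E) = (avg g)%:E)%E.
Proof.
move=> f0 bf bg fg.
have h : (V%:E * (\esum_(i in [set: I]) (avg (f i))%:E) = V%:E * (avg g)%:E)%E.
  rewrite -EFinM -integral_avg// -esumZl ?(ltW V0)//; last first.
    by move=> i; rewrite lee_fin avg_ge0// => x; exact: f0.
  rewrite (eq_integral (fun x => \esum_(i in [set: I]) (f i x)%:E)%E); last first.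
    by move=> x /set_mem/fg ->.
  rewrite ge0_integral_esum//.
  - by apply: eq_esum => i _; rewrite -EFinM -integral_avg.
  - by move=> i; apply/measurable_EFinP; apply: measurable_funTS; case: (bf i).
have {}h := congr1 (mule V^-1%:E) h.
by rewrite !muleA -!EFinM mulVf ?gt_eqF// mul1e mul1r in h.
Qed.

End average.

Lemma onepX_ge0 (R : realType) (c : R) n : -1 <= c <= 1 -> 0 <= 1 + c ^+ n.
Proof.
move=> c1; have : `|c ^+ n| <= 1 by rewrite normrX exprn_ile1// ler_norml.
by rewrite ler_norml => /andP[h _]; lra.
Qed.

(** Since [c] may be negative, the series of c^n alone has terms of both signs; the added 1 makes
    them nonnegative and contributes exactly the total mass of the Poisson law. *)
Lemma esum_poisson (R : realType) (y c : R) : 0 <= y -> -1 <= c <= 1 ->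
  ((\esum_(n in [set: nat]) (expR (- y) * y ^+ n / n`!%:R * (1 + c ^+ n))%:E) =
   (1 + expR (- (y * (1 - c))))%:E)%E.
Proof.
move=> y0 c1; set u := fun n : nat => expR (- y) * y ^+ n / n`!%:R * (1 + c ^+ n).
have u0 n : 0 <= u n.
  rewrite /u mulr_ge0// ?mulr_ge0 ?expR_ge0 ?exprn_ge0 ?invr_ge0//.
  exact: onepX_ge0.
rewrite -nneseries_esumT//.
apply/cvg_lim => //.
have -> : (fun n => \sum_(0 <= i < n) (u i)%:E)%E = EFin \o series u.
  by apply/funext => n /=; rewrite sumEFin.
apply: cvg_EFin; first by apply: nearW => n; [].
have -> : 1 + expR (- (y * (1 - c))) = expR (- y) * (expR y + expR (y * c)).
  by rewrite [RHS]mulrDr -2!expRD addNr expR0; congr (_ + expR _); ring.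
have -> : series u = fun n => expR (- y) * (series (exp_coeff y) n + series (exp_coeff (y * c)) n).
  apply/funext => n; rewrite /series/= -big_split/= mulr_sumr.
  by apply: eq_bigr => i _; rewrite /u /exp_coeff/= exprMn; ring.
by apply: cvgMr; apply: cvgD; exact: is_cvg_series_exp_coeff.
Qed.

Section phase.
Context {R : realType} {d : nat}.
Local Notation E := (sftype (euclid R d)).
Implicit Types (z w : 'rV[int]_d) (x : E) (s : R).

(** The scale [s] is kept in the pairing instead of being substituted away: the torus then becomes
    the box of half-side pi / s, which grows to the whole space as s goes to 0. *)
Definition phase s z x : R := \sum_(i < d) s * (z 0 i)%:~R * ecoord x i.

Lemma phaseD s z w x : phase s (z + w) x = phase s z x + phase s w x.
Proof.
rewrite -big_split/=; apply: eq_bigr => i _.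
by rewrite mxE intrD mulrDr mulrDl.
Qed.

Lemma phaseN s z x : phase s (- z) x = - phase s z x.
Proof.
rewrite -sumrN; apply: eq_bigr => i _.
by rewrite mxE mulrNz mulrN mulNr.
Qed.

Lemma phaseB s z w x : phase s (z - w) x = phase s z x - phase s w x.
Proof. by rewrite phaseD phaseN. Qed.

Lemma measurable_phase s z : measurable_fun [set: E] (phase s z).
Proof. exact: measurable_sum_coord. Qed.

Lemma bmeas_cos_phase s z : bmeas (fun x => cos (phase s z x)).
Proof.
split; last by exists 1 => x; rewrite ler_norml cos_geN1 cos_le1.
apply: (measurableT_comp (continuous_measurable_fun (@continuous_cos R))).
exact: measurable_phase.
Qed.

End phase.

Section fourier.
Context {R : realType} {d : nat}.
Variable a : 'rV[int]_d -> R.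
Hypothesis ha : rw_intensity a.
Local Notation E := (sftype (euclid R d)).
Local Notation Z := 'rV[int]_d.
Local Notation q := (jump_rate a).
Local Notation P := (jump_kernel a).

Lemma jump_rate_gt0 : 0 < q.
Proof. by rewrite oppr_gt0; case: ha. Qed.

Lemma jump_kernel_ge0 z : 0 <= P z.
Proof.
rewrite /jump_kernel; case: eqP => // /eqP z0; rewrite divr_ge0//.
  by case: ha => /(_ z z0).
exact/ltW/jump_rate_gt0.
Qed.

Lemma jump_kernelN z : P (- z) = P z.
Proof. by rewrite /jump_kernel oppr_eq0; case: ha => _ _ -> _ _. Qed.

Lemma jump_kernel_sum1 : ((\esum_(z in [set: Z]) (P z)%:E) = 1)%E.
Proof.
have q0 := jump_rate_gt0.
have h : (q%:E * (\esum_(z in [set: Z]) (P z)%:E) = q%:E)%E.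
  rewrite -esumZl ?(ltW q0)//; last by move=> z; rewrite lee_fin jump_kernel_ge0.
  case: ha => _ _ _ e _; rewrite -[RHS]e [RHS]esum_mkcond; apply: eq_esum => z _.
  rewrite -EFinM /jump_kernel; case: eqVneq => [->|z0].
    by rewrite mulr0 ifF//; apply/negP; rewrite inE/= eqxx.
  by rewrite ifT ?inE//= mulrCA divff ?mulr1// gt_eqF.
have {}h := congr1 (mule q^-1%:E) h.
by rewrite muleA -!EFinM mulVf ?gt_eqF// mul1e in h.
Qed.

Lemma esum_jump_le (f : Z -> R) M : 0 <= M -> (forall z, 0 <= f z <= M) ->
  ((\esum_(z in [set: Z]) (P z * f z)%:E) <= M%:E)%E.
Proof.
move=> M0 fM; rewrite -[leRHS]mule1 -jump_kernel_sum1 -esumZl//; last first.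
  by move=> z; rewrite lee_fin jump_kernel_ge0.
apply: le_esum => z _; rewrite lee_fin mulrC.
by have /andP[_ h] := fM z; rewrite ler_wpM2r// jump_kernel_ge0.
Qed.

(** One minus the characteristic function of a jump at frequency [s x]; multiplied by [jump_rate a]
    it is phi(s x). Its series has nonnegative terms and sum at most 2, so [fine] loses nothing. *)
Definition symb (s : R) (x : E) : R :=
  fine (\esum_(w in [set: Z]) (P w * (1 - cos (phase s w x)))%:E)%E.

Lemma onemcos_ge0 (y : R) : 0 <= 1 - cos y.
Proof. by rewrite subr_ge0 cos_le1. Qed.

Lemma onemcos_le2 (y : R) : 1 - cos y <= 2.
Proof. by have := cos_geN1 y; lra. Qed.

Lemma symbE s x :
  (\esum_(w in [set: Z]) (P w * (1 - cos (phase s w x)))%:E)%E = (symb s x)%:E.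
Proof.
rewrite fineK// ge0_fin_numE.
  apply: le_lt_trans (ltry 2).
  by apply: esum_jump_le => // z; rewrite onemcos_ge0 onemcos_le2.
by apply: esum_ge0 => z _; rewrite lee_fin mulr_ge0 ?jump_kernel_ge0 ?onemcos_ge0.
Qed.

Lemma symb_ge0 s x : 0 <= symb s x.
Proof.
rewrite -lee_fin -symbE.
by apply: esum_ge0 => z _; rewrite lee_fin mulr_ge0 ?jump_kernel_ge0 ?onemcos_ge0.
Qed.

Lemma symb_le2 s x : symb s x <= 2.
Proof.
rewrite -lee_fin -symbE.
by apply: esum_jump_le => // z; rewrite onemcos_ge0 onemcos_le2.
Qed.

Lemma measurable_symb s : measurable_fun [set: E] (symb s).
Proof.
apply/measurable_EFinP.
apply: (eq_measurable_fun (fun x => \esum_(w in [set: Z])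
  (P w * (1 - cos (phase s w x)))%:E)%E).
  by move=> x _; rewrite symbE.
apply: measurable_fun_esum => [w x _|w].
  by rewrite lee_fin mulr_ge0 ?jump_kernel_ge0 ?onemcos_ge0.
apply/measurable_EFinP; apply: measurable_funM => //; apply: measurable_funB => //.
by case: (bmeas_cos_phase s w).
Qed.

Lemma bmeas_symb s : bmeas (symb s).
Proof.
split; first exact: measurable_symb.
by exists 2 => x; rewrite ger0_norm ?symb_ge0 ?symb_le2.
Qed.

Variable s : R.
Hypothesis s0 : 0 < s.
Let L := pi / s.
Let V := (2 * L) ^+ d.
Local Notation B := (@ebox R d L).
Local Notation mean := (avg (sfmeasure (euclid R d)) B V).

Let L0 : 0 < L. Proof. by rewrite divr_gt0 ?pi_gt0. Qed.
Let V0 : 0 < V. Proof. by rewrite exprn_gt0// mulr_gt0. Qed.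
Let mB : measurable B. Proof. exact: measurable_box. Qed.
Let BV : sfmeasure (euclid R d) B = V%:E. Proof. by rewrite box_vol// ltW. Qed.

(** The characteristic function of one jump, real because the jump law is symmetric. Defining it
    through [symb] avoids summing a series of varying sign. *)
Definition psi (x : E) : R := 1 - symb s x.

Let bpsi : bmeas psi.
Proof. by apply: bmeasB; [exact: bmeas_cst|exact: bmeas_symb]. Qed.

Lemma psi_le1 x : -1 <= psi x <= 1.
Proof. by rewrite /psi; have := symb_ge0 s x; have := symb_le2 s x; lra. Qed.

(** The Fourier inversion formula for the law of the walk after [n] jumps. *)
Definition fcoef n z := mean (fun x => psi x ^+ n * cos (phase s z x)).

Let bfc n z : bmeas (fun x => psi x ^+ n * cos (phase s z x)).
Proof. by apply: bmeasM; [exact: bmeasX|exact: bmeas_cos_phase]. Qed.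

Lemma fcoef0 z : fcoef 0 z = (z == 0)%:R.
Proof.
have -> : fcoef 0 z = mean (fun x => cos (phase s z x)).
  by apply: eq_avg => x _; rewrite expr0 mul1r.
have h : mean (fun x => 1 + cos (phase s z x)) = 1 + (z == 0)%:R.
  apply: (mulfI (lt0r_neq0 V0)); apply: EFin_inj; rewrite -(integral_avg mB BV)//; last first.
    by apply: bmeasD; [exact: bmeas_cst|exact: bmeas_cos_phase].
  have := @integral_box_1pcos R d 0 L s (fun i => z 0 i) s0 erefl.
  rewrite cos0 mulr1 => e; rewrite (_ : (z == 0) = [forall i, z 0 i == 0]) -?e.
    by apply: eq_integral => x _; rewrite add0r.
  apply/eqP/forallP => [-> i|h]; first by rewrite mxE.
  by apply/rowP => i; rewrite mxE; exact/eqP.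
apply: (@addrI _ 1); rewrite -h avgD ?avg_cst//.
- exact: bmeas_cst.
- exact: bmeas_cos_phase.
Qed.

(* The cosine series is summed through the nonnegative functions
   (1 + h) (1 - cos), so that Tonelli's theorem suffices. *)
Lemma fcoef_step n z : (forall w, 0 <= fcoef n w) ->
  ((\esum_(w in [set: Z]) (P w * (fcoef n (z - w) + fcoef n (z + w)))%:E)
   = (2 * fcoef n.+1 z)%:E)%E.
Proof.
move=> f0.
pose h x := psi x ^+ n * cos (phase s z x).
have bh : bmeas h by exact: bfc.
have h1 x : -1 <= h x <= 1.
  rewrite -ler_norml normrM normrX -[leRHS]mulr1 ler_pM ?exprn_ge0//.
    by rewrite exprn_ile1// ler_norml psi_le1.
  by rewrite ler_norml cos_geN1 cos_le1.
pose c (w : Z) (x : E) := cos (phase s w x).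
have bc w : bmeas (c w) by exact: bmeas_cos_phase.
have b1 : bmeas (fun=> 1 : R) := bmeas_cst _ 1.
have bhc w : bmeas (fun x => h x * c w x) by exact: bmeasM.
have b1h : bmeas (fun x => 1 + h x) by exact: bmeasD.
have b1c w : bmeas (fun x => 1 - c w x) by exact: bmeasB.
have b1h1c w : bmeas (fun x => (1 + h x) * (1 - c w x)) by exact: bmeasM.
have bsy : bmeas (symb s) := bmeas_symb s.
(* Pairing z - w with z + w eliminates the sine terms, so that no imaginary part ever has to be
   shown to vanish. *)
have Bw w : fcoef n (z - w) + fcoef n (z + w) = 2 * mean (fun x => h x * c w x).
  rewrite /fcoef -(avgD mB BV)// -(avgZ mB BV)//; apply: eq_avg => x _.
  by rewrite phaseB phaseD cosB cosD /h /c; ring.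
have hc0 w : 0 <= mean (fun x => h x * c w x).
  by rewrite -(pmulr_rge0 _ (ltr0n R 2)) -Bw addr_ge0.
have mh0 : 0 <= mean h by exact: f0.
have P0 := jump_kernel_ge0.
have e1 : ((\esum_(w in [set: Z]) (P w * mean (fun x => (1 + h x) * (1 - c w x)))%:E) =
    (mean (fun x => (1 + h x) * symb s x))%:E)%E.
  rewrite -(avg_esum mB BV V0 (f := fun w x => P w * ((1 + h x) * (1 - c w x)))).
  - by apply: eq_esum => w _; rewrite (avgZ mB BV).
  - move=> w x _; rewrite mulr_ge0// mulr_ge0 ?onemcos_ge0//.
    by have := h1 x; lra.
  - by move=> w; apply: bmeasM => //; exact: bmeas_cst.
  - exact: bmeasM.
  - move=> x _; rewrite EFinM -symbE -esumZl.
    + by apply: eq_esum => w _; rewrite -EFinM; congr EFin; rewrite /c; ring.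
    + by have := h1 x; lra.
    + by move=> w; rewrite lee_fin mulr_ge0 ?onemcos_ge0.
have e2 : ((\esum_(w in [set: Z]) (P w * mean (fun x => 1 - c w x))%:E) =
    (mean (symb s))%:E)%E.
  rewrite -(avg_esum mB BV V0 (f := fun w x => P w * (1 - c w x))).
  - by apply: eq_esum => w _; rewrite (avgZ mB BV).
  - by move=> w x _; rewrite mulr_ge0 ?onemcos_ge0.
  - by move=> w; apply: bmeasM => //; exact: bmeas_cst.
  - by [].
  - by move=> x _; rewrite -symbE.
have e3 : ((\esum_(w in [set: Z]) (P w * mean h)%:E) = (mean h)%:E)%E.
  rewrite -[RHS]mule1 -jump_kernel_sum1 -esumZl//.
  by apply: eq_esum => w _; rewrite -EFinM mulrC.
(* Rests on h c + (1 + h)(1 - c) = (1 - c) + h, where all four means are nonnegative: an addition of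
   sums takes the place of a subtraction. *)
have hsum : ((\esum_(w in [set: Z]) (P w * mean (fun x => h x * c w x))%:E) +
     (mean (fun x => (1 + h x) * symb s x))%:E =
     (mean (symb s))%:E + (mean h)%:E)%E.
  rewrite -e1 -e2 -e3 -!esumD; first last.
  - move=> w _; rewrite lee_fin; apply: mulr_ge0 => //; apply: (avg_ge0 _ V0) => x _.
    by rewrite mulr_ge0 ?onemcos_ge0//; have := h1 x; lra.
  - by move=> w _; rewrite lee_fin mulr_ge0.
  - by move=> w _; rewrite lee_fin mulr_ge0.
  - by move=> w _; rewrite lee_fin; apply: mulr_ge0 => //; apply: (avg_ge0 _ V0) => x _; exact: onemcos_ge0.
  apply: eq_esum => w _; rewrite -!EFinD; congr EFin.
  have k : mean (fun x => h x * c w x) + mean (fun x => (1 + h x) * (1 - c w x)) =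
      mean (fun x => 1 - c w x) + mean h.
    by rewrite -!(avgD mB BV)//; apply: eq_avg => x _; ring.
  by rewrite -mulrDr k mulrDr.
transitivity (2%:E * \esum_(w in [set: Z]) (P w * mean (fun x => h x * c w x))%:E)%E.
  rewrite -esumZl//; last by move=> w; rewrite lee_fin mulr_ge0.
  by apply: eq_esum => w _; rewrite Bw -EFinM; congr EFin; ring.
rewrite EFinM; congr (_ * _)%E.
have -> : fcoef n.+1 z = mean (symb s) + mean h - mean (fun x => (1 + h x) * symb s x).
  have bhs : bmeas (fun x => (1 + h x) * symb s x) by exact: bmeasM.
  rewrite -(avgD mB BV)// -(avgB mB BV)//; last exact: bmeasD.
  by apply: eq_avg => x _; rewrite exprS /psi /h /psi; ring.
by rewrite EFinB EFinD -hsum addeK.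
Qed.

Lemma convpow_ge0 n z : (0 <= convpow P n z)%E.
Proof.
elim: n z => [|n ih] z /=; first by rewrite lee_fin.
by apply: esum_ge0 => w _; rewrite mule_ge0// lee_fin jump_kernel_ge0.
Qed.

Lemma esum_reindex (e : Z -> Z) (f : Z -> \bar R) : bijective e ->
  (\esum_(z in [set: Z]) f z = \esum_(z in [set: Z]) f (e z))%E.
Proof.
move=> [e' eK e'K]; apply: reindex_esum; split => //.
- by move=> x y _ _ /(congr1 e'); rewrite !eK.
- by move=> y _; exists (e' y).
Qed.

(** The nonnegativity required by [fcoef_step] is inherited from [convpow] through the induction
    hypothesis. Symmetry of the kernel makes the sums over z - w and z + w equal, which removes the
    factor 2. *)
Lemma convpowE n z : convpow P n z = (fcoef n z)%:E.
Proof.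
elim: n z => [|n ih] z /=; first by rewrite fcoef0.
have f0 w : 0 <= fcoef n w by rewrite -lee_fin -ih convpow_ge0.
have P0 := jump_kernel_ge0.
have inv1 : bijective (fun w => z - w) by exists (fun w => z - w) => w; rewrite subKr.
have inv2 : bijective (-%R : Z -> Z) by exists -%R; exact: opprK.
have e1 : (\esum_(y in [set: Z]) (convpow P n y * (P (z - y)%R)%:E) =
    \esum_(w in [set: Z]) (P w * fcoef n (z - w))%:E)%E.
  rewrite (esum_reindex _ inv1); apply: eq_esum => w _.
  by rewrite ih subKr -EFinM mulrC.
have e2 : (\esum_(w in [set: Z]) (P w * fcoef n (z - w))%:E =
    \esum_(w in [set: Z]) (P w * fcoef n (z + w))%:E)%E.
  rewrite (esum_reindex _ inv2); apply: eq_esum => w _.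
  by rewrite jump_kernelN opprK.
have h : ((\esum_(w in [set: Z]) (P w * fcoef n (z - w))%:E) +
    (\esum_(w in [set: Z]) (P w * fcoef n (z + w))%:E) = (2 * fcoef n.+1 z)%:E)%E.
  rewrite -esumD; first last.
  - by move=> w _; rewrite lee_fin mulr_ge0.
  - by move=> w _; rewrite lee_fin mulr_ge0.
  by rewrite -fcoef_step//; apply: eq_esum => w _; rewrite -EFinD -mulrDr.
rewrite -e2 in h; rewrite e1.
move: h; set S := (X in (X + X)%E).
have : (0 <= S)%E by apply: esum_ge0 => w _; rewrite lee_fin mulr_ge0.
move=> S0 h; suff : S = (fcoef n.+1 z)%:E by [].
by case: S S0 h => [r| |]//= r0 [] h; congr EFin; lra.
Qed.

Lemma fcoef_ge0 n w : 0 <= fcoef n w.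
Proof. by rewrite -lee_fin -convpowE convpow_ge0. Qed.

(** The Poisson average of psi^n is exp(-y (1 - psi)), and 1 - psi is the symbol. The left side does
    not involve [s]: this freedom of scale is what the local limit theorem exploits. *)
Lemma trans_prob0E t : 0 <= t ->
  trans_prob a t 0 = (mean (fun x => expR (- (t * (q * symb s x)))))%:E.
Proof.
move=> t0; have q0 := jump_rate_gt0; set y := q * t.
have y0 : 0 <= y by rewrite mulr_ge0// ltW.
pose W n : R := expR (- y) * y ^+ n / n`!%:R.
have W0 n : 0 <= W n by rewrite /W !mulr_ge0 ?expR_ge0 ?exprn_ge0 ?invr_ge0.
have cos1 x : cos (phase s 0 x) = 1.
  by rewrite /phase big1 ?cos0// => i _; rewrite mxE mulr0 mul0r.
have b1 : bmeas (fun=> 1 : R) := bmeas_cst _ 1.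
(* The Poisson weights have mass 1: this is [esum_poisson] at c = 1, where every factor 1 + c^n
   equals 2. *)
have e1 : ((\esum_(n in [set: nat]) (W n)%:E) = 1)%E.
  have c11 : -1 <= (1 : R) <= 1 by apply/andP; split; lra.
  have := esum_poisson y0 c11; rewrite subrr mulr0 oppr0 expR0 => h.
  have : (2%:E * (\esum_(n in [set: nat]) (W n)%:E) = 2%:E)%E.
    rewrite -esumZl// -[RHS]h.
    by apply: eq_esum => n _; rewrite expr1n -EFinM mulrC.
  move/(congr1 (mule 2^-1%:E)); rewrite muleA -!EFinM mulVf// mul1e.
  by [].
have be : bmeas (fun x => expR (- (t * (q * symb s x)))).
  split.
    apply: measurableT_comp => //; apply: measurableT_comp => //.
    by do 2 apply: measurable_funM => //; exact: measurable_symb.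
  exists 1 => x; rewrite ger0_norm ?expR_ge0// -[leRHS]expR0 ler_expR oppr_le0.
  by rewrite !mulr_ge0 ?symb_ge0// ltW.
have bp n : bmeas (fun x => psi x ^+ n) by exact: bmeasX.
have e2 : ((\esum_(n in [set: nat]) (W n * (1 + fcoef n 0))%:E) =
    (mean (fun x => 1 + expR (- (t * (q * symb s x)))))%:E)%E.
  rewrite -(avg_esum mB BV V0 (f := fun n x => W n * (1 + psi x ^+ n))).
  - apply: eq_esum => n _; rewrite (avgZ mB BV); last exact: bmeasD.
    rewrite (avgD mB BV)// (avg_cst mB BV V0); congr (_ * (_ + _))%:E.
    by apply: eq_avg => x _; rewrite cos1 mulr1.
  - by move=> n x _; rewrite mulr_ge0// onepX_ge0// psi_le1.
  - by move=> n; apply: bmeasM; [exact: bmeas_cst|exact: bmeasD].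
  - exact: bmeasD.
  - move=> x _; rewrite (esum_poisson y0 (psi_le1 x)); congr (1 + expR _)%:E.
    by rewrite /psi /y; ring.
have : (\esum_(n in [set: nat]) (W n * fcoef n 0)%:E + 1%:E =
    1%:E + (mean (fun x => expR (- (t * (q * symb s x)))))%:E)%E.
  rewrite -[in LHS]e1 -esumD; first last.
  - by move=> n _; rewrite lee_fin.
  - by move=> n _; rewrite lee_fin mulr_ge0// fcoef_ge0.
  rewrite -EFinD -[X in (X + _)%:E](avg_cst mB BV V0) -(avgD mB BV)// -e2.
  by apply: eq_esum => n _; rewrite -EFinD; congr EFin; ring.
rewrite /trans_prob.
have -> : (\esum_(n in [set: nat]) (W n * fcoef n 0)%:E =
    \esum_(n in [set: nat]) ((expR (- y) * y ^+ n / n`!%:R)%:E * convpow P n 0))%E.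
  by apply: eq_esum => n _; rewrite convpowE -EFinM.
case: (\esum_(n in _) _)%E => [r| |]//= [] h; congr EFin.
by apply: (addIr 1); rewrite h addrC.
Qed.

End fourier.

Lemma cvg_sumr (R : realType) (T : Type) (F : set_system T) {FF : Filter F} (I : Type)
    (r : seq I) (f : I -> T -> R) (l : I -> R) :
  (forall i, f i x @[x --> F] --> l i) ->
  \sum_(i <- r) f i x @[x --> F] --> \sum_(i <- r) l i.
Proof. by move=> fl; apply: (cvg_big (@add_continuous _)) => // i _; exact: fl. Qed.

(** * Lower bound and scaling limit of the symbol *)

Section norms.
Context {R : realType} {d : nat}.
Implicit Types (u v : 'rV[R]_d) (z : 'rV[int]_d).

Lemma le_coord_enorm u i : `|u 0 i| <= enorm u.
Proof.
rewrite -sqrtr_sqr ler_sqrt; last by apply: sumr_ge0 => j _; exact: sqr_ge0.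
by rewrite (bigD1 i)//= lerDl sumr_ge0// => j _; exact: sqr_ge0.
Qed.

Lemma enorm_ge0 u : 0 <= enorm u.
Proof. exact: sqrtr_ge0. Qed.

Lemma enorm_gt0 u : u != 0 -> 0 < enorm u.
Proof.
move=> u0; have [i ui] : exists i, u 0 i != 0.
  apply/existsP; rewrite -negb_forall; apply: contra u0 => /forallP h.
  by apply/eqP/rowP => i; rewrite mxE; exact/eqP.
by apply: lt_le_trans (le_coord_enorm u i); rewrite normr_gt0.
Qed.

Lemma enormZ c u : 0 <= c -> enorm (c *: u) = c * enorm u.
Proof.
move=> c0; rewrite /enorm -{2}(ger0_norm c0) -sqrtr_sqr -sqrtrM ?sqr_ge0//.
by congr Num.sqrt; rewrite mulr_sumr; apply: eq_bigr => i _; rewrite mxE exprMn.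
Qed.

Lemma enorm_continuous : continuous (@enorm R d).
Proof.
move=> u; apply: (@continuous_comp _ _ _ (fun u : 'rV[R]_d => \sum_(i < d) (u 0 i) ^+ 2)).
  apply: (@cvg_sumr _ _ (nbhs u)) => i.
  apply: (@continuous_comp _ _ _ (fun u : 'rV[R]_d => u 0 i) (fun x => x ^+ 2)).
    exact: coord_continuous.
  exact: exprn_continuous.
exact: sqrt_continuous.
Qed.

Lemma usphere_compact : compact (@usphere R d).
Proof.
apply: bounded_closed_compact.
  exists 1; split; first by rewrite num_real.
  move=> M M1 u /= uS; rewrite [leLHS]/Num.Def.normr/= mx_normrE.
  apply: bigmax_le => [|[j i] _ /=]; first by lra.
  by rewrite ord1 (le_trans (le_coord_enorm u i))// uS ltW.
have -> : @usphere R d = (@enorm R d) @^-1` [set x | x = 1] by [].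
apply: preimage_closed; last exact: closed_eq.
by move=> u _; exact: enorm_continuous.
Qed.

Definition zvec z : 'rV[R]_d := \row_i (z 0 i)%:~R.

Lemma enorm_zvec z : enorm (zvec z) = znorm R z.
Proof. by congr Num.sqrt; apply: eq_bigr => i _; rewrite mxE. Qed.

Lemma znorm_ge1 z : z != 0 -> 1 <= znorm R z.
Proof.
move=> z0; have [i zi] : exists i, z 0 i != 0.
  apply/existsP; rewrite -negb_forall; apply: contra z0 => /forallP h.
  by apply/eqP/rowP => i; rewrite mxE; exact/eqP.
rewrite -enorm_zvec; apply: le_trans (le_coord_enorm _ i).
by rewrite mxE -intr_norm ler1z -gtz0_ge1 normr_gt0.
Qed.

Lemma zdirE z : zdir R z = (znorm R z)^-1 *: zvec z.
Proof. by apply/rowP => i; rewrite !mxE mulrC. Qed.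

Lemma usphere_zdir z : z != 0 -> @usphere R d (zdir R z).
Proof.
move=> z0; have n0 : 0 < znorm R z by apply: lt_le_trans (znorm_ge1 z0).
rewrite /usphere /= zdirE enormZ ?invr_ge0 ?(ltW n0)// enorm_zvec mulVf//.
exact: lt0r_neq0.
Qed.

Lemma usphere_neq0 : (0 < d)%N -> @usphere R d !=set0.
Proof.
move=> d0; exists (delta_mx 0 (Ordinal d0)); rewrite /usphere /= /enorm.
rewrite (bigD1 (Ordinal d0))//= big1 ?addr0; last first.
  by move=> i /negPf h; rewrite mxE eqxx h expr0n.
by rewrite mxE !eqxx expr1n sqrtr1.
Qed.

End norms.

(** For lattice points with coordinates in N, ..., 2N - 1 that are shifted by at most N in one
    direction: both families stay in a cube with coordinates between N and 3N. *)
Lemma nat_cube_bounds (N i k : nat) :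
  (i < N)%N -> (k <= N)%N -> (N <= N + i + k <= 3 * N)%N.
Proof. lia. Qed.

Section kernel_bounds.
Context {R : realType} {d : nat}.
Variables (a : 'rV[int]_d -> R) (alpha : R) (H : 'rV[R]_d -> R).
Local Notation Z := 'rV[int]_d.
Implicit Types z : Z.
Hypotheses (d0 : (0 < d)%N) (ha : rw_intensity a) (alpha02 : 0 < alpha < 2).
Hypothesis cH : {within @usphere R d, continuous H}.
Hypothesis H0 : forall u, @usphere R d u -> 0 < H u.
Hypothesis aH : forall e : R, 0 < e -> exists M : R, forall z : Z, M < znorm R z ->
  `| a z * znorm R z `^ (d%:R + alpha) / H (zdir R z) - 1 | < e.

(** [H] attains its extrema on the compact sphere, nonempty because d > 0, and its minimum is
    positive. *)
Lemma H_bounds : exists c C, [/\ 0 < c, 0 < C & forall u, @usphere R d u -> c <= H u <= C].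
Proof.
have [u1 /set_mem Su1 h1] := compact_EVT_max (usphere_neq0 d0) usphere_compact cH.
have [u2 /set_mem Su2 h2] := compact_EVT_min (usphere_neq0 d0) usphere_compact cH.
exists (H u2), (H u1); split; [exact: H0|exact: H0|].
by move=> u /mem_set Su; rewrite h1// h2.
Qed.

Lemma znorm_powR_gt0 z b : z != 0 -> 0 < znorm R z `^ b.
Proof. by move=> z0; rewrite powR_gt0//; apply: lt_le_trans (znorm_ge1 (R := R) z0). Qed.

Lemma intensity_bounds : exists M c C, [/\ 0 <= M, 0 < c, 0 < C &
  forall z : Z, M < znorm R z -> c <= a z * znorm R z `^ (d%:R + alpha) <= C].
Proof.
have [c [C [c0 C0 cHC]]] := H_bounds.
(* A relative error below 1/2 places the ratio between 1/2 and 3/2, which explains the constants c /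
   2 and 2 C. *)
have [M hM] := aH (e := 2^-1) ltac:(by rewrite invr_gt0).
exists `|M|, (c / 2), (2 * C); split; [by []|by rewrite divr_gt0|by rewrite mulr_gt0|].
move=> z Mz; have z0 : z != 0.
  apply: contraTneq Mz => ->; rewrite -leNgt /znorm big1 ?sqrtr0// => i _.
  by rewrite mxE expr0n.
have /andP[h1 h2] := cHC _ (usphere_zdir (R := R) z0).
have hz0 : 0 < H (zdir R z) by apply: lt_le_trans h1.
have := hM z (le_lt_trans (ler_norm M) Mz).
rewrite ltr_norml => /andP[]; set A := a z * _.
rewrite ltrBrDr ltrBlDr ltr_pdivlMr// ltr_pdivrMr// => k1 k2.
apply/andP; split.
  by apply: le_trans (ltW k1); lra.
by apply: le_trans (ltW k2) _; lra.
Qed.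

Lemma intensity_ge0 z : z != 0 -> 0 <= a z.
Proof. by case: ha => h _ _ _ _; exact: h. Qed.

Lemma intensity_le_rate z : z != 0 -> a z <= jump_rate a.
Proof.
move=> z0; case: ha => h _ _ e _.
rewrite -lee_fin -e; apply: esum_ge; exists [set z]; last by rewrite fsbig_set1 lexx.
split; first exact: finite_set1.
by move=> _ ->.
Qed.

(** Inside the ball of radius [M], about which the asymptotics say nothing, an intensity is at most
    the total jump rate; the second summand of the constant pays for this region. *)
Lemma intensity_upper : exists2 K, 0 < K &
  forall z, z != 0 -> a z <= K * znorm R z `^ (- (d%:R + alpha)).
Proof.
have [M [c [C [M0 c0 C0 h]]]] := intensity_bounds.
have q0 := jump_rate_gt0 ha.
have b0 : 0 <= d%:R + alpha by rewrite addr_ge0// ltW//; case/andP: alpha02.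
exists (C + jump_rate a * M `^ (d%:R + alpha)).
  by rewrite ltr_pwDl// mulr_ge0 ?powR_ge0// ltW.
move=> z z0; rewrite powRN ler_pdivlMr ?znorm_powR_gt0//.
have [zM|Mz] := leP (znorm R z) M; last first.
  have /andP[_ hC] := h z Mz; apply: le_trans hC _.
  by rewrite lerDl mulr_ge0 ?powR_ge0// ltW.
apply: (@le_trans _ _ (jump_rate a * M `^ (d%:R + alpha))); last by rewrite lerDr ltW.
rewrite ler_pM ?powR_ge0 ?intensity_ge0 ?intensity_le_rate//.
by rewrite ge0_ler_powR// nnegrE// -enorm_zvec enorm_ge0.
Qed.

(** The right side may include z = 0, although [a 0] is negative and the jump kernel vanishes there,
    because the factor 1 - cos is 0. *)
Lemma rate_symbE s (x : sftype (euclid R d)) :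
  ((jump_rate a * symb a s x)%:E =
   \esum_(z in [set: Z]) (a z * (1 - cos (phase s z x)))%:E)%E.
Proof.
have q0 := jump_rate_gt0 ha.
rewrite EFinM -(symbE ha) -esumZl ?(ltW q0)//; last first.
  by move=> z; rewrite lee_fin mulr_ge0 ?jump_kernel_ge0 ?onemcos_ge0.
apply: eq_esum => z _; rewrite -EFinM; congr EFin.
rewrite /jump_kernel; case: eqVneq => [->|z0].
  rewrite mul0r mulr0 (_ : phase s 0 x = 0) ?cos0 ?subrr ?mulr0//.
  by rewrite /phase big1// => i _; rewrite mxE mulr0 mul0r.
by rewrite mulrA mulrCA divff ?mulr1// lt0r_neq0.
Qed.

Lemma intensity_onemcos_ge0 s (x : sftype (euclid R d)) z :
  0 <= a z * (1 - cos (phase s z x)).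
Proof.
have [->|z0] := eqVneq z 0; last by rewrite mulr_ge0 ?onemcos_ge0 ?intensity_ge0.
rewrite (_ : phase s 0 x = 0) ?cos0 ?subrr ?mulr0//.
by rewrite /phase big1// => i _; rewrite mxE mulr0 mul0r.
Qed.

(* From |e^{iv} - e^{iu}|^2 <= 2|1 - e^{iu}|^2 + 2|1 - e^{iv}|^2. *)
Lemma onemcosB_le (u v : R) : 1 - cos (v - u) <= 2 * (1 - cos u) + 2 * (1 - cos v).
Proof.
rewrite cosB; have := cos2Dsin2 u; have := cos2Dsin2 v.
have := sqr_ge0 (sin u + sin v); have := sqr_ge0 (2 - cos u - cos v).
rewrite !expr2; nra.
Qed.

(* With k |s x_i| in [pi/2, 3pi/2], one of the phases at z and z + k e_i is far
   from 2 pi Z; the points z are taken in a cube of side proportional to k. *)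
Lemma rate_symb_lower : exists2 c, 0 < c &
  forall s, 0 < s -> forall (x : sftype (euclid R d)), @ebox R d (pi / s) x ->
  forall i, c * (s `^ alpha * `|ecoord x i| `^ alpha) <= jump_rate a * symb a s x.
Proof.
have [M [c [C [M0 c0 C0 h]]]] := intensity_bounds.
have [a0 a2] := andP alpha02.
have q0 := jump_rate_gt0 ha.
pose m := (Num.truncn M).+1.
have mM : M < m%:R by exact: truncnS_gt.
pose b := d%:R + alpha.
(* A point with coordinates between N and 3N has norm at most 3 sqrt(d) N, hence at most D N. *)
pose D : R := 3 * d%:R.
have D0 : 0 < D by rewrite mulr_gt0// ltr0n.
pose A := m%:R * (3 / 2 * pi) : R.
have A0 : 0 < A by rewrite mulr_gt0 ?ltr0n// mulr_gt0 ?pi_gt0.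
exists (c * D `^ (- b) * A `^ (- alpha) / 4).
  by rewrite divr_gt0// !mulr_gt0 ?powR_gt0.
move=> s s0 x xB i.
have [x0|x0] := eqVneq (ecoord x i) 0.
  by rewrite x0 normr0 powR0 ?lt0r_neq0// !mulr0 mulr_ge0 ?symb_ge0// ltW.
pose th := s * `|ecoord x i|.
have th0 : 0 < th by rewrite mulr_gt0 ?normr_gt0.
have thpi : th <= pi.
  by rewrite /th mulrC -ler_pdivlMr// ler_norml xB.
(* The first multiple of [th] beyond pi / 2 overshoots by at most [th], and th <= pi because [x]
   lies in the box; hence k th <= 3 pi / 2, where the cosine is still nonpositive. *)
pose k := (Num.truncn (pi / 2 / th)).+1.
have k1 : pi / 2 <= k%:R * th by rewrite -ler_pdivrMr// ltW// truncnS_gt.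
have k2 : k%:R * th <= 3 / 2 * pi.
  have : (Num.truncn (pi / 2 / th))%:R <= pi / 2 / th.
    by rewrite truncn_le// divr_ge0 ?(ltW th0)// divr_ge0 ?pi_ge0.
  by rewrite ler_pdivlMr// => hk; rewrite /k -natr1 mulrDl mul1r; lra.
pose w : Z := \row_j (if j == i then k%:Z else 0).
have phw : `|phase s w x| = k%:R * th.
  rewrite /phase (bigD1 i)//= big1 ?addr0; last first.
    by move=> j /negPf ji; rewrite mxE ji mulr0 mul0r.
  by rewrite mxE eqxx !normrM (gtr0_norm s0) /th ger0_norm//; ring.
have cosw : cos (phase s w x) <= 0.
  have -> : cos (phase s w x) = cos (k%:R * th).
    by rewrite -phw; case: (ger0P (phase s w x)) => // _; rewrite cosN.
  have -> : k%:R * th = (k%:R * th - pi) + pi by rewrite subrK.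
  rewrite cosDpi oppr_le0 cos_ge0_pihalf//; apply/andP; split; lra.
(* N is of order 1 / th: a cube of N^d points with intensities of order N^(-d - alpha) contributes
   N^(-alpha), that is th^alpha. The factor [m] pushes the cube beyond the radius [M]. *)
pose N := (m * k)%N.
pose e1 (f : {ffun 'I_d -> 'I_N}) : Z := \row_j (N + f j)%N%:Z.
pose e2 (f : {ffun 'I_d -> 'I_N}) : Z := e1 f + w.
have e1inj : injective e1.
  move=> f g /rowP fg; apply/ffunP => j; apply/val_inj.
  by have := fg j; rewrite !mxE => -[] /addnI.
have e2inj : injective e2 by move=> f g /addIr/e1inj.
have low z : (forall j, N%:R <= ((z 0 j)%:~R : R) <= 3 * N%:R) ->
    c * (D * N%:R) `^ (- b) <= a z.
  move=> zN.
  have Nz : N%:R <= znorm R z.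
    rewrite -enorm_zvec; apply: le_trans (le_coord_enorm _ i).
    by rewrite mxE (le_trans _ (ler_norm _))//; case/andP: (zN i).
  have mN : m%:R <= N%:R :> R by rewrite ler_nat leq_pmulr.
  have zM : M < znorm R z by apply: lt_le_trans Nz; exact: lt_le_trans mN.
  have /andP[hc _] := h z zM.
  have z0 : 0 < znorm R z by apply: le_lt_trans zM.
  have zD : znorm R z <= D * N%:R.
    rewrite -[leRHS]ger0_norm ?mulr_ge0 ?(ltW D0)// -sqrtr_sqr /znorm ler_sqrt ?sqr_ge0//.
    apply: (@le_trans _ _ (\sum_(j < d) (3 * N%:R) ^+ 2)).
      apply: ler_sum => j _; have /andP[z1 z2] := zN j.
      have z3 : (0 : R) <= (z 0 j)%:~R by exact: le_trans z1.
      by rewrite !expr2; exact: ler_pM.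
    rewrite sumr_const card_ord -[leLHS]mulr_natl.
    have -> : (D * N%:R) ^+ 2 = d%:R ^+ 2 * (3 * N%:R) ^+ 2 by rewrite /D; ring.
    rewrite ler_wpM2r ?sqr_ge0//.
    by rewrite -natrX ler_nat -{1}(expn1 d) leq_pexp2l.
  have b0 : 0 <= b by rewrite addr_ge0// ltW.
  have DN0 : 0 < D * N%:R by apply: lt_le_trans zD.
  rewrite powRN ler_pdivrMr ?powR_gt0//.
  apply: (le_trans hc); rewrite ler_wpM2l//.
    by apply: intensity_ge0; apply: contraTneq z0 => ->; rewrite /znorm big1 ?sqrtr0 ?ltxx// => j _; rewrite mxE expr0n.
  by rewrite ge0_ler_powR// nnegrE ltW.
have kN : (k <= N)%N by rewrite leq_pmull.
have l1 f : c * (D * N%:R) `^ (- b) <= a (e1 f).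
  apply: low => j; rewrite mxE -pmulrn -natrM !ler_nat.
  by have := nat_cube_bounds (ltn_ord (f j)) (leq0n N); rewrite addn0.
have l2 f : c * (D * N%:R) `^ (- b) <= a (e2 f).
  apply: low => j; rewrite 3!mxE.
  have -> : ((N + f j)%N%:Z + (if j == i then k%:Z else 0)) =
      (N + f j + (if j == i then k else 0))%N%:Z by case: ifP; rewrite PoszD.
  rewrite -pmulrn -natrM !ler_nat; apply: nat_cube_bounds; first exact: ltn_ord.
  by case: ifP.
have sum1 := finite_le_esum e1inj (f := fun z => (a z * (1 - cos (phase s z x)))%:E)
  ltac:(by move=> z; rewrite lee_fin intensity_onemcos_ge0).
have sum2 := finite_le_esum e2inj (f := fun z => (a z * (1 - cos (phase s z x)))%:E)
  ltac:(by move=> z; rewrite lee_fin intensity_onemcos_ge0).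
rewrite -rate_symbE sumEFin lee_fin in sum1.
rewrite -rate_symbE sumEFin lee_fin in sum2.
(* Each pair of points satisfies (1 - cos u) + (1 - cos v) >= 1/2. The two families may overlap, so
   each is compared separately with the full sum, whence the factor 2 on the right. *)
have key : N%:R ^+ d * (c * (D * N%:R) `^ (- b) / 2) <= 2 * (jump_rate a * symb a s x).
  rewrite mulr_natl mulr2n; apply: le_trans (lerD sum1 sum2).
  rewrite -big_split/=.
  have -> : N%:R ^+ d * (c * (D * N%:R) `^ (- b) / 2) =
      \sum_(f : {ffun 'I_d -> 'I_N}) c * (D * N%:R) `^ (- b) / 2.
    by rewrite sumr_const card_ffun !card_ord -[RHS]mulr_natl natrX.
  apply: ler_sum => f _.
  have := onemcosB_le (phase s (e1 f) x) (phase s (e2 f) x).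
  rewrite -phaseB {1}/e2 addrAC subrr add0r => hcos.
  have B0 : 0 <= c * (D * N%:R) `^ (- b) by rewrite mulr_ge0 ?powR_ge0// ltW.
  have u0 := onemcos_ge0 (phase s (e1 f) x).
  have v0 := onemcos_ge0 (phase s (e2 f) x).
  have := ler_wpM2r u0 (l1 f); have := ler_wpM2r v0 (l2 f).
  have : (c * (D * N%:R) `^ (- b)) * 1 <= (c * (D * N%:R) `^ (- b)) *
      (2 * (1 - cos (phase s (e1 f) x)) + 2 * (1 - cos (phase s (e2 f) x))).
    by rewrite ler_wpM2l//; lra.
  by rewrite mulrDr; lra.
have N0 : 0 < N%:R :> R by rewrite ltr0n muln_gt0.
have Nd : N%:R ^+ d * (D * N%:R) `^ (- b) = D `^ (- b) * N%:R `^ (- alpha).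
  rewrite powRM ?(ltW D0) ?(ltW N0)// mulrCA; congr (_ * _).
  rewrite -powR_mulrn ?(ltW N0)// -powRD; first by congr (_ `^ _); rewrite /b; ring.
  by apply/implyP => _; exact: lt0r_neq0.
have NA : A `^ (- alpha) * th `^ alpha <= N%:R `^ (- alpha).
  rewrite !powRN mulrC ler_pdivrMr ?powR_gt0// mulrC ler_pdivlMr ?powR_gt0//.
  rewrite -powRM ?(ltW th0) ?(ltW N0)// ge0_ler_powR ?nnegrE ?(ltW a0) ?(ltW A0)//.
    by rewrite mulr_ge0 ?(ltW th0) ?(ltW N0).
  have -> : th * N%:R = m%:R * (k%:R * th) by rewrite /N natrM; ring.
  by rewrite /A ler_wpM2l.
have thE : s `^ alpha * `|ecoord x i| `^ alpha = th `^ alpha by rewrite powRM// ltW.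
rewrite thE.
have keyE : N%:R ^+ d * (c * (D * N%:R) `^ (- b) / 2) = c / 2 * D `^ (- b) * N%:R `^ (- alpha).
  by rewrite -[RHS]mulrA -Nd; ring.
rewrite keyE in key.
have : c / 2 * D `^ (- b) * (A `^ (- alpha) * th `^ alpha) <= c / 2 * D `^ (- b) * N%:R `^ (- alpha).
  by rewrite ler_wpM2l// mulr_ge0 ?powR_ge0// divr_ge0// ltW.
lra.
Qed.

End kernel_bounds.

Lemma sin_le_id (R : realType) (t : R) : 0 <= t -> sin t <= t.
Proof.
move=> t0.
have cs : {within `[0, t], continuous (@sin R)}.
  by apply: continuous_subspaceT => x; exact: continuous_sin.
have [c _] := MVT_segment t0 (fun x _ => is_derive_sin x) cs.
rewrite sin0 !subr0 => ->; by rewrite -[leRHS]mul1r ler_wpM2r ?cos_le1.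
Qed.

Lemma onemcos_le_sqr (R : realType) (t : R) : 1 - cos t <= t ^+ 2.
Proof.
wlog t0 : t / 0 <= t.
  move=> h; have [t0|t0] := leP 0 t; first exact: h.
  by rewrite -cosN -sqrrN; apply: h; rewrite oppr_ge0 ltW.
have cc : {within `[0, t], continuous (@cos R)}.
  by apply: continuous_subspaceT => x; exact: continuous_cos.
have [c cI] := MVT_segment t0 (fun x _ => is_derive_cos x) cc.
rewrite cos0 subr0 => h; move: cI; rewrite in_itv/= => /andP[c0 ct].
have -> : 1 - cos t = sin c * t by rewrite -opprB h mulNr opprK.
by rewrite expr2 ler_wpM2r// (le_trans (sin_le_id c0)).
Qed.

Lemma cvg_mul_floor (R : realType) (x : R) (u : nat -> R) : (forall n, 0 < u n) ->
  u n @[n --> \oo] --> 0 ->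
  u n * (Num.floor (x / u n))%:~R @[n --> \oo] --> x.
Proof.
move=> u0 cu; apply: (@squeeze_cvgr _ _ _ _ (fun n => x - u n) (cst x)).
- near=> n; have un := u0 n.
  have h1 := floor_le (x / u n); have h2 := floorD1_gt (x / u n).
  rewrite ler_pdivlMr// in h1; rewrite ltr_pdivrMr// intrD mulrDl mul1r in h2.
  rewrite /= [u n * _]mulrC; apply/andP; split; lra.
- by rewrite -[X in _ --> X]subr0; apply: cvgB => //; exact: cvg_cst.
- exact: cvg_cst.
Unshelve. all: by end_near. Qed.

Section symbol_limit.
Context {R : realType} {d : nat}.
Variables (a : 'rV[int]_d -> R) (alpha : R) (H : 'rV[R]_d -> R).
Local Notation Z := 'rV[int]_d.
Local Notation E := (sftype (euclid R d)).
Local Notation vol := (sfmeasure (euclid R d)).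
Implicit Types (z : Z) (x xi : E) (s : R) (u : nat -> R).
Hypotheses (d0 : (0 < d)%N) (ha : rw_intensity a) (alpha02 : 0 < alpha < 2).
Hypothesis cH : {within @usphere R d, continuous H}.
Hypothesis H0 : forall v : 'rV[R]_d, @usphere R d v -> 0 < H v.
Hypothesis aH : forall e : R, 0 < e -> exists M : R, forall z : Z, M < znorm R z ->
  `| a z * znorm R z `^ (d%:R + alpha) / H (zdir R z) - 1 | < e.

Let b := d%:R + alpha.

Definition evec x : 'rV[R]_d := \row_i ecoord x i.

Definition dotp x xi : R := \sum_(i < d) ecoord x i * ecoord xi i.

(** The integral multiplies each lattice term by the cell volume s^d, so the prefactor s^(-d -
    alpha) leaves s^(-alpha) phi(s xi). *)
Definition riem s xi x : R :=
  s `^ (- b) * (a (floorv s x) * (1 - cos (phase s (floorv s x) xi))).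

(** H(x / |x|) |x|^(-d - alpha) is the density of the Levy measure of a stable law; integrated over
    [x], this integrand gives its symbol at [xi]. *)
Definition riem_lim xi x : R :=
  H ((enorm (evec x))^-1 *: evec x) * enorm (evec x) `^ (- b) * (1 - cos (dotp x xi)).

Lemma riem_ge0 s xi x : 0 <= riem s xi x.
Proof. by apply: mulr_ge0; [exact: powR_ge0|exact: (intensity_onemcos_ge0 ha)]. Qed.

Lemma measurable_riem s xi : 0 < s -> measurable_fun [set: E] (riem s xi).
Proof.
move=> s0; apply/measurable_EFinP.
apply: (measurable_floorv (F := fun z => (s `^ (- b) * (a z * (1 - cos (phase s z xi))))%:E)) => // z.
by rewrite lee_fin; apply: mulr_ge0; [exact: powR_ge0|exact: (intensity_onemcos_ge0 ha)].
Qed.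

Lemma integral_riem s xi : 0 < s ->
  (\int[vol]_x (riem s xi x)%:E = (s `^ (- alpha) * (jump_rate a * symb a s xi))%:E)%E.
Proof.
move=> s0.
rewrite (esum_integral_floorv (F := fun z => (s `^ (- b) * (a z * (1 - cos (phase s z xi))))%:E))//; last first.
  by move=> z; rewrite lee_fin; apply: mulr_ge0; [exact: powR_ge0|exact: (intensity_onemcos_ge0 ha)].
under eq_esum do rewrite EFinM.
rewrite esumZl ?powR_ge0//; last by move=> z; rewrite lee_fin (intensity_onemcos_ge0 ha).
rewrite -(rate_symbE ha) -!EFinM mulrA; congr (_ * _)%:E.
rewrite -powR_mulrn ?(ltW s0)// -powRD; first by congr (_ `^ _); rewrite /b; ring.
by apply/implyP => _; exact: lt0r_neq0.
Qed.

(** For x <> 0 the lattice points z_n = floor (x / u_n) satisfy u_n z_n -> x. So |z_n| tends to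
    infinity, where the asymptotics of [a] apply, and the direction of z_n tends to that of [x]. *)
Lemma riem_cvg u xi x : (forall n, 0 < u n) -> u n @[n --> \oo] --> 0 ->
  riem (u n) xi x @[n --> \oo] --> riem_lim xi x.
Proof.
(* At x = 0 the direction and the negative power are default values, but the factor 1 - cos vanishes
   on both sides. *)
move=> u0 cu; have [v0|v0] := eqVneq (evec x) 0.
  have xi0 i : ecoord x i = 0 by have /rowP/(_ i) := v0; rewrite !mxE.
  have fl0 s : floorv s x = 0 by apply/rowP => i; rewrite !mxE xi0 mul0r floor0.
  have ph0 s : phase s 0 xi = 0 by rewrite /phase big1// => i _; rewrite mxE mulr0 mul0r.
  have -> : riem_lim xi x = 0.
    by rewrite /riem_lim /dotp big1 ?cos0 ?subrr ?mulr0// => i _; rewrite xi0 mul0r.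
  rewrite (_ : (fun n => riem (u n) xi x) = cst 0); first exact: cvg_cst.
  by apply/funext => n; rewrite /riem fl0 ph0 cos0 subrr !mulr0.
have nv0 := enorm_gt0 v0.
pose z n : Z := floorv (u n) x.
pose y n : 'rV[R]_d := u n *: zvec (z n).
have cyi i : y n 0 i @[n --> \oo] --> evec x 0 i.
  rewrite mxE; under eq_fun do rewrite /y /z !mxE.
  exact: cvg_mul_floor.
have cy : y n @[n --> \oo] --> evec x.
  apply/cvgrPdist_lt => e e0.
  have : \forall n \near \oo, forall i, `|evec x 0 i - y n 0 i| < e.
    by apply: filter_forall => i; have /cvgrPdist_lt := cyi i; exact.
  apply: filterS => n h; rewrite [ltLHS]/Num.Def.normr/= mx_normrE.
  by apply: bigmax_lt => // -[j i] _ /=; rewrite ord1 !mxE; have := h i; rewrite !mxE.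
have cny : enorm (y n) @[n --> \oo] --> enorm (evec x).
  exact: (cvg_comp _ _ cy (@enorm_continuous _ _ _)).
have nyE n : enorm (y n) = u n * znorm R (z n).
  by rewrite /y enormZ ?(ltW (u0 n))// enorm_zvec.
have zoo (M : R) : \forall n \near \oo, M < znorm R (z n).
  have h1 : \forall n \near \oo, enorm (evec x) / 2 < enorm (y n).
    by apply: (cvgr_gt _ cny); rewrite ltr_pdivrMr//; lra.
  have h2 : \forall n \near \oo, u n < enorm (evec x) / 2 / (`|M| + 1).
    by apply: (cvgr_lt _ cu); rewrite !divr_gt0// ltr_wpDl.
  near=> n.
  have k1 : enorm (evec x) / 2 < enorm (y n) by near: n.
  have k2 : u n < enorm (evec x) / 2 / (`|M| + 1) by near: n.
  rewrite ltr_pdivlMr ?ltr_wpDl// in k2; rewrite nyE in k1.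
  have := lt_trans k2 k1; rewrite ltr_pM2l// => k3.
  by apply: le_lt_trans k3; rewrite (le_trans (ler_norm M))// lerDl.
have zn0 : \forall n \near \oo, z n != 0.
  near=> n; have : 0 < znorm R (z n) by near: n; exact: zoo.
  by apply: contraTneq => ->; rewrite /znorm big1 ?sqrtr0 ?ltxx// => j _; rewrite mxE expr0n.
have c1 : a (z n) * znorm R (z n) `^ b / H (zdir R (z n)) @[n --> \oo] --> (1 : R).
  apply/cvgrPdist_lt => e e0; have [M hM] := aH e0.
  near=> n; rewrite distrC; apply: hM.
  by near: n; exact: zoo.
have zdirE' : \forall n \near \oo, zdir R (z n) = (enorm (y n))^-1 *: y n.
  near=> n; rewrite zdirE nyE /y scalerA; congr (_ *: _).
  by rewrite invfM mulrAC mulVf ?mul1r// lt0r_neq0.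
(* [H] is continuous only within the sphere, so the directions must lie on it, which holds once z_n
   is nonzero. *)
have c2 : H (zdir R (z n)) @[n --> \oo] --> H ((enorm (evec x))^-1 *: evec x).
  have Su : @usphere R d ((enorm (evec x))^-1 *: evec x).
    by rewrite /usphere/= enormZ ?invr_ge0 ?(ltW nv0)// mulVf// lt0r_neq0.
  have /subspace_continuousP/(_ _ Su) := cH; apply: cvg_comp.
  have cw : zdir R (z n) @[n --> \oo] --> (enorm (evec x))^-1 *: evec x.
    have : (enorm (y n))^-1 *: y n @[n --> \oo] --> (enorm (evec x))^-1 *: evec x.
      by apply: cvgZ => //; apply: cvgV => //; exact: lt0r_neq0.
    apply: cvg_trans; apply: near_eq_cvg; apply: filterS zdirE' => n ->.
    by [].
  move=> P /= /cw nP; have {}nP : \forall n \near \oo,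
    @usphere R d (zdir R (z n)) -> P (zdir R (z n)) by exact: nP.
  by apply: filterS2 nP zn0 => n h1 h2; apply: h1; exact: usphere_zdir.
have c3 : enorm (y n) `^ (- b) @[n --> \oo] --> enorm (evec x) `^ (- b).
  exact: (cvg_comp _ _ cny (continuous_powRx nv0)).
have c4 : phase (u n) (z n) xi @[n --> \oo] --> dotp x xi.
  apply: (@cvg_sumr _ _ \oo _ _ _ (fun i n => u n * (z n 0 i)%:~R * ecoord xi i)
    (fun i => ecoord x i * ecoord xi i)) => i; apply: cvgMl.
  rewrite /z /floorv; under eq_fun do rewrite mxE.
  exact: cvg_mul_floor.
have c5 : 1 - cos (phase (u n) (z n) xi) @[n --> \oo] --> 1 - cos (dotp x xi).
  apply: cvgB; first exact: cvg_cst.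
  exact: (cvg_comp _ _ c4 (@continuous_cos _ _)).
pose F n := a (z n) * znorm R (z n) `^ b / H (zdir R (z n)) * H (zdir R (z n)) *
  enorm (y n) `^ (- b) * (1 - cos (phase (u n) (z n) xi)).
have c6 : F n @[n --> \oo] --> riem_lim xi x.
  by rewrite /riem_lim -[H _]mul1r; exact: cvgM (cvgM (cvgM c1 c2) c3) c5.
apply: cvg_trans c6; apply: near_eq_cvg; near=> n.
have z0 : z n != 0 by near: n.
rewrite /F /riem -/(z n) nyE powRM; last 2 first.
- exact: ltW.
- exact: sqrtr_ge0.
have hz : 0 < H (zdir R (z n)) by apply: H0; exact: usphere_zdir.
have nz := znorm_powR_gt0 b z0 (R := R).
by rewrite [znorm _ _ `^ (- b)]powRN; field; rewrite !lt0r_neq0.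
Unshelve. all: by end_near. Qed.

End symbol_limit.

(** The majorant takes extended values because [gdom] is infinite at 0. *)
Lemma dominated_cvg_Rintegral dd (T : measurableType dd) (R : realType)
    (mu : {measure set T -> \bar R}) (D : set T) (f_ : nat -> T -> R) (f : T -> R)
    (G : T -> \bar R) : measurable D ->
  (forall n, measurable_fun D (f_ n)) ->
  (forall x, D x -> f_ n x @[n --> \oo] --> f x) ->
  mu.-integrable D G -> (forall n x, D x -> (`|f_ n x|%:E <= G x)%E) ->
  [/\ measurable_fun D f, mu.-integrable D (EFin \o f) &
     \int[mu]_(x in D) f_ n x @[n --> \oo] --> \int[mu]_(x in D) f x].
Proof.
move=> mD mf_ cf iG fG.
have mE n : measurable_fun D (EFin \o f_ n) by exact/measurable_EFinP.
have cE x : D x -> (EFin \o f_ n) x @[n --> \oo] --> (EFin \o f) x.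
  by move=> Dx; apply/fine_cvgP; split; [near=> n|exact: cf].
have mf : measurable_fun D (EFin \o f) by exact: (emeasurable_fun_cvg _ _ mE cE).
have [|||if_ _ hc] := @dominated_convergence _ _ _ mu D mD (fun n => EFin \o f_ n)
  (EFin \o f) G mE mf.
- exact: aeW.
- exact: iG.
- by apply: aeW => x n Dx; exact: fG.
split => //; first exact/measurable_EFinP.
apply: fine_cvg; rewrite fineK//.
exact: (integrable_fin_num mD if_).
Unshelve. all: by end_near. Qed.

(** * Majorants of product form *)

Section dominating.
Context {R : realType}.
Implicit Types (A B r y : R).
Local Notation mu := (@lebesgue_measure R).

Lemma integral_even_lty (f : R -> \bar R) :
  measurable_fun [set: R] f -> (forall x, 0 <= f x)%E -> (forall x, f (- x) = f x) ->
  (\int[mu]_(x in `[0%R, +oo[) f x < +oo)%E -> (\int[mu]_x f x < +oo)%E.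
Proof.
move=> mf f0 fN foo.
have -> : [set: R] = `[0%R, +oo[%classic `|` `]-oo, 0%R[%classic.
  apply/seteqP; split => // x _ /=; rewrite !in_itv/= andbT.
  by case: (leP 0 x) => _; [left|right].
rewrite ge0_integral_setU//=; first 1 last.
- exact: measurable_funTS.
- by apply/disj_setPS => x /= []; rewrite !in_itv/= andbT leNgt => /negP.
rewrite lte_add_pinfty//.
apply: (@le_lt_trans _ _ (\int[mu]_(x in `]-oo, 0%R]) f x)%E).
  apply: ge0_subset_integral => //; first exact: measurable_funTS.
  by move=> x /=; rewrite !in_itv/=; exact: ltW.
rewrite (_ : (\int[mu]_(x in _) _)%E = (\int[mu]_(x in `]-oo, 0%R]) f (- x)%R)%E).
  by rewrite -ge0_integration_by_substitution0.
by apply: eq_integral => x _; rewrite fN.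
Qed.

(* +oo at 0, where the powers in [pmin] take the junk value 0. *)
Definition gdom A B y : \bar R := if y == 0 then +oo%E else (pmin A B (`|y| / 2))%:E.

Lemma gdom_ge0 A B y : (0 <= gdom A B y)%E.
Proof. by rewrite /gdom; case: ifP => // _; rewrite lee_fin pmin_ge0. Qed.

Lemma measurable_gdom A B : measurable_fun [set: R] (gdom A B).
Proof.
apply: measurable_fun_ifT => //=.
  exact: measurable_fun_eqr.
apply/measurable_EFinP.
have mh : measurable_fun [set: R] (fun x : R => `|x| / 2).
  by apply: measurable_funM => //; exact: normr_measurable.
exact: (measurableT_comp (@measurable_pmin R A B setT) mh).
Qed.

Lemma integral_gdom A B : A < 1 -> 1 < B -> (\int[mu]_x gdom A B x < +oo)%E.
Proof.
move=> A1 B1; apply: integral_even_lty => //.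
- exact: measurable_gdom.
- by move=> x; exact: gdom_ge0.
- by move=> x; rewrite /gdom oppr_eq0 normrN.
rewrite -integral_itv_obnd_cbnd; last by apply: measurable_funTS; exact: measurable_gdom.
rewrite (_ : (\int[mu]_(x in _) _)%E =
    (\int[mu]_(x in `]0%R, +oo[) (pmin A B (2^-1 * x))%:E)%E); last first.
  apply: eq_integral => x; rewrite inE/= in_itv/= andbT => x0.
  by rewrite /gdom gt_eqF// gtr0_norm// mulrC.
rewrite integral_itv_obnd_cbnd; last first.
  apply/measurable_EFinP; apply: (measurableT_comp (@measurable_pmin R A B setT)).
  exact: measurable_funM.
rewrite (ge0_integral_scale (f := fun x => (pmin A B x)%:E)).
- by rewrite lte_mul_pinfty// ?lee_fin ?invr_ge0//; exact: integral_pmin.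
- by rewrite invr_gt0.
- by apply/measurable_EFinP; exact: measurable_pmin.
- by move=> x; rewrite lee_fin pmin_ge0.
Qed.

Lemma ler_powRN p r r' : 0 <= p -> 0 < r' -> r' <= r -> r `^ (- p) <= r' `^ (- p).
Proof.
move=> p0 r0 rr; have r1 : 0 < r by apply: lt_le_trans rr.
by rewrite !powRN lef_pV2 ?posrE ?powR_gt0// ge0_ler_powR// nnegrE ltW.
Qed.

Lemma le_pmin A B r r' : 0 <= A -> 0 <= B -> 0 < r' -> r' <= r -> pmin A B r <= pmin A B r'.
Proof.
move=> A0 B0 r0 rr; rewrite /pmin le_min !ge_min.
by rewrite (ler_powRN A0 r0 rr) (ler_powRN B0 r0 rr) orbT.
Qed.

Lemma expe_le_prod d (g : 'I_d -> \bar R) (c : R) : 0 <= c ->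
  (forall i, c%:E <= g i)%E -> ((c ^+ d)%:E <= \prod_(i < d) g i)%E.
Proof.
move=> c0; elim: d g => [|d ih] g cg; first by rewrite big_ord0 expr0.
by rewrite big_ord_recl exprS EFinM lee_pmul ?lee_fin ?exprn_ge0//; exact: ih.
Qed.

Lemma powR_expn r p d : (r `^ p) ^+ d = r `^ (p * d%:R).
Proof. by rewrite -powR_mulrn ?powR_ge0// -powRrM. Qed.

(* Sharing the radial bound equally among the d coordinates turns the dominating
   function into a product, whose integrability is a one-dimensional matter. *)
Lemma min_sqr_le_pmin (d : nat) (alpha r : R) : (0 < d)%N -> 0 < alpha < 2 -> 0 < r ->
  r `^ (- (d%:R + alpha)) * Num.min 1 (r ^+ 2) <=
  pmin (1 - (1 - alpha / 2) / d%:R) (1 + alpha / d%:R) r ^+ d.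
Proof.
(* The exponents solve d B = d + alpha and d A = d - (1 - alpha / 2). Near 0 only half of the
   available margin 2 - alpha is used: this still gives A < 1 and keeps A nonnegative even for d =
   1, as monotonicity of [pmin] requires. *)
move=> d0 /andP[a0 a2] r0; set A := 1 - _; set B := 1 + _.
have dp : 0 < d%:R :> R by rewrite ltr0n.
have AB : - B <= - A.
  rewrite lerN2; apply: (@le_trans _ _ 1).
    by rewrite gerBl divr_ge0//; lra.
  by rewrite lerDl divr_ge0// ltW.
have e1 : (r `^ (- B)) ^+ d = r `^ (- (d%:R + alpha)).
  by rewrite powR_expn; congr (_ `^ _); rewrite /B; field; rewrite gt_eqF.
have e2 : (r `^ (- A)) ^+ d = r `^ (- d%:R + (1 - alpha / 2)).
  by rewrite powR_expn; congr (_ `^ _); rewrite /A; field; rewrite gt_eqF.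
have [r1|r1] := leP r 1.
  have -> : pmin A B r = r `^ (- A).
    by apply/min_idPl; apply: ger_powR => //; rewrite r0.
  rewrite e2; apply: (@le_trans _ _ (r `^ (- (d%:R + alpha)) * r ^+ 2)).
    by rewrite ler_wpM2l ?powR_ge0// ge_min lexx orbT.
  rewrite -powR_mulrn ?(ltW r0)// -powRD; last first.
    by apply/implyP => _; exact: lt0r_neq0.
  by apply: ger_powR; [rewrite r0|lra].
have -> : pmin A B r = r `^ (- B).
  by apply/min_idPr; apply: ler_powR => //; exact: ltW.
by rewrite e1 -[leRHS]mulr1 ler_wpM2l ?powR_ge0// ge_min lexx.
Qed.

End dominating.

Section symbol_cvg.
Context {R : realType} {d : nat}.
Variables (a : 'rV[int]_d -> R) (alpha : R) (H : 'rV[R]_d -> R).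
Local Notation Z := 'rV[int]_d.
Local Notation E := (sftype (euclid R d)).
Local Notation vol := (sfmeasure (euclid R d)).
Implicit Types (z : Z) (x xi : E) (s : R) (u : nat -> R).
Hypotheses (d0 : (0 < d)%N) (ha : rw_intensity a) (alpha02 : 0 < alpha < 2).
Hypothesis cH : {within @usphere R d, continuous H}.
Hypothesis H0 : forall v : 'rV[R]_d, @usphere R d v -> 0 < H v.
Hypothesis aH : forall e : R, 0 < e -> exists M : R, forall z : Z, M < znorm R z ->
  `| a z * znorm R z `^ (d%:R + alpha) / H (zdir R z) - 1 | < e.

Let b := d%:R + alpha.
Let A := 1 - (1 - alpha / 2) / d%:R.
Let B := 1 + alpha / d%:R.

Let dp : 0 < d%:R :> R. Proof. by rewrite ltr0n. Qed.
Let A0 : 0 <= A.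
Proof.
case/andP: alpha02 => a0 a2; have d1 : 1 <= d%:R :> R by rewrite ler1n.
by rewrite /A subr_ge0 ler_pdivrMr// mul1r; lra.
Qed.
Let A1 : A < 1.
Proof. by case/andP: alpha02 => a0 a2; rewrite /A gtrBl divr_gt0//; lra. Qed.
Let B1 : 1 < B.
Proof. by case/andP: alpha02 => a0 a2; rewrite /B ltrDl divr_gt0. Qed.

(** |x_i| is at most s (|z| + 1), and a nonzero lattice vector has norm at least 1. This transfers a
    bound at the lattice point to the point [x] itself. *)
Lemma le_floorv_norm s x i : 0 < s -> floorv s x != 0 ->
  `|ecoord x i| / 2 <= s * znorm R (floorv s x).
Proof.
move=> s0 z0; have n1 := znorm_ge1 (R := R) z0.
have zi : `|((floorv s x) 0 i)%:~R : R| <= znorm R (floorv s x).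
  by rewrite -enorm_zvec; apply: le_trans (le_coord_enorm _ i); rewrite [zvec _ 0 i]mxE.
have : `|ecoord x i / s| <= `|((floorv s x) 0 i)%:~R : R| + 1.
  rewrite mxE; have h1 := floor_le (ecoord x i / s).
  have h2 := floorD1_gt (ecoord x i / s); rewrite intrD in h2.
  set k := (Num.floor _)%:~R in h1 h2 *.
  have a1 := ler_norm k; have a2 := ler_norm (- k); rewrite normrN in a2.
  rewrite mulr1z in h2.
  by rewrite ler_norml; apply/andP; split; lra.
rewrite normrM normfV (gtr0_norm s0) ler_pdivrMr// => h.
rewrite ler_pdivrMr//.
apply: (le_trans h); rewrite mulrC -mulrA ler_wpM2l ?(ltW s0)//; lra.
Qed.

Lemma norm_phase_le s z xi : 0 < s ->
  `|phase s z xi| <= s * znorm R z * \sum_(i < d) `|ecoord xi i|.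
Proof.
move=> s0; rewrite (le_trans (ler_norm_sum _ _ _))// mulr_sumr ler_sum// => i _.
rewrite !normrM (gtr0_norm s0) ler_wpM2r// ler_wpM2l ?(ltW s0)//.
by rewrite -enorm_zvec; apply: le_trans (le_coord_enorm _ i); rewrite [zvec _ 0 i]mxE.
Qed.

(** Uniform in the mesh: with r = s |z| and S the l1 norm of [xi], 1 - cos is at most (2 + S^2)
    min(1, r^2), and monotonicity of [pmin] replaces r by |x_i| / 2 in every coordinate. The cell of
    the origin contributes nothing. *)
Lemma riem_bound xi : exists2 K, 0 < K & forall s x, 0 < s ->
  ((riem a alpha s xi x)%:E <= K%:E * \prod_(i < d) gdom A B (ecoord x i))%E.
Proof.
have [K0 K00 aK] := intensity_upper d0 ha alpha02 cH H0 aH.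
pose S := \sum_(i < d) `|ecoord xi i|.
have S0 : 0 <= S by apply: sumr_ge0.
have C0 : 0 < 2 + S ^+ 2 by rewrite ltr_wpDr ?sqr_ge0.
exists (K0 * (2 + S ^+ 2)); first exact: mulr_gt0.
move=> s x s0; set z := floorv s x.
have [z0|z0] := eqVneq z 0.
  have -> : riem a alpha s xi x = 0.
    rewrite /riem -/z z0 (_ : phase s 0 xi = 0) ?cos0 ?subrr ?mulr0//.
    by rewrite /phase big1// => i _; rewrite mxE mulr0 mul0r.
  by rewrite mule_ge0 ?lee_fin ?mulr_ge0 ?(ltW K00) ?(ltW C0)// prode_ge0// => i; rewrite gdom_ge0.
have n1 := znorm_ge1 (R := R) z0.
have n0 : 0 < znorm R z by apply: lt_le_trans n1.
pose r := s * znorm R z.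
have r0 : 0 < r by rewrite mulr_gt0.
have hcos : 1 - cos (phase s z xi) <= (2 + S ^+ 2) * Num.min 1 (r ^+ 2).
  have [_|_] := leP 1 (r ^+ 2).
    by have := onemcos_le2 (phase s z xi); have := sqr_ge0 S; lra.
  apply: (le_trans (onemcos_le_sqr _)).
  have := norm_phase_le z xi s0; rewrite -/S -/r => h.
  rewrite -real_normK ?num_real//; apply: (@le_trans _ _ ((r * S) ^+ 2)).
    by rewrite ler_sqr ?nnegrE ?mulr_ge0// ltW.
  by rewrite exprMn mulrC ler_wpM2r ?sqr_ge0// lerDr.
have hr : riem a alpha s xi x <=
    K0 * (2 + S ^+ 2) * (r `^ (- b) * Num.min 1 (r ^+ 2)).
  rewrite /riem -/z /r powRM ?(ltW s0) ?(ltW n0)//.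
  apply: (@le_trans _ _ (s `^ (- b) * ((K0 * znorm R z `^ (- b)) * ((2 + S ^+ 2) * Num.min 1 (r ^+ 2))))).
    rewrite ler_wpM2l ?powR_ge0// ler_pM//.
    - exact: (intensity_ge0 ha).
    - exact: aK.
  by rewrite le_eqVlt; apply/orP; left; apply/eqP; rewrite /r; ring.
have hp := min_sqr_le_pmin d0 alpha02 r0.
apply: (@le_trans _ _ (K0 * (2 + S ^+ 2) * pmin A B r ^+ d)%:E).
  by rewrite lee_fin (le_trans hr)// ler_wpM2l// ltW// mulr_gt0.
rewrite EFinM lee_wpmul2l ?lee_fin ?(ltW (mulr_gt0 _ _))//.
apply: expe_le_prod; first exact: pmin_ge0.
move=> i; rewrite /gdom; case: eqVneq => [_|xi0]; first by rewrite leey.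
rewrite lee_fin; apply: le_pmin => //; first by rewrite ltW// (lt_trans _ B1).
  by rewrite divr_gt0// normr_gt0.
exact: le_floorv_norm.
Qed.

(** The order of quantifiers matters: one limit serves all sequences, so a choice over [xi] later
    defines the limiting symbol [Phi]. *)
Lemma rate_symb_cvg xi : exists phi : R, forall u, (forall n, 0 < u n) ->
  u n @[n --> \oo] --> 0 ->
  u n `^ (- alpha) * (jump_rate a * symb a (u n) xi) @[n --> \oo] --> phi.
Proof.
have [K K0 hK] := riem_bound xi.
pose G x := (K%:E * \prod_(i < d) gdom A B (ecoord x i))%E.
have mG : measurable_fun [set: E] G.
  apply: emeasurable_funM => //.
  by apply: (measurable_prod_coord (f := fun=> gdom A B)) => i; exact: measurable_gdom.
have p0 x : (0 <= \prod_(i < d) gdom A B (ecoord x i))%E.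
  by apply: prode_ge0 => i _; exact: gdom_ge0.
have iG : vol.-integrable [set: E] G.
  apply/integrableP; split => //.
  rewrite (eq_integral G); last first.
    by move=> x _; rewrite gee0_abs// mule_ge0// lee_fin ltW.
  rewrite ge0_integralZl ?lee_fin ?(ltW K0)//; last first.
    by apply: (measurable_prod_coord (f := fun=> gdom A B)) => i; exact: measurable_gdom.
  rewrite (integral_prod_coord (f := fun=> gdom A B)); last 2 first.
  - by move=> i; exact: measurable_gdom.
  - by move=> i x; exact: gdom_ge0.
  rewrite lte_mul_pinfty ?lee_fin ?(ltW K0)// ltey_eq prode_fin_num// => i _.
  rewrite ge0_fin_numE; first exact: integral_gdom.
  by apply: integral_ge0 => x _; exact: gdom_ge0.
exists (\int[vol]_x riem_lim alpha H xi x); move=> u u0 cu.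
have mr n : measurable_fun [set: E] (riem a alpha (u n) xi) by exact: measurable_riem.
have dom n x : (`|riem a alpha (u n) xi x|%:E <= G x)%E.
  by rewrite ger0_norm ?(riem_ge0 _ ha)//; exact: hK.
have [_ _] := @dominated_cvg_Rintegral _ _ _ vol setT (fun n => riem a alpha (u n) xi)
  (riem_lim alpha H xi) G measurableT mr
  (fun x _ => riem_cvg cH H0 aH u0 cu) iG (fun n x _ => dom n x).
apply: cvg_trans; apply: near_eq_cvg; near=> n.
by rewrite /= /Rintegral integral_riem.
Unshelve. all: by end_near. Qed.

End symbol_cvg.

Lemma Rintegral_gt0 dd (T : measurableType dd) (R : realType)
    (mu : {measure set T -> \bar R}) (D : set T) (f : T -> R) : measurable D ->
  mu D != 0%E -> mu.-integrable D (EFin \o f) -> (forall x, D x -> 0 < f x) ->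
  0 < \int[mu]_(x in D) f x.
Proof.
move=> mD D0 fi f0; rewrite lt_neqAle Rintegral_ge0 ?andbT; last first.
  by move=> x Dx; exact/ltW/f0.
apply/negP => /eqP f00; move/negP: D0; apply; apply/eqP.
have fi0 : (\int[mu]_(x in D) `|(EFin \o f) x| = 0)%E.
  rewrite (eq_integral (EFin \o f)); last first.
    by move=> x /set_mem Dx; rewrite gee0_abs// lee_fin ltW// f0.
  by rewrite -(fineK (integrable_fin_num mD fi)); congr EFin; exact: esym f00.
have /(ae_eq_integral_abs mu mD (measurable_int _ fi)) h := fi0.
apply: measure_negligible => //; apply: negligibleS h => x Dx /= /(_ Dx) [] fx0.
by have := f0 x Dx; rewrite fx0 ltxx.
Qed.

(** For w > 1, w^r <= w^(n+1) <= (n+1)! e^w by a single term of the exponential series; the summand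
    1 of the bound covers w <= 1. *)
Lemma powR_expRN_bound (R : realType) (r : R) : 0 <= r ->
  exists2 M, 0 < M & forall w, 0 <= w -> w `^ r * expR (- w) <= M.
Proof.
move=> r0; pose n := Num.truncn r.
exists (1 + n.+1`!%:R); first by rewrite ltr_wpDr.
move=> w w0; have [w1|w1] := leP w 1.
  apply: (@le_trans _ _ (1 * 1)); last by rewrite mulr1 lerDl.
  apply: ler_pM; rewrite ?powR_ge0 ?expR_ge0//; last by rewrite expR_le1 oppr_le0.
  apply: (@le_trans _ _ (1 `^ r)); last by rewrite powR1.
  by apply: ge0_ler_powR; rewrite ?nnegrE.
apply: (@le_trans _ _ n.+1`!%:R); last by rewrite lerDr.
rewrite expRN ler_pdivrMr ?expR_gt0//.
apply: (@le_trans _ _ (w ^+ n.+1)).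
  rewrite -powR_mulrn//; apply: ler_powR; first exact: ltW.
  by rewrite ltW// truncnS_gt.
rewrite -ler_pdivrMl ?ltr0n ?fact_gt0//.
by rewrite mulrC; apply: le_trans (expR_ge1Dxn n w0); rewrite lerDr.
Qed.

Lemma integral_expRN_powR (R : realType) (c alpha : R) : 0 < c -> 0 < alpha ->
  (\int[@lebesgue_measure R]_x (expR (- (c * `|x| `^ alpha)))%:E < +oo)%E.
Proof.
move=> c0 a0.
have mf : measurable_fun [set: R] (fun x : R => expR (- (c * `|x| `^ alpha))).
  have m1 : measurable_fun [set: R] (fun x : R => `|x| `^ alpha).
    exact: (measurableT_comp (@measurable_powR R alpha) (@normr_measurable R setT)).
  apply: (measurableT_comp (@measurable_expR R)).
  by apply: measurableT_comp => //; exact: measurable_funM.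
apply: integral_even_lty.
- exact/measurable_EFinP.
- by move=> x; rewrite lee_fin expR_ge0.
- by move=> x; rewrite normrN.
(* The exponent 2 / alpha turns x^alpha into x^2, so the stretched exponential decays at least like
   x^(-2). *)
have [M M0 hM] := @powR_expRN_bound R (2 / alpha) ltac:(by rewrite divr_ge0// ltW).
pose K := 1 + M * c `^ (- (2 / alpha)).
have K0 : 0 <= K by rewrite addr_ge0// mulr_ge0 ?powR_ge0// ltW.
rewrite -integral_itv_obnd_cbnd; last by apply/measurable_EFinP; exact: measurable_funTS.
apply: (@le_lt_trans _ _ (\int[@lebesgue_measure R]_(x in `]0%R, +oo[) (K%:E * (pmin 0 2 x)%:E))%E).
  apply: ge0_le_integral => //.
  - by apply/measurable_EFinP; exact: measurable_funTS.
  - by apply: emeasurable_funM => //; apply/measurable_EFinP; exact: measurable_pmin.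
  - move=> x; rewrite /= in_itv/= andbT => x0; rewrite -EFinM lee_fin (gtr0_norm x0).
    rewrite /pmin minr_pMr// le_min oppr0 powRr0 mulr1; apply/andP; split.
      apply: (@le_trans _ _ 1); last by rewrite lerDl mulr_ge0 ?powR_ge0// ltW.
      by rewrite expR_le1 oppr_le0 mulr_ge0 ?powR_ge0// ltW.
    apply: (@le_trans _ _ (M * c `^ (- (2 / alpha)) * x `^ (- 2))); last first.
      by rewrite ler_wpM2r ?powR_ge0// lerDr.
    have w0 : 0 <= c * x `^ alpha by rewrite mulr_ge0 ?powR_ge0// ltW.
    have := hM _ w0; rewrite powRM ?powR_ge0 ?(ltW c0)// -powRrM.
    have -> : alpha * (2 / alpha) = 2 by field; rewrite gt_eqF.
    rewrite !powRN => h; have cp := powR_gt0 (2 / alpha) c0; have xp := powR_gt0 2 x0.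
    by rewrite -mulrA -invfM ler_pdivlMr ?mulr_gt0// mulrC.
rewrite ge0_integralZl//; last 2 first.
- by apply/measurable_EFinP; exact: measurable_pmin.
- by move=> x _; rewrite lee_fin pmin_ge0.
rewrite lte_mul_pinfty// integral_itv_obnd_cbnd; last first.
  by apply/measurable_EFinP; exact: measurable_pmin.
by apply: integral_pmin; lra.
Qed.

(** * Local limit theorem at the origin *)

Section local_limit.
Context {R : realType} {d : nat}.
Variables (a : 'rV[int]_d -> R) (alpha : R) (H : 'rV[R]_d -> R).
Local Notation Z := 'rV[int]_d.
Local Notation E := (sftype (euclid R d)).
Local Notation vol := (sfmeasure (euclid R d)).
Implicit Types (z : Z) (x xi : E) (s t : R) (u : nat -> R).
Hypotheses (d0 : (0 < d)%N) (ha : rw_intensity a) (alpha02 : 0 < alpha < 2).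
Hypothesis cH : {within @usphere R d, continuous H}.
Hypothesis H0 : forall v : 'rV[R]_d, @usphere R d v -> 0 < H v.
Hypothesis aH : forall e : R, 0 < e -> exists M : R, forall z : Z, M < znorm R z ->
  `| a z * znorm R z `^ (d%:R + alpha) / H (zdir R z) - 1 | < e.

Let beta := d%:R / alpha.
Let al0 : 0 < alpha. Proof. by case/andP: alpha02. Qed.

Definition ret t : R := fine (trans_prob a t 0).

Let V s := (2 * (pi / s)) ^+ d.

Let V0 s : 0 < s -> 0 < V s.
Proof. by move=> s0; rewrite exprn_gt0// mulr_gt0// divr_gt0// pi_gt0. Qed.

Let BV s : 0 < s -> vol (@ebox R d (pi / s)) = (V s)%:E.
Proof. by move=> s0; rewrite box_vol// divr_ge0 ?pi_ge0// ltW. Qed.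

Let q0 : 0 < jump_rate a := jump_rate_gt0 ha.

Let bexp t s : 0 <= t -> bmeas (fun xi => expR (- (t * (jump_rate a * symb a s xi)))).
Proof.
move=> t0; split.
  apply: measurableT_comp => //; apply: measurableT_comp => //.
  by do 2 apply: measurable_funM => //; exact: measurable_symb.
exists 1 => x; rewrite ger0_norm ?expR_ge0// expR_le1 oppr_le0.
by rewrite !mulr_ge0 ?symb_ge0// ltW.
Qed.

Lemma retE s t : 0 < s -> 0 <= t -> ret t = avg vol (@ebox R d (pi / s)) (V s)
  (fun xi => expR (- (t * (jump_rate a * symb a s xi)))).
Proof. by move=> s0 t0; rewrite /ret (trans_prob0E ha s0). Qed.

Lemma trans_prob_ret t : 0 <= t -> trans_prob a t 0 = (ret t)%:E.
Proof. by move=> t0; rewrite /ret (trans_prob0E ha ltr01)//. Qed.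

Lemma ret_le1 t : 0 <= t -> ret t <= 1.
Proof.
move=> t0; rewrite (retE ltr01 t0) -[leRHS](avg_cst (@measurable_box R d _) (BV ltr01) (V0 ltr01)).
apply: (le_avg (@measurable_box R d _) (BV ltr01) (V0 ltr01)); first exact: bexp.
  exact: bmeas_cst.
by move=> x _; rewrite expR_le1 oppr_le0 !mulr_ge0 ?symb_ge0// ltW.
Qed.

Lemma ret_gt0 t : 0 <= t -> 0 < ret t.
Proof.
move=> t0; apply: (@lt_le_trans _ _ (expR (- (t * (jump_rate a * 2))))); first exact: expR_gt0.
rewrite (retE ltr01 t0) -[leLHS](avg_cst (@measurable_box R d _) (BV ltr01) (V0 ltr01)).
apply: (le_avg (@measurable_box R d _) (BV ltr01) (V0 ltr01)); last 2 first.
- exact: bexp.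
- by move=> x _; rewrite ler_expR lerN2 !ler_wpM2l ?symb_le2// ltW.
exact: bmeas_cst.
Qed.

Lemma measurable_ret : measurable_fun (`[0%R, +oo[%classic : set R) ret.
Proof.
apply/measurable_EFinP; apply: (eq_measurable_fun (fun t => trans_prob a t 0)).
  by move=> t; rewrite inE/= in_itv/= andbT => t0; rewrite /= trans_prob_ret.
apply: measurable_fun_esum => [n t|n].
  rewrite /= in_itv/= andbT => t0; rewrite mule_ge0 ?(convpow_ge0 ha)// lee_fin.
  by rewrite !mulr_ge0 ?expR_ge0 ?exprn_ge0 ?invr_ge0 ?mulr_ge0// ltW.
apply: emeasurable_funM => //; apply/measurable_EFinP; apply: measurable_funTS.
have mq : measurable_fun [set: R] (fun t => jump_rate a * t) by exact: measurable_funM.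
apply: measurable_funM => //; apply: measurable_funM; last exact: measurable_funX.
by apply: (measurableT_comp (@measurable_expR R)); exact: measurableT_comp.
Qed.

(* The substitution s = t^(-1/alpha) in [retE] produces a rescaled integrand that
   converges pointwise by [rate_symb_cvg]. *)
Let J t xi := \1_(@ebox R d (pi / t `^ (- alpha^-1))) xi *
  expR (- (t * (jump_rate a * symb a (t `^ (- alpha^-1)) xi))).

Let scaleK t : 0 < t -> (t `^ (- alpha^-1)) `^ (- alpha) = t.
Proof.
move=> t0; rewrite -powRrM mulrNN mulVf ?gt_eqF// powRr1//; exact: ltW.
Qed.

Lemma ret_scaled t : 0 < t ->
  t `^ beta * ret t = ((2 * pi) ^+ d)^-1 * \int[vol]_xi J t xi.
Proof.
move=> t0; have s0 : 0 < t `^ (- alpha^-1) by rewrite powR_gt0.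
rewrite (retE s0 (ltW t0)) /avg mulrA; congr (_ * _).
  have -> : V (t `^ (- alpha^-1)) = (2 * pi) ^+ d * t `^ beta.
    rewrite /V mulrA expr_div_n; congr (_ * _).
    by rewrite powR_expn mulNr powRN invrK; congr (_ `^ _); rewrite /beta mulrC.
  by rewrite [X in _ * X]invfM mulrCA mulfV ?mulr1// lt0r_neq0// powR_gt0.
rewrite /Rintegral; congr fine; rewrite integral_mkcond; apply: eq_integral => x _.
rewrite patchE /J indicE; case: ifPn => _; first by rewrite mul1r.
by rewrite mul0r.
Qed.

Lemma measurable_J t : 0 < t -> measurable_fun [set: E] (J t).
Proof.
move=> t0; apply: measurable_funM.
  by apply: measurable_indic; exact: measurable_box.
by case: (bexp (t `^ (- alpha^-1)) (ltW t0)).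
Qed.

(** At the scale s = t^(-1/alpha) the factor s^alpha cancels [t]. Averaging the d coordinatewise
    lower bounds of the symbol then gives a majorant that is a product and does not depend on
    [t]. *)
Lemma J_bound : exists2 c : R, 0 < c & forall t xi, 0 < t ->
  ((J t xi)%:E <= \prod_(i < d) (expR (- (c * `|ecoord xi i| `^ alpha)))%:E)%E.
Proof.
have [c c0 hc] := rate_symb_lower d0 ha alpha02 cH H0 aH.
have dp : 0 < d%:R :> R by rewrite ltr0n.
exists (c / d%:R); first exact: divr_gt0.
move=> t xi t0; rewrite prodEFin lee_fin -expR_sum /J indicE.
case: (boolP (xi \in _)) => [/set_mem xB|_]; last by rewrite mul0r expR_ge0.
rewrite mul1r ler_expR sumrN lerN2 -mulr_sumr.
have s0 : 0 < t `^ (- alpha^-1) by rewrite powR_gt0.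
have h i : c * `|ecoord xi i| `^ alpha <= t * (jump_rate a * symb a (t `^ (- alpha^-1)) xi).
  have := ler_wpM2l (ltW t0) (hc _ s0 xi xB i).
  have -> : (t `^ (- alpha^-1)) `^ alpha = t^-1.
    by rewrite -{2}(scaleK t0) powRN invrK.
  by rewrite [c * (_ * _)]mulrCA mulVKf// gt_eqF.
rewrite mulrAC ler_pdivrMr// mulr_sumr.
apply: le_trans (ler_sum _ (fun i _ => h i)) _.
by rewrite sumr_const card_ord -[leLHS]mulr_natr.
Qed.

Lemma integrable_prod_expRN c : 0 < c -> vol.-integrable [set: E]
  (fun xi => \prod_(i < d) (expR (- (c * `|ecoord xi i| `^ alpha)))%:E)%E.
Proof.
move=> c0; pose f (y : R) : \bar R := (expR (- (c * `|y| `^ alpha)))%:E.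
have mf : measurable_fun [set: R] f.
  apply/measurable_EFinP; apply: (measurableT_comp (@measurable_expR R)).
  apply: measurableT_comp => //; apply: measurable_funM => //.
  exact: (measurableT_comp (@measurable_powR R alpha) (@normr_measurable R setT)).
have f0 y : (0 <= f y)%E by rewrite lee_fin expR_ge0.
apply/integrableP; split.
  exact: (measurable_prod_coord (f := fun=> f)).
rewrite (eq_integral (fun xi => \prod_(i < d) f (ecoord xi i))%E); last first.
  by move=> xi _; rewrite gee0_abs//; apply: prode_ge0.
rewrite (integral_prod_coord (f := fun=> f))// ltey_eq prode_fin_num// => i _.
rewrite ge0_fin_numE; first exact: integral_expRN_powR.
exact: integral_ge0.
Qed.

Lemma local_limit : exists2 C : R, 0 < C & t `^ beta * ret t @[t --> +oo] --> C.
Proof.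
have [c c0 hJ] := J_bound.
have [Phi hPhi] := choice (rate_symb_cvg d0 ha alpha02 cH H0 aH).
pose G xi := (\prod_(i < d) (expR (- (c * `|ecoord xi i| `^ alpha)))%:E)%E.
have iG : vol.-integrable [set: E] G by exact: integrable_prod_expRN.
have cvgJ u : (forall n, 1 <= u n) -> u n @[n --> \oo] --> +oo ->
    vol.-integrable [set: E] (EFin \o (fun xi => expR (- Phi xi))) /\
    \int[vol]_xi J (u n) xi @[n --> \oo] --> \int[vol]_xi expR (- Phi xi).
  move=> u1 cu.
  have u0 n : 0 < u n by apply: lt_le_trans (u1 n).
  have mJ n := measurable_J (u0 n).
  have cJ xi : [set: E] xi -> J (u n) xi @[n --> \oo] --> expR (- Phi xi).
    move=> _; pose s n := u n `^ (- alpha^-1).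
    have s0 n : 0 < s n by rewrite powR_gt0.
    have cs : s n @[n --> \oo] --> 0.
      have ai : 0 < alpha^-1 by rewrite invr_gt0.
      exact: (cvg_comp _ _ cu (cvgy_powRN ai)).
    have h1 : expR (- (u n * (jump_rate a * symb a (s n) xi))) @[n --> \oo] --> expR (- Phi xi).
      have h := hPhi xi s s0 cs.
      have {}h : u n * (jump_rate a * symb a (s n) xi) @[n --> \oo] --> Phi xi.
        by apply: cvg_trans h; apply: near_eq_cvg; near=> n; rewrite scaleK.
      exact: (cvg_comp _ _ (cvgN h) (@continuous_expR R _)).
    apply: cvg_trans h1; apply: near_eq_cvg.
    (* As the boxes grow, [xi] is eventually inside; the + 1 guards against a zero coordinate. *)
    have : \forall n \near \oo, forall i, s n < pi / (`|ecoord xi i| + 1).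
      apply: filter_forall => i; apply: (cvgr_lt _ cs).
      by rewrite divr_gt0 ?pi_gt0// ltr_wpDl.
    apply: filterS => n hn; rewrite /J indicE mem_set ?mul1r// => i.
    have sn : 0 < u n `^ (- alpha^-1) := s0 n.
    rewrite -ler_norml ler_pdivlMr// mulrC.
    have xp : 0 < `|ecoord xi i| + 1 by rewrite ltr_wpDl.
    have := hn i; rewrite ltr_pdivlMr// mulrDr mulr1 => h.
    by apply: ltW; apply: le_lt_trans h; rewrite lerDl ltW.
  have dJ n xi : [set: E] xi -> (`|J (u n) xi|%:E <= G xi)%E.
    by move=> _; rewrite ger0_norm ?hJ// mulr_ge0 ?expR_ge0// indicE.
  by have [_ ? ?] := @dominated_cvg_Rintegral _ _ _ vol setT (fun n => J (u n))
    (fun xi => expR (- Phi xi)) G measurableT mJ cJ iG dJ.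
pose I := \int[vol]_xi expR (- Phi xi).
have I0 : 0 < I.
  (* One particular sequence is enough to obtain the integrability of exp(-Phi), from which the
     positivity of the limit follows. *)
  have n1 n : (1 : R) <= n.+1%:R by rewrite ler1n.
  have noo : (n.+1%:R : R) @[n --> \oo] --> +oo.
    by apply/cvgryPge => M; near=> n; rewrite (le_trans (ler_norm M))// ltW// (lt_le_trans (truncnS_gt _))// ler_nat ltnS; near: n; exact: nbhs_infty_ge.
  have [iPhi _] := cvgJ _ n1 noo.
  by apply: Rintegral_gt0 => //; [exact: vol_setT_neq0|move=> xi _; exact: expR_gt0].
exists (((2 * pi) ^+ d)^-1 * I).
  by rewrite mulr_gt0// invr_gt0 exprn_gt0// mulr_gt0// pi_gt0.
apply/cvg_pinftyP => u cu.
(* Truncation at 1 meets the requirement of [cvgJ] at every index and changes only finitely many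
   terms. *)
pose v n := Num.max 1 (u n).
have v1 n : 1 <= v n by rewrite /v le_max lexx.
have uv : \forall n \near \oo, v n = u n.
  have /cvgryPge/(_ 1) := cu; apply: filterS => n un.
  by rewrite /v; apply/max_idPr.
have cv : v n @[n --> \oo] --> +oo.
  by apply: cvg_trans cu; apply: near_eq_cvg; apply: filterS uv => n ->.
have [_ hv] := cvgJ v v1 cv.
have h : ((2 * pi) ^+ d)^-1 * \int[vol]_xi J (v n) xi @[n --> \oo] --> ((2 * pi) ^+ d)^-1 * I.
  exact: cvgMr.
apply: cvg_trans h; apply: near_eq_cvg; near=> n.
have <- : v n = u n by near: n.
by rewrite ret_scaled// (lt_le_trans ltr01).
Unshelve. all: by end_near. Qed.

(** The majorant of [J] is uniform in t, so the bound holds down to t = 0; the Abelian arguments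
    evaluate p at u / lam for every u > 0. *)
Lemma ret_upper : exists2 K : R, 0 < K & forall t, 0 < t -> ret t <= K * t `^ (- beta).
Proof.
have [c c0 hJ] := J_bound.
have iG := integrable_prod_expRN c0.
pose g xi := \prod_(i < d) expR (- (c * `|ecoord xi i| `^ alpha)).
have ig : vol.-integrable [set: E] (EFin \o g).
  by apply: eq_integrable iG => // xi _; rewrite prodEFin.
have g0 xi : 0 <= g xi by apply: prodr_ge0 => i _; exact: expR_ge0.
exists (((2 * pi) ^+ d)^-1 * (1 + \int[vol]_xi g xi)).
  by rewrite mulr_gt0 ?invr_gt0 ?exprn_gt0 ?mulr_gt0 ?pi_gt0// ltr_wpDr// Rintegral_ge0.
move=> t t0; rewrite powRN ler_pdivlMr ?powR_gt0// mulrC ret_scaled//.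
rewrite ler_wpM2l ?invr_ge0 ?exprn_ge0 ?mulr_ge0 ?pi_ge0//.
have Jg xi : J t xi <= g xi by have := hJ t xi t0; rewrite prodEFin lee_fin.
apply: (@le_trans _ _ (\int[vol]_xi g xi)); last by rewrite lerDr.
apply: le_Rintegral => //.
apply: (le_integrable measurableT _ _ ig).
  by apply/measurable_EFinP; exact: measurable_J.
move=> xi _; rewrite /= lee_fin !ger0_norm//.
by rewrite mulr_ge0 ?expR_ge0// indicE.
Qed.

End local_limit.

(** * Abelian theorems *)

Section abelian.
Context {R : realType}.
Implicit Types (t u lam : R).
Local Notation mu := (@lebesgue_measure R).
Local Notation D := (`]0%R, +oo[%classic : set R).
Variables (p : R -> R) (beta C K : R).
Hypotheses (mp : measurable_fun [set: R] p) (p0 : forall t, 0 < p t).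
Hypotheses (p1 : forall t, p t <= 1) (C0 : 0 < C) (K0 : 0 < K).
Hypothesis pK : forall t, 0 < t -> p t <= K * t `^ (- beta).
Hypothesis pC : t `^ beta * p t @[t --> +oo] --> C.

Let mD : measurable (D : set (measurableTypeR R)).
Proof. exact: measurable_itv. Qed.

Let r t := t `^ beta * p t.

Let r_ge0 t : 0 <= r t.
Proof. by rewrite mulr_ge0 ?powR_ge0// ltW. Qed.

Let r_le t : 0 < t -> r t <= K.
Proof.
move=> t0; have := pK t0; rewrite powRN ler_pdivlMr ?powR_gt0//.
by rewrite mulrC.
Qed.

Let mr lam : measurable_fun [set: R] (fun u => r (u / lam)).
Proof.
have m1 : measurable_fun [set: R] (fun u => u / lam) by exact: measurable_funM.
apply: measurable_funM; first exact: (measurableT_comp (@measurable_powR R beta) m1).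
exact: measurableT_comp.
Qed.

Lemma integrable_pmin c (a b : R) : a < 1 -> 1 < b ->
  mu.-integrable D (fun u => (c * pmin a b u)%:E).
Proof.
move=> a1 b1; suff h : mu.-integrable D (EFin \o pmin a b) by exact: (integrableZl _ c h).
apply/integrableP; split; first by apply/measurable_EFinP; exact: measurable_pmin.
have -> : (\int[mu]_(x in D) `|(EFin \o pmin a b) x| = \int[mu]_(x in D) (pmin a b x)%:E)%E.
  by apply: eq_integral => u _; rewrite gee0_abs// lee_fin pmin_ge0.
rewrite integral_itv_obnd_cbnd; first exact: integral_pmin.
by apply/measurable_EFinP; exact: measurable_pmin.
Qed.

Lemma mu_posaxis_neq0 : mu D != 0%E.
Proof. by rewrite lebesgue_measure_itv/= ltry. Qed.

Section kernel.
Variable k : R -> R.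
Hypotheses (mk : measurable_fun [set: R] k) (k0 : forall u, 0 < u -> 0 < k u).

(** Substitution u = lam t, followed by p(u / lam) = (u / lam)^(-beta) r(u / lam). On the right
    [lam] survives only inside [r], which is bounded by K and tends to C. *)
Lemma abel_scaling lam : 0 < lam ->
  ((lam `^ (1 - beta))%:E * \int[mu]_(t in D) (k (lam * t) * p t)%:E =
   \int[mu]_(u in D) (k u * u `^ (- beta) * r (u / lam))%:E)%E.
Proof.
move=> l0; pose f := ((fun u => (k u * p (u / lam))%:E) \_ D)%E.
have mf0 : measurable_fun [set: R] (fun u => (k u * p (u / lam))%:E).
  apply/measurable_EFinP; apply: measurable_funM => //.
  by apply: measurableT_comp => //; exact: measurable_funM.
have mf : measurable_fun [set: R] f.
  by apply/(measurable_restrictT _ _).1 => //; exact: measurable_funTS.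
have f0 u : (0 <= f u)%E.
  apply: erestrict_ge0 => v; rewrite /= in_itv/= andbT => v0.
  by rewrite lee_fin mulr_ge0// ltW// k0.
have := ge0_integral_scale l0 mf f0.
rewrite -integral_itv_obnd_cbnd; last first.
  by apply: measurable_funTS; apply: measurableT_comp => //; exact: measurable_funM.
rewrite -[in RHS]integral_itv_obnd_cbnd; last exact: measurable_funTS.
have -> : (\int[mu]_(t in D) f (lam * t)%R = \int[mu]_(t in D) (k (lam * t) * p t)%:E)%E.
  apply: eq_integral => t; rewrite inE/= in_itv/= andbT => t0; rewrite /f patchE ifT; last first.
    by rewrite inE/= in_itv/= andbT mulr_gt0.
  by congr (_ * p _)%:E; rewrite mulrAC mulfV ?mul1r// gt_eqF.
move=> ->; rewrite muleA -EFinM -ge0_integralZl//; last 2 first.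
- exact: measurable_funTS.
- by rewrite lee_fin mulr_ge0 ?powR_ge0// invr_ge0 ltW.
apply: eq_integral => u /[dup] uD; rewrite inE/= in_itv/= andbT => u0.
rewrite /f patchE uD -EFinM; congr EFin.
rewrite /r powRM ?invr_ge0 ?(ltW u0) ?(ltW l0)//.
have -> : lam `^ (1 - beta) / lam = lam^-1 `^ beta.
  rewrite powRB; last by apply/implyP => _; exact: lt0r_neq0.
  have -> : lam^-1 `^ beta = (lam `^ (-1)) `^ beta by rewrite powR_inv1// ltW.
  rewrite -powRrM mulN1r powRN powRr1 ?(ltW l0)//.
  by rewrite mulrAC mulfV ?mul1r// gt_eqF.
by rewrite powRN; field; rewrite gt_eqF// powR_gt0.
Qed.

Lemma abel_scalingR lam : 0 < lam ->
  mu.-integrable D (fun u => (k u * u `^ (- beta) * r (u / lam))%:E) ->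
  lam `^ (1 - beta) * (\int[mu]_(t in D) (k (lam * t) * p t))%R =
   (\int[mu]_(u in D) (k u * u `^ (- beta) * r (u / lam)))%R.
Proof.
move=> l0 fi; have fn := integrable_fin_num mD fi.
have e := abel_scaling l0; have lp : 0 < lam `^ (1 - beta) by rewrite powR_gt0.
(* An infinite integral would be read as 0 by [Rintegral]; finiteness comes back from the right side
   by division by a positive real. *)
have h : (\int[mu]_(t in D) (k (lam * t) * p t)%:E)%E \is a fin_num.
  rewrite -e in fn; move: fn; case: (integral _ _ _) => // [|] /=.
    by rewrite gt0_muley ?lte_fin.
  by rewrite gt0_muleNy ?lte_fin.
by rewrite /Rintegral -e fineM.
Qed.

(** The limit is C times the integral of k(u) u^(-beta), by dominated convergence. The exponents [a]
    and [b] are left free since each kernel has its own behaviour at 0 and at infinity. *)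
Lemma abel_pow (M a b : R) : a < 1 -> 1 < b -> 0 <= M ->
  (forall u, 0 < u -> k u * u `^ (- beta) <= M * pmin a b u) ->
  exists2 c : R, 0 < c &
    lam `^ (1 - beta) * (\int[mu]_(t in D) (k (lam * t) * p t))%R @[lam --> 0^'+] --> c.
Proof.
move=> a1 b1 M0 hk.
have mf lam : measurable_fun D (fun u => k u * u `^ (- beta) * r (u / lam)).
  apply: measurable_funTS; apply: measurable_funM; last exact: mr.
  by apply: measurable_funM => //; exact: measurable_powR.
have f0 lam u : D u -> 0 <= k u * u `^ (- beta) * r (u / lam).
  rewrite /= in_itv/= andbT => u0.
  by rewrite mulr_ge0// mulr_ge0 ?powR_ge0// ltW// k0.
have fG lam u : 0 < lam -> D u ->
    k u * u `^ (- beta) * r (u / lam) <= M * K * pmin a b u.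
  rewrite /= in_itv/= andbT => l0 u0; rewrite [leRHS]mulrAC; apply: ler_pM => //.
  - by rewrite mulr_ge0 ?powR_ge0// ltW// k0.
  - exact: hk.
  - by apply: r_le; exact: divr_gt0.
have iG := integrable_pmin (M * K) a1 b1.
have ifl lam : 0 < lam -> mu.-integrable D (fun u => (k u * u `^ (- beta) * r (u / lam))%:E).
  move=> l0; apply: (le_integrable mD _ _ iG); first by apply/measurable_EFinP; exact: mf.
  move=> u Du; have h0 := f0 lam u Du; have h1 := fG lam u l0 Du.
  by rewrite /= lee_fin !ger0_norm//; exact: le_trans h1.
have cf (v : nat -> R) : (forall n, 0 < v n) /\ v n @[n --> \oo] --> 0 ->
    mu.-integrable D (EFin \o (fun u => k u * u `^ (- beta) * C)) /\
    (\int[mu]_(u in D) (k u * u `^ (- beta) * r (u / v n)))%R @[n --> \oo] -->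
    (\int[mu]_(u in D) (k u * u `^ (- beta) * C))%R.
  move=> [v0 cv].
  have c1 u : D u -> k u * u `^ (- beta) * r (u / v n) @[n --> \oo] --> k u * u `^ (- beta) * C.
    rewrite /= in_itv/= andbT => u0; apply: cvgMr.
    have h : u / v n @[n --> \oo] --> +oo.
      apply/gtr0_cvgV0; first by apply: nearW => n; rewrite divr_gt0.
      rewrite [X in X @ _ --> _](_ : _ = (fun n => v n * u^-1)); last first.
        by apply/funext => n; rewrite /= invfM invrK mulrC.
      by rewrite -[X in _ --> X](mul0r u^-1); exact: cvgMl.
    exact: (cvg_comp _ _ h pC).
  have d1 n u : D u -> (`|k u * u `^ (- beta) * r (u / v n)|%:E <= (M * K * pmin a b u)%:E)%E.
    by move=> Du; rewrite lee_fin ger0_norm ?f0// fG.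
  by have [_ ? ?] := @dominated_cvg_Rintegral _ _ _ mu D
    (fun n u => k u * u `^ (- beta) * r (u / v n)) (fun u => k u * u `^ (- beta) * C)
    _ mD (fun n => mf (v n)) c1 iG d1.
exists (\int[mu]_(u in D) (k u * u `^ (- beta) * C))%R.
  (* Any sequence decreasing to 0 would do: only the integrability of the limit is extracted here,
     for the positivity of the constant. *)
  have v1 : (forall n, 0 < n.+1%:R^-1 :> R) /\ (n.+1%:R^-1 : R) @[n --> \oo] --> 0.
    split; first by move=> n; rewrite invr_gt0.
    exact: cvg_harmonic.
  have [iC _] := cf _ v1.
  apply: (Rintegral_gt0 mD mu_posaxis_neq0 iC) => u.
  by rewrite /= in_itv/= andbT => u0; rewrite !mulr_gt0 ?k0 ?powR_gt0.
apply/cvg_at_rightP => v [v0 cv]; have [_ h] := cf v (conj v0 cv).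
apply: cvg_trans h; apply: near_eq_cvg; near=> n.
by rewrite (abel_scalingR (v0 n) (ifl _ (v0 n))).
Unshelve. all: by end_near. Qed.

End kernel.
End abelian.

Section log_integrals.
Context {R : realType}.
Local Notation mu := (@lebesgue_measure R).
Implicit Types (x y b : R).

Lemma integral_powRN_itv b x y : b != 1 -> 0 < x -> x < y ->
  (\int[mu]_(u in `]x, y]) (u `^ (- b))%:E =
   ((y `^ (1 - b) - x `^ (1 - b)) / (1 - b))%:E)%E.
Proof.
move=> b1 x0 xy.
rewrite integral_itv_obnd_cbnd; last by apply/measurable_EFinP; exact: measurable_powRl.
have dF u : 0 < u -> {for u, continuous (fun x => x `^ (1 - b) / (1 - b))}.
  move=> u0; apply: differentiable_continuous; apply/derivable1_diffP.
  by apply: ex_derive; exact: derivable_powRdiv.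
rewrite (@continuous_FTC2 _ _ (fun x => x `^ (1 - b) / (1 - b)))//.
- by rewrite -EFinB mulrBl.
- apply: continuous_in_subspaceT => u; rewrite inE/= in_itv/= => /andP[u1 _].
  by apply: continuous_powRx; exact: lt_le_trans u1.
- split.
  + move=> u; rewrite in_itv/= => /andP[u1 _].
    by apply: ex_derive; apply: derivable_powRdiv => //; exact: lt_trans u1.
  + by apply: cvg_at_right_filter; exact: dF.
  + by apply: cvg_at_left_filter; apply: dF; exact: lt_trans xy.
- move=> u; rewrite in_itv/= => /andP[u1 _]; rewrite derive1E.
  have u0 : 0 < u by exact: lt_trans u1.
  by have h' := derivable_powRdiv b1 u0; apply: derive_val.
Qed.

Lemma integral_inv_itv x y : 0 < x -> x < y ->
  (\int[mu]_(u in `]x, y]) (u^-1)%:E = (ln y - ln x)%:E)%E.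
Proof.
move=> x0 xy.
have -> : (\int[mu]_(u in `]x, y]) (u^-1)%:E = \int[mu]_(u in `]x, y]) (u `^ (- 1))%:E)%E.
  apply: eq_integral => u; rewrite inE/= in_itv/= => /andP[u1 _].
  by rewrite powR_inv1// ltW// (lt_trans x0).
rewrite integral_itv_obnd_cbnd; last by apply/measurable_EFinP; exact: measurable_powRl.
have dF u : 0 < u -> {for u, continuous (@ln R)}.
  move=> u0; apply: differentiable_continuous; apply/derivable1_diffP.
  by apply: ex_derive; exact: is_derive1_ln.
rewrite (@continuous_FTC2 _ _ (@ln R))//.
- apply: continuous_in_subspaceT => u; rewrite inE/= in_itv/= => /andP[u1 _].
  by apply: continuous_powRx; exact: lt_le_trans u1.
- split.
  + move=> u; rewrite in_itv/= => /andP[u1 _].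
    by apply: ex_derive; apply: is_derive1_ln; exact: lt_trans u1.
  + by apply: cvg_at_right_filter; exact: dF.
  + by apply: cvg_at_left_filter; apply: dF; exact: lt_trans xy.
- move=> u; rewrite in_itv/= => /andP[u1 _]; rewrite derive1E.
  have u0 : 0 < u by exact: lt_trans u1.
  by rewrite powR_inv1 ?(ltW u0)//; have h' := is_derive1_ln u0; apply: derive_val.
Qed.

End log_integrals.

(** * The critical exponents, where a logarithm appears *)

Section abelian_log.
Context {R : realType}.
Implicit Types (t u lam e T : R).
Local Notation mu := (@lebesgue_measure R).
Local Notation D := (`]0%R, +oo[%classic : set R).
Variables (p : R -> R) (beta C K : R).
Hypotheses (mp : measurable_fun [set: R] p) (p0 : forall t, 0 < p t).
Hypotheses (p1 : forall t, p t <= 1) (C0 : 0 < C) (K0 : 0 < K).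
Hypothesis pK : forall t, 0 < t -> p t <= K * t `^ (- beta).
Hypothesis pC : t `^ beta * p t @[t --> +oo] --> C.
Variables (k : R -> R) (M : R).
Hypotheses (mk : measurable_fun [set: R] k) (k0 : forall u, 0 < u -> 0 < k u).
Hypotheses (b1 : 1 <= beta) (M0 : 0 <= M).
Hypothesis k1 : forall u, 0 < u -> k u <= u `^ (beta - 1).
Hypothesis k2 : forall u, 0 < u -> u <= 1 -> u `^ (beta - 1) * (1 - u) <= k u.
Hypothesis k3 : forall u, 1 <= u -> k u * u `^ (- beta) <= M * u `^ (- 2).

Let r t := t `^ beta * p t.
(** By [k1] and [k2], k(u) u^(-beta) equals 1 / u up to an error of at most 1 on ]0, 1]: this is the
    borderline case where [abel_pow] fails. By [k3] it is of order u^(-2) at infinity. *)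
Let F lam u := k u * u `^ (- beta) * r (u / lam).
Let B := fine (\int[mu]_(u in `[1%R, +oo[) (u `^ (- 2))%:E)%E.

Let r_ge0 t : 0 <= r t.
Proof. by rewrite mulr_ge0 ?powR_ge0// ltW. Qed.

Let r_le t : 0 < t -> r t <= K.
Proof.
move=> t0; have := pK t0; rewrite powRN ler_pdivlMr ?powR_gt0//.
by rewrite mulrC.
Qed.

Let F_ge0 lam u : 0 < u -> 0 <= F lam u.
Proof. by move=> u0; rewrite mulr_ge0// mulr_ge0 ?powR_ge0// ltW// k0. Qed.

Let mF lam (A : set R) : measurable_fun A (F lam).
Proof.
apply: measurable_funTS.
have m1 : measurable_fun [set: R] (fun u => u / lam) by exact: measurable_funM.
apply: measurable_funM.
  by apply: measurable_funM => //; exact: measurable_powR.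
apply: measurable_funM; first exact: (measurableT_comp (@measurable_powR R beta) m1).
exact: measurableT_comp.
Qed.

Let kpow u : 0 < u -> k u * u `^ (- beta) <= u^-1.
Proof.
move=> u0; have -> : u^-1 = u `^ (beta - 1) * u `^ (- beta).
  rewrite -powRD; last by apply/implyP => _; exact: lt0r_neq0.
  by rewrite -powR_inv1 ?(ltW u0)//; congr (_ `^ _); ring.
by rewrite ler_wpM2r ?powR_ge0// k1.
Qed.

(* The logarithm comes from ]lam, 1], where [F lam u] is close to C / u; the rest
   of the half-line contributes O(1). *)
Let F_small lam u : 0 < lam -> 0 < u -> u <= lam -> F lam u <= lam^-1.
Proof.
move=> l0 u0 ul.
apply: (@le_trans _ _ (u^-1 * (u / lam))).
  apply: ler_pM; [|exact: r_ge0|exact: kpow|].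
    by rewrite mulr_ge0 ?powR_ge0// ltW// k0.
  have x1 : 0 < u / lam <= 1 by rewrite divr_gt0// ler_pdivrMr// mul1r.
  apply: (@le_trans _ _ ((u / lam) `^ beta)); first by rewrite ler_piMr ?powR_ge0.
  by apply: ge1r_powR.
by rewrite mulrA mulVf ?mul1r// gt_eqF.
Qed.

Let F_large lam u : 0 < lam -> 1 <= u -> F lam u <= K * M * u `^ (- 2).
Proof.
move=> l0 u1; have u0 : 0 < u by apply: lt_le_trans u1.
rewrite -mulrA mulrC; apply: ler_pM; [|exact: r_ge0|exact: k3|].
  by rewrite mulr_ge0 ?powR_ge0// ltW// k0.
by apply: r_le; exact: divr_gt0.
Qed.

(** Beyond u = T lam the ratio [r] is at most C + e. Below it, T lam / u exceeds 1, so the second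
    term alone dominates the crude bound K. *)
Let F_mid_le e T lam u : 0 < e -> 1 <= T -> (forall t, T <= t -> `|r t - C| <= e) ->
  0 < lam -> 0 < u -> F lam u <= (C + e) * u^-1 + K * T * (lam * u `^ (- 2)).
Proof.
move=> e0 T1 hT l0 u0.
have u2 : u `^ (- 2) = u^-1 * u^-1.
  by rewrite powRN -invfM -expr2; congr (_^-1); rewrite (powR_mulrn 2)// ltW.
have -> : (C + e) * u^-1 + K * T * (lam * u `^ (- 2)) = u^-1 * (C + e + K * T * (lam / u)).
  by rewrite u2; ring.
apply: ler_pM; [|exact: r_ge0|exact: kpow|].
  by rewrite mulr_ge0 ?powR_ge0// ltW// k0.
have [Tu|uT] := leP T (u / lam).
  have := hT _ Tu; rewrite ler_norml => /andP[_ h].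
  apply: (@le_trans _ _ (C + e)); first lra.
  by rewrite lerDl !mulr_ge0 ?invr_ge0// ltW// (lt_le_trans ltr01).
apply: (le_trans (r_le (divr_gt0 u0 l0))).
apply: (@le_trans _ _ (K * T * (lam / u))).
  rewrite -mulrA ler_pMr// -ler_pdivrMr ?divr_gt0// mul1r invf_div; exact: ltW.
by rewrite lerDr addr_ge0// ltW.
Qed.

(** The loss of 1 in k(u) u^(-beta) >= 1 / u - 1 costs at most K, as r <= K. For u < T lam the term
    with C T makes the inequality trivial. *)
Let F_mid_ge e T lam u : 0 < e -> e <= C -> 1 <= T -> (forall t, T <= t -> `|r t - C| <= e) ->
  0 < lam -> 0 < u -> u <= 1 ->
  (C - e) * u^-1 <= F lam u + (K + C * T * (lam * u `^ (- 2))).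
Proof.
move=> e0 eC T1 hT l0 u0 u1.
have u2 : u `^ (- 2) = u^-1 * u^-1.
  by rewrite powRN -invfM -expr2; congr (_^-1); rewrite (powR_mulrn 2)// ltW.
have hk : u^-1 - 1 <= k u * u `^ (- beta).
  have -> : u^-1 - 1 = u `^ (beta - 1) * (1 - u) * u `^ (- beta).
    rewrite mulrAC -powRD; last by apply/implyP => _; exact: lt0r_neq0.
    have -> : beta - 1 - beta = -1 by ring.
    by rewrite powR_inv1 ?(ltW u0)//; field; rewrite gt_eqF.
  by rewrite ler_wpM2r ?powR_ge0// k2.
have rl : r (u / lam) <= K by apply: r_le; exact: divr_gt0.
have h1 : u^-1 * r (u / lam) - K <= F lam u.
  have := ler_wpM2r (r_ge0 (u / lam)) hk; rewrite -/(F lam u) mulrBl mul1r; lra.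
suff : (C - e) * u^-1 <= u^-1 * r (u / lam) + C * T * (lam * u `^ (- 2)) by lra.
have -> : u^-1 * r (u / lam) + C * T * (lam * u `^ (- 2)) =
    (r (u / lam) + C * T * (lam / u)) * u^-1 by rewrite u2; ring.
rewrite ler_wpM2r ?invr_ge0 ?(ltW u0)//.
have [Tu|uT] := leP T (u / lam).
  have := hT _ Tu; rewrite ler_norml => /andP[h _].
  apply: (@le_trans _ _ (r (u / lam))); first lra.
  by rewrite lerDl !mulr_ge0 ?invr_ge0// ltW// (lt_le_trans ltr01).
apply: (@le_trans _ _ (C * T * (lam / u))); last by rewrite lerDr.
apply: (@le_trans _ _ C); first by rewrite gerBl ltW.
by rewrite -mulrA ler_pMr// -ler_pdivrMr ?divr_gt0// mul1r invf_div; exact: ltW.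
Qed.

Let B_fin : (\int[mu]_(u in `[1%R, +oo[) (u `^ (- 2))%:E)%E \is a fin_num.
Proof.
rewrite ge0_fin_numE; first by apply: integral_powRN_1y; lra.
by apply: integral_ge0 => u _; rewrite lee_fin powR_ge0.
Qed.

Let F_split lam : 0 < lam -> lam < 1 ->
  (\int[mu]_(u in D) (F lam u)%:E = \int[mu]_(u in `]0%R, lam]) (F lam u)%:E +
    \int[mu]_(u in `]lam, 1%R]) (F lam u)%:E + \int[mu]_(u in `]1%R, +oo[) (F lam u)%:E)%E.
Proof.
move=> l0 l1.
have mFE (A : set R) : measurable_fun A (fun u => (F lam u)%:E) by apply/measurable_EFinP; exact: mF.
have -> : D = `]0%R, 1%R] `|` `]1%R, +oo[.
  by rewrite -itv_bndbnd_setU// bnd_simp.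
rewrite ge0_integral_setU//=; first last.
- by apply/disj_setPS => u /= []; rewrite !in_itv/= andbT leNgt => /andP[_ /negP].
- by move=> u [] /=; rewrite in_itv/= => /andP[u0 _]; rewrite lee_fin F_ge0// (lt_trans ltr01).
- exact: mFE.
congr (_ + _)%E.
have -> : `]0%R, 1%R]%classic = `]0%R, lam] `|` `]lam, 1%R] :> set R.
  by rewrite -itv_bndbnd_setU// bnd_simp ltW.
rewrite ge0_integral_setU//=; first last.
- by apply/disj_setPS => u /= []; rewrite !in_itv/= leNgt => /andP[_ /negP h] /andP[].
- by move=> u [] /=; rewrite in_itv/= => /andP[u0 _]; rewrite lee_fin F_ge0// (lt_trans l0).
- exact: mFE.
Qed.

(** lam u^(-2) has integral 1 - lam over ]lam, 1], so the correction terms stay bounded while 1 / u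
    yields the logarithm. *)
Let mid_itv lam (A1 A2 : R) : 0 < lam -> lam < 1 -> 0 <= A1 -> 0 <= A2 ->
  (\int[mu]_(u in `]lam, 1%R]) (A1 * u^-1 + A2 * (lam * u `^ (- 2)))%:E <=
   (A1 * - ln lam + A2)%:E)%E.
Proof.
move=> l0 l1 A10 A20.
have mi : measurable_fun (`]lam, 1%R] : set R) (fun u : R => (u^-1)%:E).
  apply/measurable_EFinP.
  apply: (eq_measurable_fun (fun u => u `^ (- 1))); last exact: measurable_powRl.
  move=> u; rewrite inE/= in_itv/= => /andP[u1 _].
  by rewrite powR_inv1// ltW// (lt_trans l0).
have mp2 : measurable_fun (`]lam, 1%R] : set R) (fun u : R => (u `^ (- 2))%:E).
  by apply/measurable_EFinP; exact: measurable_powRl.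
have -> : (\int[mu]_(u in `]lam, 1%R]) (A1 * u^-1 + A2 * (lam * u `^ (- 2)))%:E =
  \int[mu]_(u in `]lam, 1%R]) (A1%:E * (u^-1)%:E + (A2 * lam)%:E * (u `^ (- 2))%:E))%E.
  by apply: eq_integral => u _; rewrite -!EFinM -EFinD mulrA.
rewrite ge0_integralD//=; first last.
- exact: emeasurable_funM.
- by move=> u _; rewrite -EFinM lee_fin mulr_ge0 ?powR_ge0// mulr_ge0// ltW.
- exact: emeasurable_funM.
- move=> u; rewrite in_itv/= => /andP[u1 _]; rewrite -EFinM lee_fin mulr_ge0// invr_ge0.
  by rewrite ltW// (lt_trans l0).
rewrite ge0_integralZl//; last first.
  move=> u; rewrite /= in_itv/= => /andP[u1 _]; rewrite lee_fin invr_ge0.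
  by rewrite ltW// (lt_trans l0).
rewrite ge0_integralZl//; last 2 first.
- by move=> u _; rewrite lee_fin powR_ge0.
- by rewrite lee_fin mulr_ge0// ltW.
rewrite integral_inv_itv// integral_powRN_itv//; last first.
  by rewrite gt_eqF// ltr1n.
rewrite -!EFinM -EFinD lee_fin ln1 sub0r lerD2l.
have -> : (1 : R) - 2 = -1 by ring.
rewrite powR1 powR_inv1 ?(ltW l0)//.
have -> : A2 * lam * ((1 - lam^-1) / -1) = A2 * (1 - lam) by field; rewrite gt_eqF.
by rewrite ler_piMr// gerBl ltW.
Qed.

(** The three summands come from ]0, lam], where F <= 1 / lam, from ]lam, 1], and from the tail,
    with [B] the integral of u^(-2). *)
Lemma log_upper e T lam : 0 < e -> 1 <= T -> (forall t, T <= t -> `|r t - C| <= e) ->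
  0 < lam -> lam < 1 ->
  (\int[mu]_(u in D) (F lam u)%:E <= (1 + ((C + e) * - ln lam + K * T) + K * M * B)%:E)%E.
Proof.
move=> e0 T1 hT l0 l1; rewrite F_split// !EFinD -EFinD.
have mFE (A : set R) : measurable_fun A (fun u => (F lam u)%:E) by apply/measurable_EFinP; exact: mF.
apply: leeD; first apply: leeD.
- apply: (@le_trans _ _ (\int[mu]_(u in `]0%R, lam]) (lam^-1)%:E)%E).
    apply: ge0_le_integral => //.
    - by move=> u /=; rewrite in_itv/= => /andP[u0 _]; rewrite lee_fin F_ge0.
    - exact: mFE.
    - by move=> u /=; rewrite in_itv/= => /andP[u0 ul]; rewrite lee_fin F_small.
  rewrite integral_cst//= lebesgue_measure_itv/= lte_fin l0 -EFinB -EFinM lee_fin.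
  by rewrite subr0 mulVf// gt_eqF.
- apply: le_trans (mid_itv _ _ _ _) => //; last 2 first.
  + by rewrite addr_ge0// ltW.
  + by rewrite mulr_ge0 ?(ltW K0)// (le_trans ler01).
  apply: ge0_le_integral => //.
  + by move=> u /=; rewrite in_itv/= => /andP[u0 _]; rewrite lee_fin F_ge0// (lt_trans l0).
  + exact: mFE.
  + apply/measurable_EFinP; apply: measurable_funD; apply: measurable_funM => //.
      apply: (eq_measurable_fun (fun u => u `^ (- 1))); last exact: measurable_powRl.
      move=> u; rewrite inE/= in_itv/= => /andP[u1 _].
      by rewrite powR_inv1// ltW// (lt_trans l0).
    by apply: measurable_funM => //; exact: measurable_powRl.
  + move=> u /=; rewrite in_itv/= => /andP[u0 _]; rewrite lee_fin F_mid_le//.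
    exact: lt_trans u0.
- apply: (@le_trans _ _ (\int[mu]_(u in `]1%R, +oo[) ((K * M)%:E * (u `^ (- 2))%:E))%E).
    apply: ge0_le_integral => //.
    + by move=> u /=; rewrite in_itv/= andbT => u0; rewrite lee_fin F_ge0//; exact: (lt_trans ltr01 u0).
    + exact: mFE.
    + by apply: emeasurable_funM => //; apply/measurable_EFinP; exact: measurable_powRl.
    + move=> u /=; rewrite in_itv/= andbT => u0; rewrite -EFinM lee_fin F_large//; exact: ltW.
  rewrite ge0_integralZl//; last 3 first.
  + by apply/measurable_EFinP; exact: measurable_powRl.
  + by move=> u _; rewrite lee_fin powR_ge0.
  + by rewrite lee_fin mulr_ge0// ltW.
  rewrite integral_itv_obnd_cbnd; last by apply/measurable_EFinP; exact: measurable_powRl.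
  by rewrite [leRHS]EFinM /B fineK.
Qed.

(** The error terms are moved to the right so that only integrals of nonnegative functions are added
    and nothing is subtracted in the extended reals. *)
Lemma log_lower e T lam : 0 < e -> e <= C -> 1 <= T -> (forall t, T <= t -> `|r t - C| <= e) ->
  0 < lam -> lam < 1 ->
  (((C - e) * - ln lam)%:E <= \int[mu]_(u in D) (F lam u)%:E + (K + C * T)%:E)%E.
Proof.
move=> e0 eC T1 hT l0 l1.
have mFE (A : set R) : measurable_fun A (fun u => (F lam u)%:E) by apply/measurable_EFinP; exact: mF.
have mi : measurable_fun (`]lam, 1%R] : set R) (fun u : R => (u^-1)%:E).
  apply/measurable_EFinP.
  apply: (eq_measurable_fun (fun u => u `^ (- 1))); last exact: measurable_powRl.
  move=> u; rewrite inE/= in_itv/= => /andP[u1 _].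
  by rewrite powR_inv1// ltW// (lt_trans l0).
have mG : measurable_fun (`]lam, 1%R] : set R) (fun u => (K + C * T * (lam * u `^ (- 2)))%:E).
  apply/measurable_EFinP; apply: measurable_funD => //; apply: measurable_funM => //.
  by apply: measurable_funM => //; exact: measurable_powRl.
have G0 u : 0 <= K + C * T * (lam * u `^ (- 2)).
  by rewrite addr_ge0 ?(ltW K0)// !mulr_ge0 ?powR_ge0 ?(ltW C0) ?(ltW l0)// (le_trans ler01).
have hG : (\int[mu]_(u in `]lam, 1%R]) (K + C * T * (lam * u `^ (- 2)))%:E <= (K + C * T)%:E)%E.
  have CT0 : 0 <= C * T by rewrite mulr_ge0 ?(ltW C0)// (le_trans ler01).
  have := mid_itv l0 l1 (lexx 0) CT0; rewrite mul0r add0r => h.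
  under eq_integral do rewrite EFinD.
  rewrite ge0_integralD//; last 3 first.
  - by move=> u _; rewrite lee_fin ltW.
  - by move=> u _; rewrite lee_fin !mulr_ge0 ?powR_ge0 ?(ltW C0) ?(ltW l0)// (le_trans ler01).
  - apply/measurable_EFinP; apply: measurable_funM => //.
    by apply: measurable_funM => //; exact: measurable_powRl.
  rewrite EFinD; apply: leeD.
    rewrite integral_cst//= lebesgue_measure_itv/= lte_fin l1 -EFinB -EFinM lee_fin.
    by rewrite ler_piMr ?(ltW K0)// gerBl ltW.
  apply: le_trans h; rewrite le_eqVlt; apply/orP; left; apply/eqP.
  by apply: eq_integral => u _; rewrite mul0r add0r.
have -> : ((C - e) * - ln lam)%:E = (\int[mu]_(u in `]lam, 1%R]) ((C - e)%:E * (u^-1)%:E))%E.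
  rewrite ge0_integralZl//.
  - by rewrite integral_inv_itv// ln1 sub0r EFinM.
  - move=> u; rewrite /= in_itv/= => /andP[u1 _]; rewrite lee_fin invr_ge0.
    by rewrite ltW// (lt_trans l0).
  - by rewrite lee_fin subr_ge0.
apply: (@le_trans _ _ (\int[mu]_(u in `]lam, 1%R]) (F lam u)%:E + (K + C * T)%:E)%E); last first.
  apply: leeD => //; apply: ge0_subset_integral => //.
  - exact: mFE.
  - by move=> u /=; rewrite in_itv/= andbT => u0; rewrite lee_fin F_ge0.
  - by move=> u /=; rewrite !in_itv/= andbT => /andP[u0 _]; exact: lt_trans u0.
apply: (@le_trans _ _ (\int[mu]_(u in `]lam, 1%R]) (F lam u)%:E +
    \int[mu]_(u in `]lam, 1%R]) (K + C * T * (lam * u `^ (- 2)))%:E)%E); last exact: leeD.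
have F0 u : `]lam, 1%R]%classic u -> (0 <= (F lam u)%:E)%E.
  by rewrite /= in_itv/= => /andP[u0 _]; rewrite lee_fin F_ge0// (lt_trans l0).
rewrite -ge0_integralD//; last by move=> u _; rewrite lee_fin.
apply: ge0_le_integral => //.
- move=> u; rewrite /= in_itv/= => /andP[u1 _]; rewrite -EFinM lee_fin mulr_ge0 ?subr_ge0// invr_ge0.
  by rewrite ltW// (lt_trans l0).
- by apply: emeasurable_funM => //; exact: mi.
- by apply: emeasurable_funD; [exact: mFE|exact: mG].
- move=> u; rewrite /= in_itv/= => /andP[u0 u1]; rewrite -EFinM -EFinD lee_fin.
  by apply: F_mid_ge => //; exact: lt_trans u0.
- exact: mFE.
Qed.

Lemma abel_log :
  (forall lam, 0 < lam -> (\int[mu]_(t in D) (k (lam * t) * p t)%:E)%E \is a fin_num) ->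
  lam `^ (1 - beta) * (\int[mu]_(t in D) (k (lam * t) * p t))%R / - ln lam @[lam --> 0^'+] --> C.
Proof.
move=> hf; pose X lam := lam `^ (1 - beta) * (\int[mu]_(t in D) (k (lam * t) * p t))%R.
have XE lam : 0 < lam -> (\int[mu]_(u in D) (F lam u)%:E = (X lam)%:E)%E.
  move=> l0; rewrite /F /r -(abel_scaling beta mp p0 mk k0 l0) /X /Rintegral EFinM fineK//.
  exact: hf.
have B0 : 0 <= B by apply: fine_ge0; apply: integral_ge0 => u _; rewrite lee_fin powR_ge0.
apply/cvgrPdist_le => e e0.
(* Half of [e] is for the main term and half for the bounded remainder; the minimum with [C] meets
   the requirement of [log_lower]. *)
pose e1 := Num.min (e / 2) C; have e10 : 0 < e1 by rewrite lt_min divr_gt0.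
have e1C : e1 <= C by rewrite ge_min lexx orbT.
have e1e : e1 <= e / 2 by rewrite ge_min lexx.
have [T [T1 hT]] : exists T, 1 <= T /\ forall t, T <= t -> `|r t - C| <= e1.
  have /cvgrPdist_le/(_ _ e10)[T0 [_ h]] := pC.
  exists (Num.max 1 (T0 + 1)); split; first by rewrite le_max lexx.
  move=> t; rewrite ge_max => /andP[_ h1]; rewrite distrC; apply: h.
  by apply: lt_le_trans h1; rewrite ltrDl.
(* Collects all bounded errors; lam < exp(-W / (e / 2)) makes them at most (e / 2) times -ln lam. *)
pose W := 1 + K * T + K * M * B + K + C * T.
have W0 : 0 <= W.
  have T0 := le_trans ler01 T1.
  by rewrite !addr_ge0// ?mulr_ge0// ltW.
near=> lam.
have l0 : 0 < lam by near: lam; exact: nbhs_right_gt.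
have l1 : lam < 1 by near: lam; exact: nbhs_right_lt.
have lW : lam < expR (- (W / (e / 2))) by near: lam; apply: nbhs_right_lt; exact: expR_gt0.
have L0 : 0 < - ln lam by rewrite oppr_gt0 ln_lt0// l0.
have LW : W <= e / 2 * - ln lam.
  rewrite mulrC -ler_pdivrMr ?divr_gt0// lerNr -[leRHS]expRK ler_ln ?posrE ?expR_gt0//.
  exact: ltW.
have := log_upper e10 T1 hT l0 l1; rewrite XE// lee_fin => hu.
have := log_lower e10 e1C T1 hT l0 l1; rewrite XE// -EFinD lee_fin => hl.
rewrite -/(X lam) distrC.
have -> : X lam / - ln lam - C = (X lam - C * - ln lam) / - ln lam.
  by field; rewrite -oppr_eq0 gt_eqF.
rewrite normrM normfV (gtr0_norm L0) ler_pdivrMr// ler_norml.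
have he : e1 * - ln lam <= e / 2 * - ln lam by rewrite ler_wpM2r// ltW.
have T0 := le_trans ler01 T1.
have K1 : 0 <= K * T by rewrite mulr_ge0// ltW.
have K2 : 0 <= K * M * B by rewrite !mulr_ge0// ltW.
have K3 : 0 <= C * T by rewrite mulr_ge0// ltW.
move: (ltW K0) K1 K2 K3 LW hu hl he; rewrite /W; move: (- ln lam) (X lam) (K * T) (K * M * B) (C * T) => L Y KT KB CT.
rewrite !mulrDl !mulNr; move: (e1 * L) (C * L) => eL CL; move=> *.
by apply/andP; split; lra.
Unshelve. all: by end_near. Qed.

End abelian_log.

(** * Laplace transforms in the five regimes *)

Section laplace.
Context {R : realType}.
Implicit Types (t u lam : R).
Local Notation mu := (@lebesgue_measure R).
Local Notation D := (`]0%R, +oo[%classic : set R).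
Variables (p : R -> R) (beta C K : R).
Hypotheses (mp : measurable_fun [set: R] p) (p0 : forall t, 0 < p t).
Hypotheses (p1 : forall t, p t <= 1) (C0 : 0 < C) (K0 : 0 < K).
Hypothesis pK : forall t, 0 < t -> p t <= K * t `^ (- beta).
Hypothesis pC : t `^ beta * p t @[t --> +oo] --> C.

Let mD : measurable (D : set (measurableTypeR R)).
Proof. exact: measurable_itv. Qed.

Definition laplace lam := (\int[mu]_(t in D) (expR (- (lam * t)) * p t))%R.

Let ker_exp u := expR (- u).
Let ker_1mexp u := 1 - expR (- u).

Let mexp : measurable_fun [set: R] ker_exp.
Proof. by apply: measurableT_comp. Qed.

Let m1mexp : measurable_fun [set: R] ker_1mexp.
Proof. exact: measurable_funB. Qed.

Let ker_1mexp_gt0 u : 0 < u -> 0 < ker_1mexp u.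
Proof. by move=> u0; rewrite subr_gt0 expR_lt1 oppr_lt0. Qed.

Let ker_1mexp_le1 u : ker_1mexp u <= 1.
Proof. by rewrite gerBl expR_ge0. Qed.

Let ker_1mexp_le u : ker_1mexp u <= u.
Proof. by rewrite /ker_1mexp; have := expR_ge1Dx (- u); lra. Qed.

(** From e^u >= 1 + u, the right side is at least u / (1 + u). This is the lower bound [k2] of the
    logarithmic case at beta = 2. *)
Let ker_1mexp_ge u : 0 < u -> u * (1 - u) <= ker_1mexp u.
Proof.
move=> u0; have h : 1 + u <= expR u by exact: expR_ge1Dx.
have hN : expR (- u) <= (1 + u)^-1 by rewrite expRN lef_pV2// posrE ?expR_gt0// addr_gt0.
apply: (@le_trans _ _ (1 - (1 + u)^-1)); last by rewrite lerD2l lerN2.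
have -> : 1 - (1 + u)^-1 = u / (1 + u) by field; rewrite gt_eqF// addr_gt0.
rewrite ler_wpM2l ?(ltW u0)// -[leRHS]mul1r ler_pdivlMr ?addr_gt0//.
have -> : (1 - u) * (1 + u) = 1 - u ^+ 2 by ring.
by rewrite gerBl sqr_ge0.
Qed.

Let le_scale_pmin M a b u (x : R) : x <= M * u `^ (- a) -> x <= M * u `^ (- b) -> x <= M * pmin a b u.
Proof. by rewrite /pmin; move=> h1 h2; rewrite minEle; case: ifP. Qed.

Let integrable_le (f g : R -> R) : measurable_fun D f -> mu.-integrable D (EFin \o g) ->
  (forall t, 0 < t -> 0 <= f t <= g t) -> mu.-integrable D (EFin \o f).
Proof.
move=> mf ig fg; apply: (le_integrable mD _ _ ig); first exact/measurable_EFinP.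
move=> t; rewrite /= in_itv/= andbT => /fg/andP[f0 fgt].
by rewrite lee_fin !ger0_norm// (le_trans f0).
Qed.

Lemma laplace_integrable lam : 0 < lam ->
  mu.-integrable D (EFin \o (fun t => expR (- (lam * t)) * p t)).
Proof.
(* As p <= 1, the exponential itself dominates; it is written as the case alpha = 1 of
   [integral_expRN_powR]. *)
move=> l0; apply: (@integrable_le _ (fun t => expR (- (lam * `|t| `^ 1)))).
- apply: measurable_funTS; apply: measurable_funM => //.
  by apply: measurableT_comp => //; apply: measurableT_comp => //; exact: measurable_funM.
- apply: (@integrableS _ _ _ _ setT) => //.
  have mf : measurable_fun [set: R] (fun t => expR (- (lam * `|t| `^ 1))).
    apply: measurableT_comp => //; apply: measurableT_comp => //; apply: measurable_funM => //.
    exact: (measurableT_comp (@measurable_powR R 1)).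
  apply/integrableP; split; first exact/measurable_EFinP.
  apply: le_lt_trans (integral_expRN_powR l0 ltr01); rewrite le_eqVlt; apply/orP; left; apply/eqP.
  by apply: eq_integral => t _; rewrite /= ger0_norm ?expR_ge0.
- move=> t t0; rewrite mulr_ge0 ?expR_ge0 ?(ltW (p0 _))//= gtr0_norm// powRr1 ?(ltW t0)//.
  by rewrite ler_piMr ?expR_ge0.
Qed.

(** p <= 1 handles small t and p <= K t^(-beta) large t. The case g = 0 gives the finiteness of G_0,
    the case g = 1 that of the first moment. *)
Lemma integrable_powR_return g : 0 <= g -> g < beta - 1 ->
  mu.-integrable D (EFin \o (fun t => t `^ g * p t)).
Proof.
move=> g0 gb.
have i : mu.-integrable D (EFin \o (fun t => (1 + K) * pmin (- g) (beta - g) t)).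
  by apply: (integrable_pmin (1 + K)); lra.
apply: integrable_le i _.
  by apply: measurable_funTS; apply: measurable_funM => //; exact: measurable_powR.
move=> t t0; rewrite mulr_ge0 ?powR_ge0 ?(ltW (p0 _))//=; apply: le_scale_pmin.
  rewrite opprK mulrC ler_wpM2r ?powR_ge0// (le_trans (p1 t))// lerDl; exact: ltW.
have -> : - (beta - g) = g + - beta by ring.
rewrite powRD; last by apply/implyP => _; exact: lt0r_neq0.
rewrite mulrCA ler_wpM2l ?powR_ge0// (le_trans (pK t0))// ler_wpM2r ?powR_ge0//.
by rewrite lerDr.
Qed.

Lemma integrable_return : 1 < beta -> mu.-integrable D (EFin \o p).
Proof.
move=> b1; have := @integrable_powR_return 0 (lexx _).
rewrite subr_gt0 => /(_ b1) i; apply: eq_integrable i => // t _.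
by rewrite /= powRr0 mul1r.
Qed.

(** e^(-u) u^(-beta) is integrable at 0 because beta < 1, and at infinity it is at most M u^(-2). *)
Lemma laplace_pow : beta < 1 -> exists2 c : R, 0 < c &
  lam `^ (1 - beta) * laplace lam @[lam --> 0^'+] --> c.
Proof.
move=> b1; have [M M0 hM] : exists2 M : R, 0 < M & forall u, 0 <= u -> u `^ (2 - beta) * expR (- u) <= M.
  by have [|M M0 h] := @powR_expRN_bound R (2 - beta); [lra|exists M].
have M1 : 0 <= 1 + M by rewrite addr_ge0// ltW.
have k0 u : 0 < u -> 0 < ker_exp u by move=> _; exact: expR_gt0.
have hk u : 0 < u -> ker_exp u * u `^ (- beta) <= (1 + M) * pmin beta 2 u.
  move=> u0; apply: le_scale_pmin.
    rewrite ler_wpM2r ?powR_ge0// (@le_trans _ _ 1)//; last by rewrite lerDl ltW.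
    by rewrite /ker_exp -[leRHS]expR0 ler_expR oppr_le0 ltW.
  have h := hM _ (ltW u0); rewrite /ker_exp.
  have -> : - beta = (2 - beta) + -2 by ring.
  rewrite powRD; last by apply/implyP => _; exact: lt0r_neq0.
  rewrite mulrA ler_wpM2r ?powR_ge0// mulrC (le_trans h)//.
  by rewrite lerDr.
exact: (abel_pow mp p0 C0 pK pC mexp k0 b1 (ltr1n R 2) M1 hk).
Qed.

(** At beta = 1 the comparison function u^(beta - 1) is 1, and the kernel lies between 1 - u and
    1. *)
Lemma laplace_log : beta = 1 -> laplace lam / - ln lam @[lam --> 0^'+] --> C.
Proof.
move=> b1; have [M M0 hM] : exists2 M : R, 0 < M & forall u, 0 <= u -> u `^ 1 * expR (- u) <= M.
  by have [|M M0 h] := @powR_expRN_bound R 1; [exact: ler01|exists M].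
have k0 u : 0 < u -> 0 < ker_exp u by move=> _; exact: expR_gt0.
have b1' : 1 <= beta by rewrite b1.
have k1 u : 0 < u -> ker_exp u <= u `^ (beta - 1).
  by move=> u0; rewrite b1 subrr powRr0 /ker_exp -[leRHS]expR0 ler_expR oppr_le0 ltW.
have k2 u : 0 < u -> u <= 1 -> u `^ (beta - 1) * (1 - u) <= ker_exp u.
  by move=> _ _; rewrite b1 subrr powRr0 mul1r; exact: expR_ge1Dx.
have k3 u : 1 <= u -> ker_exp u * u `^ (- beta) <= M * u `^ (- 2).
  move=> u1; have u0 : 0 < u by apply: lt_le_trans u1.
  have h := hM _ (ltW u0); rewrite /ker_exp b1.
  have -> : -1 = 1 + -2 :> R by ring.
  rewrite powRD; last by apply/implyP => _; exact: lt0r_neq0.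
  by rewrite mulrA ler_wpM2r ?powR_ge0// mulrC.
have hf lam : 0 < lam -> (\int[mu]_(t in D) (ker_exp (lam * t) * p t)%:E)%E \is a fin_num.
  by move=> l0; exact: integrable_fin_num (laplace_integrable l0).
have := abel_log mp p0 p1 C0 K0 pK pC mexp k0 b1' (ltW M0) k1 k2 k3 hf.
apply: cvg_trans; apply: near_eq_cvg; near=> lam.
by rewrite /laplace b1 subrr powRr0 mul1r.
Unshelve. all: by end_near. Qed.

Lemma laplace0 : laplace 0 = (\int[mu]_(t in D) p t)%R.
Proof. by apply: eq_Rintegral => t _; rewrite mul0r oppr0 expR0 mul1r. Qed.

Section recurrent_diff.
Hypothesis b1 : 1 < beta.

Lemma laplace_diff lam : 0 < lam ->
  mu.-integrable D (EFin \o (fun t => ker_1mexp (lam * t) * p t)) /\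
  laplace 0 - laplace lam = (\int[mu]_(t in D) (ker_1mexp (lam * t) * p t))%R.
Proof.
move=> l0; have ip := integrable_return b1; have il := laplace_integrable l0.
have e t : ker_1mexp (lam * t) * p t = p t - expR (- (lam * t)) * p t.
  by rewrite /ker_1mexp mulrBl mul1r.
split; last by rewrite laplace0 -RintegralB//; apply: eq_Rintegral => t _; rewrite e.
apply: eq_integrable (integrableB mD ip il) => // t _.
by rewrite /= e.
Qed.

(** 1 - e^(-u) is at most min(u, 1), so the majorant has exponent beta - 1 at 0 and beta at
    infinity; integrability at the two ends amounts to 1 < beta < 2. *)
Lemma laplace_diff_pow : beta < 2 -> exists2 c : R, 0 < c &
  lam `^ (1 - beta) * (laplace 0 - laplace lam) @[lam --> 0^'+] --> c.
Proof.
move=> b2.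
have hk u : 0 < u -> ker_1mexp u * u `^ (- beta) <= 1 * pmin (beta - 1) beta u.
  move=> u0; apply: le_scale_pmin; last by rewrite ler_wpM2r ?powR_ge0.
  rewrite opprB mul1r powRD; last by apply/implyP => _; exact: lt0r_neq0.
  by rewrite powRr1 ?(ltW u0)// ler_wpM2r ?powR_ge0.
have b1' : beta - 1 < 1 by lra.
have [c c0 h] := abel_pow mp p0 C0 pK pC m1mexp ker_1mexp_gt0 b1' b1 ler01 hk.
exists c => //; apply: cvg_trans h; apply: near_eq_cvg; near=> lam.
have l0 : 0 < lam by near: lam; exact: nbhs_right_gt.
by have [_ ->] := laplace_diff l0.
Unshelve. all: by end_near. Qed.

(** At beta = 2 the comparison function u^(beta - 1) is [u], and 1 - e^(-u) lies between u (1 - u)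
    and u on ]0, 1]. *)
Lemma laplace_diff_log : beta = 2 ->
  lam^-1 * (laplace 0 - laplace lam) / - ln lam @[lam --> 0^'+] --> C.
Proof.
move=> b2.
have bE : beta - 1 = 1 by rewrite b2; ring.
have k1 u : 0 < u -> ker_1mexp u <= u `^ (beta - 1).
  by move=> u0; rewrite bE powRr1// ltW.
have k2 u : 0 < u -> u <= 1 -> u `^ (beta - 1) * (1 - u) <= ker_1mexp u.
  by move=> u0 u1; rewrite bE powRr1 ?(ltW u0)// ker_1mexp_ge.
have k3 u : 1 <= u -> ker_1mexp u * u `^ (- beta) <= 1 * u `^ (- 2).
  by move=> u1; rewrite b2 ler_wpM2r ?powR_ge0.
have hf lam : 0 < lam -> (\int[mu]_(t in D) (ker_1mexp (lam * t) * p t)%:E)%E \is a fin_num.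
  by move=> l0; have [i _] := laplace_diff l0; exact: integrable_fin_num i.
have := abel_log mp p0 p1 C0 K0 pK pC m1mexp ker_1mexp_gt0 (ltW b1) ler01 k1 k2 k3 hf.
apply: cvg_trans; apply: near_eq_cvg; near=> lam.
have l0 : 0 < lam by near: lam; exact: nbhs_right_gt.
have [_ ->] := laplace_diff l0.
have -> : 1 - beta = -1 by rewrite b2; ring.
by rewrite powR_inv1// ltW.
Unshelve. all: by end_near. Qed.

(** No rescaling here: (1 - e^(-lam t)) / lam lies between t (1 - lam t) and t, so dominated
    convergence by t p(t) applies and the constant is the first moment of [p]. *)
Lemma laplace_diff_lin : 2 < beta -> exists2 c : R, 0 < c &
  lam^-1 * (laplace 0 - laplace lam) @[lam --> 0^'+] --> c.
Proof.
move=> b2.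
have i1 : mu.-integrable D (EFin \o (fun t => t * p t)).
  have b2' : 1 < beta - 1 by lra.
  have := integrable_powR_return ler01 b2'; apply: eq_integrable => // t.
  by rewrite inE/= in_itv/= andbT => t0; rewrite powRr1// ltW.
exists (\int[mu]_(t in D) (t * p t))%R.
  apply: (Rintegral_gt0 mD mu_posaxis_neq0 i1) => t.
  by rewrite /= in_itv/= andbT => t0; rewrite mulr_gt0.
apply/cvg_at_rightP => v [v0 cv].
have mf n : measurable_fun D (fun t => (v n)^-1 * (ker_1mexp (v n * t) * p t)).
  apply: measurable_funTS; apply: measurable_funM => //; apply: measurable_funM => //.
  by apply: (measurableT_comp m1mexp); exact: measurable_funM.
have cf t : D t -> (v n)^-1 * (ker_1mexp (v n * t) * p t) @[n --> \oo] --> t * p t.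
  rewrite /= in_itv/= andbT => t0.
  have u0 n : 0 < v n * t by rewrite mulr_gt0.
  suff h : (v n)^-1 * ker_1mexp (v n * t) @[n --> \oo] --> t.
    rewrite [X in X @ _ --> _](_ : _ = fun n => (v n)^-1 * ker_1mexp (v n * t) * p t).
      exact: cvgMl.
    by apply/funext => n; rewrite mulrA.
  apply: (@squeeze_cvgr _ _ _ _ (fun n => t * (1 - v n * t)) (fun=> t)) => //.
    apply: nearW => n; rewrite ler_pdivlMl ?ler_pdivrMl// ker_1mexp_le andbT.
    by rewrite mulrA ker_1mexp_ge.
    rewrite -[X in _ --> X]mulr1; apply: cvgMr.
    rewrite -[X in _ --> X](subr0 1); apply: cvgB; first exact: cvg_cst.
    by rewrite -(mul0r t); exact: cvgMl.
  exact: cvg_cst.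
have df n t : D t -> (`|(v n)^-1 * (ker_1mexp (v n * t) * p t)|%:E <= (t * p t)%:E)%E.
  rewrite /= in_itv/= andbT => t0; rewrite lee_fin ger0_norm; last first.
    by rewrite mulr_ge0 ?invr_ge0 ?(ltW (v0 n))// mulr_ge0 ?(ltW (p0 _))// ltW// ker_1mexp_gt0// mulr_gt0.
  by rewrite mulrA ler_wpM2r ?(ltW (p0 _))// ler_pdivrMl// ker_1mexp_le.
have [_ _] := dominated_cvg_Rintegral mD mf cf i1 df.
apply: cvg_trans; apply: near_eq_cvg; near=> n.
have [i ->] := laplace_diff (v0 n).
by rewrite RintegralZl.
Unshelve. all: by end_near. Qed.

End recurrent_diff.
End laplace.

(** * From Laplace transforms to the Green function *)

Lemma equiv0_of_cvg (R : realType) (f g h : R -> R) (c : R) : c != 0 ->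
  h x @[x --> 0^'+] --> c -> (forall x, 0 < x -> x < 1 -> f x / g x = h x / c) -> equiv0 f g.
Proof.
move=> c0 hc fg; rewrite /equiv0 -(mulfV c0).
have hc1 : h x / c @[x --> 0^'+] --> c / c by exact: cvgMl.
apply: cvg_trans hc1; apply: near_eq_cvg; near=> x; apply/esym/fg.
  by near: x; exact: nbhs_right_gt.
by near: x; exact: nbhs_right_lt.
Unshelve. all: by end_near. Qed.

Lemma measurable_ret_norm (R : realType) d (a : 'rV[int]_d -> R) : rw_intensity a ->
  measurable_fun [set: R] (fun t => ret a `|t|).
Proof.
move=> ha; apply: (measurable_comp _ _ (measurable_ret ha)) => //.
by move=> _ [t _ <-]; rewrite /= in_itv/= andbT.
Qed.

(** Integrability guarantees that [laplace] is the true value of the integral and not the default of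
    [fine]; the single point t = 0 has measure zero. *)
Lemma green_laplace (R : realType) d (a : 'rV[int]_d -> R) (lam : R) : rw_intensity a ->
  lebesgue_measure.-integrable `]0%R, +oo[
    (EFin \o (fun t : R => expR (- (lam * t)) * ret a `|t|)) ->
  green a lam = (laplace (fun t => ret a `|t|) lam)%:E.
Proof.
move=> ha i; rewrite /green /laplace /Rintegral fineK; last first.
  exact: integrable_fin_num i.
rewrite integral_itv_obnd_cbnd; last by case/integrableP : i.
apply: eq_integral => t; rewrite inE/= in_itv/= andbT => t0.
by rewrite trans_prob_ret// ger0_norm.
Qed.

Theorem theorem3 (R : realType) (d : nat) (a : 'rV[int]_d -> R) (alpha : R)
    (H : 'rV[R]_d -> R) :
  (0 < d)%N ->
  rw_intensity a ->
  0 < alpha < 2 ->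
  {within @usphere R d, continuous H} ->
  (forall u, @usphere R d u -> 0 < H u) ->
  (forall u, @usphere R d u -> H (- u) = H u) ->
  (forall e : R, 0 < e -> exists M : R, forall z : 'rV[int]_d, M < @znorm R d z ->
      `| a z * @znorm R d z `^ (d%:R + alpha) / H (@zdir R d z) - 1 | < e) ->
  let finiteG (Gr : R -> R) := forall lam, 0 < lam -> green a lam = (Gr lam)%:E in
  (* (i) *)
  ((d = 1%N /\ 1 < alpha < 2) ->
     exists2 gamma : R, 0 < gamma & exists Gr, finiteG Gr /\
       equiv0 Gr (fun lam => gamma * lam `^ ((1 - alpha) / alpha))) /\
  (* (ii) *)
  ((d = 1%N /\ alpha = 1) ->
     exists2 gamma : R, 0 < gamma & exists Gr, finiteG Gr /\
       equiv0 Gr (fun lam => - (gamma * ln lam))) /\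
  (* (iii) *)
  ([\/ d = 1%N /\ 2^-1 < alpha < 1, d = 2%N /\ 1 < alpha < 2
     | d = 3%N /\ 3 / 2 < alpha < 2] ->
     exists2 gamma : R, 0 < gamma & exists Gr, finiteG Gr /\
       exists G0 : R, green a 0 = G0%:E /\
       equiv0 (fun lam => Gr lam - G0)
              (fun lam => - (gamma * lam `^ ((d%:R - alpha) / alpha)))) /\
  (* (iv) *)
  ([\/ d = 1%N /\ alpha = 2^-1, d = 2%N /\ alpha = 1
     | d = 3%N /\ alpha = 3 / 2] ->
     exists2 gamma : R, 0 < gamma & exists Gr, finiteG Gr /\
       exists G0 : R, green a 0 = G0%:E /\
       equiv0 (fun lam => Gr lam - G0) (fun lam => gamma * lam * ln lam)) /\
  (* (v) *)
  ([\/ d = 1%N /\ alpha < 2^-1, d = 2%N /\ alpha < 1,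
       d = 3%N /\ alpha < 3 / 2 | (4 <= d)%N] ->
     exists2 gamma : R, 0 < gamma & exists Gr, finiteG Gr /\
       exists G0 : R, green a 0 = G0%:E /\
       equiv0 (fun lam => Gr lam - G0) (fun lam => - (gamma * lam))).
Proof.
move=> d0 ha a02 cH H0 _ aH finiteG; have /andP[alpha0 alpha2] := a02.
(* [ret a] is meaningful for t >= 0 only; the absolute value makes p globally
   positive and measurable without changing its Laplace transform. *)
pose p (t : R) := ret a `|t|; pose beta := d%:R / alpha.
have mp : measurable_fun [set: R] p by exact: measurable_ret_norm.
have p0 t : 0 < p t by exact: ret_gt0.
have p1 t : p t <= 1 by exact: ret_le1.
have [K K0 rK] := ret_upper d0 ha a02 cH H0 aH.
have pK t : 0 < t -> p t <= K * t `^ (- beta) by move=> t0; rewrite /p gtr0_norm// rK.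
have [C C0 rC] := local_limit d0 ha a02 cH H0 aH.
have pC : t `^ beta * p t @[t --> +oo] --> C.
  apply: cvg_trans rC; apply: near_eq_cvg; near=> t.
  by rewrite /p ger0_norm//; near: t; exact: nbhs_pinfty_ge.
have fG : finiteG (laplace p).
  by move=> lam l0; apply: green_laplace => //; exact: laplace_integrable.
have g0 : 1 < beta -> green a 0 = (laplace p 0)%:E.
  move=> b1; apply: green_laplace => //.
  apply: eq_integrable (integrable_return mp p0 p1 K0 pK b1) => // t _.
  by rewrite /= mul0r oppr0 expR0 mul1r.
have powV (lam : R) : 0 < lam -> lam `^ (beta - 1) = (lam `^ (1 - beta))^-1.
  by move=> l0; rewrite -powRN opprB.
have powN0 (lam r : R) : 0 < lam -> lam `^ r != 0 by move=> l0; rewrite gt_eqF// powR_gt0.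
have exponent : (d%:R - alpha) / alpha = beta - 1.
  by rewrite mulrBl mulfV// gt_eqF.
(* Staying below 1 keeps the logarithm nonzero, so the quotients by it are genuine; this is why
   [equiv0_of_cvg] compares on ]0, 1[ only. *)
have lnN0 (lam : R) : 0 < lam -> lam < 1 -> ln lam != 0.
  by move=> l0 l1; rewrite lt_eqF// ln_lt0// l0.
have b_lt x : 0 < x -> (beta < x) = (d%:R < x * alpha).
  by move=> x0; rewrite ltr_pdivrMr.
have b_gt x : 0 < x -> (x < beta) = (x * alpha < d%:R).
  by move=> x0; rewrite ltr_pdivlMr.
have b_eq x : d%:R = x * alpha -> beta = x.
  by move=> h; rewrite /beta h mulfK// gt_eqF.
split; [|split; [|split; [|split]]].
- move=> [d1 /andP[a1 _]].
  have b1 : beta < 1 by rewrite b_lt// mul1r d1.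
  have [c c0 h] := laplace_pow mp p0 C0 pK pC b1.
  exists c => //; exists (laplace p); split => //.
  apply: (equiv0_of_cvg _ h); first exact: lt0r_neq0.
  have -> : (1 - alpha) / alpha = beta - 1 by rewrite -exponent d1.
  move=> lam l0 _; rewrite powV//; field.
  by rewrite powN0//= gt_eqF.
- move=> [d1 a1]; have b1 : beta = 1 by apply: b_eq; rewrite d1 a1 mulr1.
  exists C => //; exists (laplace p); split => //.
  apply: (equiv0_of_cvg _ (laplace_log mp p0 p1 C0 K0 pK pC b1)); first exact: lt0r_neq0.
  by move=> lam l0 l1; field; rewrite lnN0//= gt_eqF.
(* In all three cases alpha < d < 2 alpha, that is 1 < beta < 2. *)
- move=> hd; have [b1 b2] : 1 < beta /\ beta < 2.
    rewrite b_gt// b_lt//; case: hd => -[-> /andP[h1 h2]]; split; lra.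
  have [c c0 h] := laplace_diff_pow mp p0 p1 C0 K0 pK pC b1 b2.
  exists c => //; exists (laplace p); split => //.
  exists (laplace p 0); split; first exact: g0.
  apply: (equiv0_of_cvg _ h); first exact: lt0r_neq0.
  move=> lam l0 _; rewrite exponent powV//; field.
  by rewrite powN0//= gt_eqF.
- move=> hd; have b2 : beta = 2.
    by apply: b_eq; case: hd => -[-> ->]; lra.
  have b1 : 1 < beta by rewrite b2 ltr1n.
  exists C => //; exists (laplace p); split => //.
  exists (laplace p 0); split; first exact: g0.
  apply: (equiv0_of_cvg _ (laplace_diff_log mp p0 p1 C0 K0 pK pC b1 b2)); first exact: lt0r_neq0.
  by move=> lam l0 l1; field; rewrite lnN0//= !gt_eqF.
(* For d >= 4 the inequality d > 2 alpha follows from alpha < 2 alone. *)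
- move=> hd; have b2 : 2 < beta.
    rewrite b_gt//; case: hd => [[-> h]|[-> h]|[-> h]|h]; [lra|lra|lra|].
    have : 4%:R <= d%:R :> R by rewrite ler_nat.
    by move: (d%:R) => D h4; lra.
  have b1 : 1 < beta by apply: lt_trans b2; rewrite ltr1n.
  have [c c0 h] := laplace_diff_lin mp p0 p1 K0 pK b1 b2.
  exists c => //; exists (laplace p); split => //.
  exists (laplace p 0); split; first exact: g0.
  apply: (equiv0_of_cvg _ h); first exact: lt0r_neq0.
  by move=> lam l0 _; field; rewrite !gt_eqF.
Unshelve. all: by end_near. Qed.
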